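(* Let $n,m$ be positive integers and let $\mathcal M$ be a symmetric positive definite, unimodular even integral matrix of degree $m$. Define $$\Theta_{\mathcal M}(\Omega,Z)=\sum_{\xi\in\mathbb Z^{(m,n)}}e^{\pi i\,\sigma(\mathcal M(\xi\,\Omega\,{}^t\xi+2\,\xi\,{}^tZ))},\qquad(\Omega,Z)\in\mathbb H_{n,m}.$$ Then there is a uniquely determined character $\rho_{\mathcal M}$ of $\Gamma^J$, with $|\rho_{\mathcal M}(\widetilde\gamma)|^8=1$ for all $\widetilde\gamma\in\Gamma^J$, such that for every $\widetilde\gamma=(\gamma,(\lambda,\mu;\kappa))\in\Gamma^J$ with $\gamma\in\Gamma_n$ and $(\lambda,\mu;\kappa)\in H_{\mathbb Z}^{(n,m)}$, $$\Theta_{\mathcal M}\big(\widetilde\gamma\cdot(\Omega,Z)\big)=\rho_{\mathcal M}(\widetilde\gamma)\,J_{\mathcal M}\big(\widetilde\gamma,(\Omega,Z)\big)\,\Theta_{\mathcal M}(\Omega,Z),\qquad(\Omega,Z)\in\mathbb H_{n,m}.$$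
   Context: Notation: $F^{(k,l)}$ is the set of $k\times l$ matrices over $F$; ${}^tM$ is the transpose; $\sigma(\cdot)$ is the trace; $i=\sqrt{-1}$; $z^{k/2}=(z^{1/2})^k$ with $-\pi/2<\arg z^{1/2}\le\pi/2$. $\mathbb H_n=\{\Omega\in\mathbb C^{(n,n)}: \Omega={}^t\Omega,\ \mathrm{Im}\,\Omega>0\}$, and $\mathbb H_{n,m}=\mathbb H_n\times\mathbb C^{(m,n)}$. Unimodular means determinant $1$; an even integral matrix is an integral symmetric matrix with even diagonal entries. $H_{\mathbb R}^{(n,m)}=\{(\lambda,\mu;\kappa): \lambda,\mu\in\mathbb R^{(m,n)},\ \kappa\in\mathbb R^{(m,m)},\ \kappa+\mu\,{}^t\lambda\text{ symmetric}\}$ with $(\lambda,\mu;\kappa)\circ(\lambda',\mu';\kappa')=(\lambda+\lambda',\mu+\mu';\kappa+\kappa'+\lambda\,{}^t\mu'-\mu\,{}^t\lambda')$, and $H_{\mathbb Z}^{(n,m)}$ is the subgroup of elements with $\lambda,\mu,\kappa$ integral. The Jacobi group is $G^J=Sp(n,\mathbb R)\ltimes H_{\mathbb R}^{(n,m)}$ with $(g,(\lambda,\mu;\kappa))\cdot(g',(\lambda',\mu';\kappa'))=(gg',(\widetilde\lambda+\lambda',\widetilde\mu+\mu';\kappa+\kappa'+\widetilde\lambda\,{}^t\mu'-\widetilde\mu\,{}^t\lambda'))$, where $(\widetilde\lambda,\widetilde\mu)=(\lambda,\mu)g'$. $\Gamma_n=Sp(n,\mathbb Z)$ and $\Gamma^J=\Gamma_n\ltimes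 H_{\mathbb Z}^{(n,m)}$. $G^J$ acts on $\mathbb H_{n,m}$ by $(g,(\lambda,\mu;\kappa))\cdot(\Omega,Z)=\big((A\Omega+B)(C\Omega+D)^{-1},(Z+\lambda\Omega+\mu)(C\Omega+D)^{-1}\big)$ for $g=\begin{pmatrix}A&B\\C&D\end{pmatrix}$. The automorphic factor $J_{\mathcal M}:G^J\times\mathbb H_{n,m}\to\mathbb C^\times$ is $$J_{\mathcal M}((g,(\lambda,\mu;\kappa)),(\Omega,Z))=e^{\pi i\,\sigma(\mathcal M(Z+\lambda\Omega+\mu)(C\Omega+D)^{-1}C\,{}^t(Z+\lambda\Omega+\mu))}\,e^{-\pi i\,\sigma(\mathcal M(\lambda\Omega\,{}^t\lambda+2\lambda\,{}^tZ+\kappa+\mu\,{}^t\lambda))}\det(C\Omega+D)^{m/2}.$$ *)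

(* Defs.v *)
From HB Require Import structures.
From mathcomp Require Import all_boot all_order all_algebra.
From mathcomp Require Import finmap complex.
From mathcomp Require Import all_classical all_reals all_analysis.
From mathcomp.analysis.showcase Require summability.
From mathcomp Require Import ring.

Set Implicit Arguments.
Unset Strict Implicit.
Unset Printing Implicit Defensive.

Import Order.TTheory GRing.Theory Num.Theory.
Import numFieldNormedType.Exports.

Local Open Scope ring_scope.

(* Sp(n, S), the Heisenberg group and the Jacobi group are defined over an    *)
(* arbitrary commutative ring S, so that S = R gives Sp(n, R), H_R, G^J and   *)
(* S = int gives Sp(n, Z), H_Z, Gamma^J; the inclusion Gamma^J -> G^J is      *)
(* [jacobi_map intr].                                                         *)

Section Symplectic.
Variables (S : comNzRingType) (n : nat).

Definition symp_form : 'M[S]_(n + n) := block_mx 0 1%:M (- 1%:M) 0.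

Definition symplectic (g : 'M[S]_(n + n)) : bool :=
  g^T *m symp_form *m g == symp_form.

Record sp : Type := Sp { sp_mx :> 'M[S]_(n + n); spP : symplectic sp_mx }.

HB.instance Definition _ := [isSub for sp_mx].
HB.instance Definition _ := [Choice of sp by <:].

Lemma symp_formN : symp_form *m (- symp_form) = 1%:M.
Proof.
rewrite /symp_form opp_block_mx mulmx_block !(mul0mx, mulmx0, oppr0, opprK).
by rewrite mulmx1 !mulmxN !mulNmx mulmx1 !opprK !add0r !addr0 -scalar_mx_block.
Qed.

Lemma tr_symp_form : symp_form^T = - symp_form.
Proof.
by rewrite tr_block_mx opp_block_mx !trmx0 linearN /= trmx1 !oppr0 opprK.
Qed.

Lemma symplectic1 : symplectic 1%:M.
Proof. by rewrite /symplectic trmx1 mul1mx mulmx1. Qed.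

Lemma symplecticM (g h : sp) : symplectic (g *m h).
Proof.
apply/eqP; rewrite trmx_mul !mulmxA -(mulmxA _ g^T) -(mulmxA _ (g^T *m _)).
by rewrite (eqP (spP g)) (eqP (spP h)).
Qed.

Definition sp_inv_mx (g : 'M[S]_(n + n)) : 'M[S]_(n + n) :=
  - symp_form *m g^T *m symp_form.

Lemma sp_mulVmx (g : sp) : sp_inv_mx g *m g = 1%:M.
Proof.
rewrite /sp_inv_mx -!mulmxA (mulmxA g^T) (eqP (spP g)) mulNmx -mulmxN.
exact: symp_formN.
Qed.

Lemma sp_mulmxV (g : sp) : g *m sp_inv_mx g = 1%:M.
Proof. exact: mulmx1C (sp_mulVmx g). Qed.

Lemma symplecticV (g : sp) : symplectic (sp_inv_mx g).
Proof.
have := sp_mulmxV g; move: (sp_inv_mx g) => h gh; apply/eqP.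
rewrite -[in X in X = _](eqP (spP g)) !mulmxA -trmx_mul gh trmx1 mul1mx.
by rewrite -mulmxA gh mulmx1.
Qed.

Definition sp_one := Sp symplectic1.
Definition sp_mul (g h : sp) := Sp (symplecticM g h).
Definition sp_inv (g : sp) := Sp (symplecticV g).

Lemma sp_mulA : associative sp_mul.
Proof. by move=> g h k; apply: val_inj; rewrite /= mulmxA. Qed.
Lemma sp_mul1 : left_id sp_one sp_mul.
Proof. by move=> g; apply: val_inj; rewrite /= mul1mx. Qed.
Lemma sp_mulr1 : right_id sp_one sp_mul.
Proof. by move=> g; apply: val_inj; rewrite /= mulmx1. Qed.
Lemma sp_mulV : left_inverse sp_one sp_inv sp_mul.
Proof. by move=> g; apply: val_inj; rewrite /= sp_mulVmx. Qed.
Lemma sp_mulrV : right_inverse sp_one sp_inv sp_mul.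
Proof. by move=> g; apply: val_inj; rewrite /= sp_mulmxV. Qed.

HB.instance Definition _ :=
  isGroup.Build sp sp_mulA sp_mul1 sp_mulr1 sp_mulV sp_mulrV.

Lemma sp_mul_symp_tr (g : sp) : g *m symp_form *m g^T = symp_form.
Proof.
have JJ : symp_form *m symp_form = - 1%:M.
  by rewrite -symp_formN mulmxN opprK.
rewrite -[RHS]mul1mx -(sp_mulmxV g) /sp_inv_mx -!mulmxA JJ.
by rewrite !(mulmxN, mulNmx) opprK mulmx1.
Qed.

End Symplectic.

Section Jacobi.
Variables (S : comNzRingType) (n m : nat).

Definition heis_cond (x : 'M[S]_(m, n) * 'M[S]_(m, n) * 'M[S]_m) : bool :=
  let: (lam, mu, kap) := x in
  (kap + mu *m lam^T)^T == kap + mu *m lam^T.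

Record heis : Type := Heis {
  heis_val : 'M[S]_(m, n) * 'M[S]_(m, n) * 'M[S]_m;
  heisP : heis_cond heis_val }.

HB.instance Definition _ := [isSub for heis_val].
HB.instance Definition _ := [Choice of heis by <:].

Definition hlam (h : heis) : 'M[S]_(m, n) := (heis_val h).1.1.
Definition hmu (h : heis) : 'M[S]_(m, n) := (heis_val h).1.2.
Definition hkap (h : heis) : 'M[S]_m := (heis_val h).2.

(* (lambda, mu) as a single m x 2n matrix, on which Sp(n, S) acts on the right. *)
Definition hrow (h : heis) : 'M[S]_(m, n + n) := row_mx (hlam h) (hmu h).

Record jacobi : Type := Jacobi { jsp : sp S n; jheis : heis }.

Definition jacobi_pair (x : jacobi) := (jsp x, jheis x).
Definition pair_jacobi (p : sp S n * heis) := Jacobi p.1 p.2.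
Lemma jacobi_pairK : cancel jacobi_pair pair_jacobi. Proof. by case. Qed.

HB.instance Definition _ := Choice.copy jacobi (can_type jacobi_pairK).

(* lambda tmu' - mu tlambda' for v = (lambda, mu) and w = (lambda', mu') *)
Definition hform (v w : 'M[S]_(m, n + n)) : 'M[S]_m :=
  lsubmx v *m (rsubmx w)^T - rsubmx v *m (lsubmx w)^T.

Lemma hformE v w : hform v w = v *m symp_form S n *m w^T.
Proof.
rewrite -[v in RHS]hsubmxK -[w in RHS]hsubmxK tr_row_mx mul_row_block.
by rewrite !(mulmx0, mulmxN, mulmx1) add0r addr0 mul_row_col mulNmx addrC.
Qed.

Lemma hform_sp (g : sp S n) v w : hform (v *m g) (w *m g) = hform v w.
Proof.
by rewrite !hformE trmx_mul !mulmxA -(mulmxA v) -(mulmxA v) sp_mul_symp_tr.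
Qed.

Lemma hformDl u v w : hform (u + v) w = hform u w + hform v w.
Proof. by rewrite !hformE !mulmxDl. Qed.
Lemma hformDr u v w : hform u (v + w) = hform u v + hform u w.
Proof. by rewrite !hformE linearD /= mulmxDr. Qed.
Lemma hformNl v w : hform (- v) w = - hform v w.
Proof. by rewrite !hformE !mulNmx. Qed.
Lemma hformNr v w : hform v (- w) = - hform v w.
Proof. by rewrite !hformE linearN /= !mulmxN. Qed.
Lemma hform0l w : hform 0 w = 0.
Proof. by rewrite !hformE !mul0mx. Qed.
Lemma hform0r w : hform w 0 = 0.
Proof. by rewrite !hformE trmx0 mulmx0. Qed.
Lemma tr_hform v w : (hform v w)^T = - hform w v.
Proof.
by rewrite !hformE !trmx_mul trmxK tr_symp_form mulNmx mulmxN mulmxA.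
Qed.

(* kappa + mu tlambda is symmetric iff kappa - tkappa = lambda tmu - mu tlambda *)
Lemma heis_condE (v : 'M[S]_(m, n + n)) (k : 'M[S]_m) :
  heis_cond (lsubmx v, rsubmx v, k) = (k - k^T == hform v v).
Proof.
rewrite /heis_cond /hform linearD /= trmx_mul trmxK.
by rewrite [RHS]subr_eq addrAC [RHS]eq_sym [RHS]subr_eq [in RHS]addrC.
Qed.

Lemma hrowK (v : 'M[S]_(m, n + n)) k (H : heis_cond (lsubmx v, rsubmx v, k)) :
  hrow (Heis H) = v.
Proof. exact: hsubmxK. Qed.

Lemma heis_hform (h : heis) : hkap h - (hkap h)^T = hform (hrow h) (hrow h).
Proof.
by case: h => [[[l u] k] H]; apply/eqP; rewrite -heis_condE row_mxKl row_mxKr.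
Qed.

Lemma heis_ext (h h' : heis) : hrow h = hrow h' -> hkap h = hkap h' -> h = h'.
Proof.
move=> /eq_row_mx[el eu] ek; apply: val_inj => /=; move: el eu ek.
rewrite /hlam /hmu /hkap.
by case: (heis_val h) (heis_val h') => [[? ?] ?] [[? ?] ?] /= -> -> ->.
Qed.

Lemma jacobi_ext (x y : jacobi) : jsp x = jsp y ->
  hrow (jheis x) = hrow (jheis y) -> hkap (jheis x) = hkap (jheis y) -> x = y.
Proof.
case: x y => [g h] [g' h'] /= -> er ek; congr Jacobi; exact: heis_ext.
Qed.

(* (g, (l, u; k)) (g', (l', u'; k')) =                                        *)
(*   (g g', (lt + l', ut + u'; k + k' + lt tu' - ut tl')), (lt, ut) = (l, u) g' *)
Definition jmul_heis_val (x y : jacobi) :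
    'M[S]_(m, n) * 'M[S]_(m, n) * 'M[S]_m :=
  let lt := lsubmx (hrow (jheis x) *m jsp y) in
  let ut := rsubmx (hrow (jheis x) *m jsp y) in
  (lt + hlam (jheis y), ut + hmu (jheis y),
   hkap (jheis x) + hkap (jheis y)
     + (lt *m (hmu (jheis y))^T - ut *m (hlam (jheis y))^T)).

Lemma jmul_heis_valE x y :
  let v := hrow (jheis x) *m jsp y in
  jmul_heis_val x y = (lsubmx (v + hrow (jheis y)), rsubmx (v + hrow (jheis y)),
   hkap (jheis x) + hkap (jheis y) + hform v (hrow (jheis y))).
Proof.
by rewrite /jmul_heis_val /hform !linearD /= /hrow row_mxKl row_mxKr.
Qed.

Lemma jmul_heisP x y : heis_cond (jmul_heis_val x y).
Proof.
rewrite jmul_heis_valE heis_condE hformDl !hformDr hform_sp -!heis_hform.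
set v := _ *m _; set w := hrow (jheis y).
move: (hkap (jheis x)) (hkap (jheis y)) (hform v w) (hform w v) (tr_hform v w).
move=> k k' a b ab; apply/eqP/matrixP => i j.
have := congr1 (fun A : 'M[S]_m => A i j) ab.
by rewrite !mxE => ->; ring.
Qed.

Definition jone_heis_val : 'M[S]_(m, n) * 'M[S]_(m, n) * 'M[S]_m := (0, 0, 0).
Lemma jone_heisP : heis_cond jone_heis_val.
Proof. by rewrite /heis_cond /= mul0mx addr0 trmx0. Qed.

Definition jinv_heis_val (x : jacobi) : 'M[S]_(m, n) * 'M[S]_(m, n) * 'M[S]_m :=
  let v := - (hrow (jheis x) *m sp_inv (jsp x)) in
  (lsubmx v, rsubmx v, - hkap (jheis x) + hform v v).
Lemma jinv_heisP x : heis_cond (jinv_heis_val x).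
Proof.
rewrite heis_condE; set v := - (_ *m _).
have -> : hform v v = hkap (jheis x) - (hkap (jheis x))^T.
  by rewrite /v hformNl hformNr opprK hform_sp -heis_hform.
move: (hkap _) => k; apply/eqP/matrixP => i j; rewrite !mxE; ring.
Qed.

Definition jacobi_one := Jacobi (sp_one S n) (Heis jone_heisP).
Definition jacobi_mul (x y : jacobi) :=
  Jacobi (sp_mul (jsp x) (jsp y)) (Heis (jmul_heisP x y)).
Definition jacobi_inv (x : jacobi) :=
  Jacobi (sp_inv (jsp x)) (Heis (jinv_heisP x)).

Lemma hrow_jmul x y : hrow (jheis (jacobi_mul x y)) =
  hrow (jheis x) *m jsp y + hrow (jheis y).
Proof.
by rewrite {1}/hrow /hlam /hmu /= -[RHS]hsubmxK !linearD /= /hrow row_mxKl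
  row_mxKr.
Qed.
Lemma hkap_jmul x y : hkap (jheis (jacobi_mul x y)) =
  hkap (jheis x) + hkap (jheis y) + hform (hrow (jheis x) *m jsp y) (hrow (jheis y)).
Proof. exact: (congr1 snd (jmul_heis_valE x y)). Qed.
Lemma hrow_jone : hrow (jheis jacobi_one) = 0.
Proof. exact: row_mx0. Qed.
Lemma hrow_jinv x :
  hrow (jheis (jacobi_inv x)) = - (hrow (jheis x) *m sp_inv (jsp x)).
Proof. exact: hsubmxK. Qed.

Lemma hkap_jinv x : hkap (jheis (jacobi_inv x)) =
  - hkap (jheis x) + hform (hrow (jheis x)) (hrow (jheis x)).
Proof.
rewrite -[RHS](congr1 (fun A => _ + A) (hform_sp (sp_inv (jsp x)) _ _)).
by rewrite -[hform (_ *m _) _]opprK -hformNl -hformNr.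
Qed.

Lemma jacobi_mulA : associative jacobi_mul.
Proof.
move=> x y z; apply: jacobi_ext; first exact: sp_mulA.
  by rewrite !hrow_jmul mulmxDl /= -!mulmxA addrA.
rewrite !hkap_jmul !hrow_jmul /= mulmxDl hformDl hformDr mulmxA hform_sp.
by rewrite !addrA; apply/matrixP => i j; rewrite !mxE; ring.
Qed.

Lemma jacobi_mul1 : left_id jacobi_one jacobi_mul.
Proof.
move=> x; apply: jacobi_ext; first exact: sp_mul1.
  by rewrite hrow_jmul hrow_jone mul0mx add0r.
by rewrite hkap_jmul hrow_jone mul0mx hform0l /hkap add0r addr0.
Qed.

Lemma jacobi_mulr1 : right_id jacobi_one jacobi_mul.
Proof.
move=> x; apply: jacobi_ext; first exact: sp_mulr1.
  by rewrite hrow_jmul hrow_jone mulmx1 addr0.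
by rewrite hkap_jmul hrow_jone hform0r /hkap !addr0.
Qed.

Lemma jacobi_mulV : left_inverse jacobi_one jacobi_inv jacobi_mul.
Proof.
move=> x; apply: jacobi_ext; first exact: sp_mulV.
  by rewrite hrow_jmul hrow_jinv hrow_jone mulNmx -mulmxA sp_mulVmx mulmx1 addNr.
rewrite hkap_jmul hrow_jinv mulNmx -mulmxA sp_mulVmx mulmx1.
by rewrite hkap_jinv hformNl addrAC addrK addNr.
Qed.

Lemma jacobi_mulrV : right_inverse jacobi_one jacobi_inv jacobi_mul.
Proof.
move=> x; apply: jacobi_ext; first exact: sp_mulrV.
  by rewrite hrow_jmul hrow_jinv hrow_jone subrr.
rewrite hkap_jmul hrow_jinv.
by rewrite hkap_jinv hformNr hform_sp addrA subrr add0r subrr.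
Qed.

HB.instance Definition _ := isGroup.Build jacobi
  jacobi_mulA jacobi_mul1 jacobi_mulr1 jacobi_mulV jacobi_mulrV.

End Jacobi.

Section JacobiMap.
Variables (S T : comNzRingType) (f : {rmorphism S -> T}) (n m : nat).

Lemma map_symp_form : map_mx f (symp_form S n) = symp_form T n.
Proof. by rewrite map_block_mx !map_mx0 map_mxN map_mx1. Qed.

Lemma sp_mapP (g : sp S n) : symplectic (map_mx f g).
Proof.
by apply/eqP; rewrite map_trmx -map_symp_form -!map_mxM (eqP (spP g)).
Qed.
Definition sp_map (g : sp S n) : sp T n := Sp (sp_mapP g).

Lemma heis_mapP (h : heis S n m) :
  heis_cond (map_mx f (hlam h), map_mx f (hmu h), map_mx f (hkap h)).
Proof.
case: h => [[[l u] k] H]; rewrite /heis_cond /hlam /hmu /hkap /=.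
by rewrite map_trmx -map_mxM -map_mxD map_trmx (eqP H).
Qed.
Definition heis_map (h : heis S n m) : heis T n m := Heis (heis_mapP h).

Definition jacobi_map (x : jacobi S n m) : jacobi T n m :=
  Jacobi (sp_map (jsp x)) (heis_map (jheis x)).

End JacobiMap.

Section Theta.
Variables (R : realType) (n m : nat).
Local Open Scope complex_scope.
Local Notation C := R[i].

Definition posdef (k : nat) (A : 'M[R]_k) : Prop :=
  forall x : 'rV[R]_k, x != 0 -> 0 < (x *m A *m x^T) 0 0.

Definition siegel (Omega : 'M[C]_n) : Prop :=
  Omega^T = Omega /\ posdef (map_mx (@complex.Im R) Omega).

Definition cexp (z : C) : C :=
  (expR (complex.Re z))%:C * (cos (complex.Im z) +i* sin (complex.Im z)).

Definition pi_i : C := 0 +i* pi.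

Definition toC (p q : nat) (A : 'M[R]_(p, q)) : 'M[C]_(p, q) :=
  map_mx (real_complex R) A.

Definition ztoC (p q : nat) (A : 'M[int]_(p, q)) : 'M[C]_(p, q) :=
  map_mx intr A.

(* C Omega + D *)
Definition sp_den (g : sp R n) (Omega : 'M[C]_n) : 'M[C]_n :=
  toC (dlsubmx g) *m Omega + toC (drsubmx g).

Definition jacobi_act (x : jacobi R n m) (p : 'M[C]_n * 'M[C]_(m, n)) :
    'M[C]_n * 'M[C]_(m, n) :=
  let: (Omega, Z) := p in
  let g := jsp x in
  let h := jheis x in
  ((toC (ulsubmx g) *m Omega + toC (ursubmx g)) *m invmx (sp_den g Omega),
   (Z + toC (hlam h) *m Omega + toC (hmu h)) *m invmx (sp_den g Omega)).

(* [sqrtc] is the square root with argument in ]-pi/2, pi/2], so that         *)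
(* z^(k/2) = (sqrtc z) ^+ k.                                                  *)
Definition jfactor (M : 'M[int]_m) (x : jacobi R n m)
    (p : 'M[C]_n * 'M[C]_(m, n)) : C :=
  let: (Omega, Z) := p in
  let g := jsp x in
  let lam := toC (hlam (jheis x)) in
  let mu := toC (hmu (jheis x)) in
  let kap := toC (hkap (jheis x)) in
  let W := Z + lam *m Omega + mu in
  cexp (pi_i * \tr (ztoC M *m W *m invmx (sp_den g Omega)
                     *m toC (dlsubmx g) *m W^T))
  * cexp (- pi_i * \tr (ztoC M *m (lam *m Omega *m lam^T
                     + (lam *m Z^T) *+ 2 + kap + mu *m lam^T)))
  * sqrtc (\det (sp_den g Omega)) ^+ m.

(* Unordered sum over Z^(m, n): limit of the partial sums along the directed  *)
(* set of finite subsets; [C^o] carries the topology of the modulus.          *)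
Definition theta (M : 'M[int]_m) (p : 'M[C]_n * 'M[C]_(m, n)) : C :=
  let: (Omega, Z) := p in
  summability.sum (fun xi : 'M[int]_(m, n) =>
    cexp (pi_i * \tr (ztoC M *m (ztoC xi *m Omega *m (ztoC xi)^T
                       + (ztoC xi *m Z^T) *+ 2))) : C^o).

(* Homomorphisms from Gamma^J = jacobi int n m to the unit group of C. *)
Definition character (rho : jacobi int n m -> C) : Prop :=
  (forall x, rho x != 0) /\ (forall x y, rho (x * y)%g = rho x * rho y).

End Theta.

Definition even_integral (m : nat) (M : 'M[int]_m) : Prop :=
  M^T = M /\ forall i, (2 %| M i i)%Z.

(* Main.v *)
Require Import Defs.
From HB Require Import structures.
From mathcomp Require Import all_boot all_order all_algebra.
From mathcomp Require Import perm finmap complex.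
From mathcomp Require Import all_classical all_reals all_analysis.
From mathcomp.analysis.showcase Require summability.
From mathcomp Require Import ring lra zify.

(** The group Sp(n, Z) is generated by unipotent elements, Levi elements and
    inversions in one coordinate.  Unipotent elements fix every term of the theta
    series because the matrix [M] is even, and Levi elements permute the terms.
    An inversion in one coordinate is Poisson summation over a lattice of rank [m]
    for a complex Gaussian; in rank one, Poisson summation is finite Fourier
    analysis on a grid of mesh [1 / N], where the Riemann sums of the Gaussian along
    a tilted line are compared with those along the real axis by deforming the
    line, and their limit is found by applying the formula to the self-dual
    Gaussian.  Since an inversion fixes [i I], where theta does not vanish, its
    multiplier has modulus 1.  Evenness gives [M = S - S^T] modulo 2 for an integral
    [S], so that [m] is even because [det M] is odd; hence [det (C Omega + D) ^ (m / 2)]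
    is a true cocycle and the multiplier, which is trivial on the Heisenberg group,
    is a character. *)

Set Implicit Arguments.
Unset Strict Implicit.
Unset Printing Implicit Defensive.

Import Order.TTheory GRing.Theory Num.Theory.
Import numFieldNormedType.Exports.
Import Normc.

Local Open Scope ring_scope.

(** Inverting one coordinate at a time keeps the complex parameter of the Gaussian a scalar: for
    fixed remaining columns the exponent is a number [t] of the upper half plane times the real form
    [M]. Hence only the root of the number ['i / t] occurs, and no branch for the square root of the
    determinant of a complex symmetric matrix has to be followed. Deforming the line works at the
    level of sums: the derivative of [al * gauss (al * x + bt)] along a path of [(al, bt)] is an
    exact derivative in [x], so the Riemann sums over the whole line change by an amount that
    vanishes with the mesh. The constant in the lattice formula is never evaluated. What counts is
    that it does not depend on the complex parameters, because the modulus of the multiplier is then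
    read off at a single point. The condition on eighth powers of moduli says exactly that all
    multipliers have modulus 1. *)

Section ComplexModulus.
Variable R : realType.
Local Open Scope complex_scope.
Implicit Types z w : R[i].

Lemma normcE_norm z : `|z| = (normc z)%:C.
Proof. by case: z. Qed.

Lemma normc_ge0 z : 0 <= normc z.
Proof. by case: z => a b; apply: sqrtr_ge0. Qed.

Lemma normc_eq0 z : (normc z == 0) = (z == 0).
Proof. by apply/eqP/eqP => [/eq0_normc//|->]; rewrite normc0. Qed.

Lemma normc_gt0 z : (0 < normc z) = (z != 0).
Proof. by rewrite lt_def normc_eq0 normc_ge0 andbT. Qed.

Lemma normcB z w : normc (z - w) = normc (w - z).
Proof. by rewrite -normcN opprB. Qed.

Lemma normc_sum (I : Type) (s : seq I) (P : pred I) (F : I -> R[i]) :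
  normc (\sum_(i <- s | P i) F i) <= \sum_(i <- s | P i) normc (F i).
Proof.
elim/big_ind2: _ => [|x1 x2 y1 y2 h1 h2|//]; first by rewrite normc0.
by apply: le_trans (le_normcD _ _) _; apply: lerD.
Qed.

Lemma normc_real (x : R) : normc x%:C = `|x|.
Proof. by rewrite /= expr0n /= addr0 sqrtr_sqr. Qed.

Lemma normc_Re z : `|complex.Re z| <= normc z.
Proof.
by case: z => a b /=; rewrite -sqrtr_sqr ler_wsqrtr // lerDl sqr_ge0.
Qed.

Lemma normc_Im z : `|complex.Im z| <= normc z.
Proof.
by case: z => a b /=; rewrite -sqrtr_sqr ler_wsqrtr // lerDr sqr_ge0.
Qed.

Lemma normc_ReIm z : normc z <= `|complex.Re z| + `|complex.Im z|.
Proof.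
case: z => a b; rewrite /= -(@ger0_norm _ (`|a| + `|b|)) ?addr_ge0 //.
rewrite -sqrtr_sqr ler_wsqrtr // sqrrD !real_normK ?num_real // addrAC lerDl.
by rewrite mulrn_wge0 // mulr_ge0.
Qed.

Lemma normcX z k : normc (z ^+ k) = normc z ^+ k.
Proof. by elim: k => [|k IH]; rewrite ?normc1 // !exprS normcM IH. Qed.

Lemma normc_triangle z w u : normc (z - w) <= normc (z - u) + normc (u - w).
Proof. by rewrite -(subrKA u); exact: le_normcD. Qed.

Lemma normc_small z w : (forall e : R, 0 < e -> normc (z - w) < e) -> z = w.
Proof.
move=> h; apply/eqP; rewrite -subr_eq0 -normc_eq0; apply/eqP/le_anti.
rewrite normc_ge0 andbT; apply/ler_addgt0Pl => e e0.
by rewrite addr0; apply/ltW/h.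
Qed.

End ComplexModulus.

(** * Unordered sums of complex families *)

(** Only [s] has to be duplicate-free, so a finite set can be compared with any convenient list that
    covers it, such as a box of pairs. *)
Lemma ler_sum_subset (R : numDomainType) (I : eqType) (g : I -> R) (s t : seq I) :
  (forall i, 0 <= g i) -> uniq s -> {subset s <= t} ->
  \sum_(i <- s) g i <= \sum_(i <- t) g i.
Proof.
move=> g0; elim: s t => [|x s IH] t /=; first by rewrite big_nil sumr_ge0.
case/andP=> xs us st; rewrite big_cons (perm_big _ (perm_to_rem (st x _))) ?mem_head //.
rewrite big_cons lerD2l; apply: IH => // y ys.
have yt : y \in t by apply: st; rewrite inE ys orbT.
have := perm_mem (perm_to_rem (st x (mem_head x s))) y; rewrite yt inE.
by case: eqP => // eyx; rewrite eyx (negPf xs) in ys.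
Qed.

Section HasSum.
Variable R : realType.
Local Open Scope complex_scope.
Local Open Scope fset_scope.
Local Open Scope ring_scope.
Local Notation C := R[i].

(** Convergence along the directed set of finite subsets, with a real tolerance and the real-valued
    modulus; [sum_eq] links it to the sum by which [theta] is defined. *)
Definition has_sum (I : choiceType) (f : I -> C) (s : C) : Prop :=
  forall e : R, 0 < e -> exists A : {fset I}, forall B : {fset I}, A `<=` B ->
    normc (\sum_(i <- B) f i - s) < e.

Definition rsummable (I : choiceType) (g : I -> R) : Prop :=
  exists K : R, forall A : {fset I}, \sum_(i <- A) g i <= K.

Definition abs_summable (I : choiceType) (f : I -> C) : Prop :=
  rsummable (fun i => normc (f i)).

Section Basic.
Variables (I : choiceType).
Implicit Types (f g : I -> C) (s t : C).

Lemma has_sum_unique f s t : has_sum f s -> has_sum f t -> s = t.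
Proof.
move=> hs ht; apply: normc_small => e e0.
have e2 : 0 < e / 2 by rewrite divr_gt0.
have [A hA] := hs _ e2; have [B hB] := ht _ e2.
apply: le_lt_trans (normc_triangle _ _ (\sum_(i <- A `|` B) f i)) _.
rewrite (splitr e) ltrD // ?hB ?fsubsetUr // normcB hA //; exact: fsubsetUl.
Qed.

Lemma eq_has_sum f g s : f =1 g -> has_sum f s -> has_sum g s.
Proof. by move=> /funext ->. Qed.

Lemma has_sumD f g s t : has_sum f s -> has_sum g t ->
  has_sum (fun i => f i + g i) (s + t).
Proof.
move=> hs ht e e0; have e2 : 0 < e / 2 by rewrite divr_gt0.
have [A hA] := hs _ e2; have [B hB] := ht _ e2.
exists (A `|` B) => D; rewrite fsubUset => /andP[AD BD].
rewrite big_split /= opprD addrACA.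
by apply: le_lt_trans (le_normcD _ _) _; rewrite (splitr e) ltrD ?hA ?hB.
Qed.

Lemma has_sumZ c f s : has_sum f s -> has_sum (fun i => c * f i) (c * s).
Proof.
move=> hs e e0; have c1 : 0 < normc c + 1 by rewrite ltr_wpDl ?normc_ge0.
have [A hA] := hs (e / (normc c + 1)) (divr_gt0 e0 c1).
exists A => B AB; rewrite -mulr_sumr -mulrBr normcM.
have := hA _ AB; rewrite ltr_pdivlMr // mulrC => h.
by apply: le_lt_trans h; rewrite ler_wpM2r ?normc_ge0 // lerDl.
Qed.

Lemma has_sum_norm_le f s K : has_sum f s ->
  (forall A : {fset I}, \sum_(i <- A) normc (f i) <= K) -> normc s <= K.
Proof.
move=> hs hK; apply/ler_addgt0Pr => e /hs[A /(_ A (fsubset_refl _)) hA].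
rewrite -[s](subrK (\sum_(i <- A) f i)) addrC.
apply: le_trans (le_normcD _ _) _; rewrite lerD ?(le_trans (normc_sum _ _ _)) //.
by rewrite normcB ltW.
Qed.

Lemma fset_sum_setD (V : zmodType) (h : I -> V) (A B : {fset I}) : A `<=` B ->
  \sum_(i <- B) h i = \sum_(i <- A) h i + \sum_(i <- B `\` A) h i.
Proof.
move=> AB; rewrite (big_fsetID _ (fun i => i \in A)) /=; congr (_ + _).
  apply: perm_big; apply: uniq_perm; rewrite ?fset_uniq // => i.
  by rewrite !inE /= andbC; case: (boolP (i \in A)) => //= /(fsubsetP AB).
apply: perm_big; apply: uniq_perm; rewrite ?fset_uniq // => i.
by rewrite !inE /= andbC.
Qed.

(** If a finite sum is within [e] of the supremum, a disjoint finite set cannot contribute [e]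
    more. *)
Lemma rsummable_tail (g : I -> R) : (forall i, 0 <= g i) -> rsummable g ->
  forall e : R, 0 < e -> exists A : {fset I}, forall B : {fset I},
    [disjoint B & A] -> \sum_(i <- B) g i < e.
Proof.
move=> g0 [K hK] e e0.
pose S := [set x : R | exists A : {fset I}, x = \sum_(i <- A) g i]%classic.
have hS : has_sup S.
  by split; [exists (\sum_(i <- fset0) g i), fset0 | exists K => _ [A ->]].
have [_ [A ->] hA] := sup_adherent e0 hS; exists A => B BA.
have : \sum_(i <- A `|` B) g i <= sup S.
  by apply: ub_le_sup; [case: hS | exists (A `|` B)].
rewrite (fset_sum_setD _ (fsubsetUl A B)).
have -> : (A `|` B) `\` A = B.
  apply/fsetP => i; rewrite !inE; case: (boolP (i \in B)) => [iB|]; last by case: (i \in A).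
  by rewrite orbT andbT; apply: (fdisjointP BA).
by move=> h; rewrite -(ltrD2l (\sum_(i <- A) g i)) (le_lt_trans h) // -ltrBlDr.
Qed.

Lemma real_has_sum (g : I -> R) : (forall i, 0 <= g i) -> rsummable g ->
  exists s : R, has_sum (fun i => (g i)%:C) s%:C.
Proof.
move=> g0 [K hK].
pose S := [set x : R | exists A : {fset I}, x = \sum_(i <- A) g i]%classic.
have hS : has_sup S.
  by split; [exists (\sum_(i <- fset0) g i), fset0 | exists K => _ [A ->]].
exists (sup S) => e e0; have [_ [A ->] hA] := sup_adherent e0 hS.
exists A => B AB; rewrite -rmorph_sum -rmorphB normc_real.
have hB : \sum_(i <- B) g i <= sup S.
  by apply: ub_le_sup; [case: hS | exists B].
rewrite ler0_norm ?subr_le0 // opprB ltrBlDr -ltrBlDl.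
apply: lt_le_trans hA _; rewrite (fset_sum_setD _ AB) lerDl; exact: sumr_ge0.
Qed.

(** The real and imaginary parts are each a difference of two nonnegative summable families, whose
    sums are suprema. *)
Lemma abs_summable_has_sum f : abs_summable f -> exists s, has_sum f s.
Proof.
move=> [K hK].
have part (p : I -> R) : (forall i, `|p i| <= normc (f i)) ->
    exists s, has_sum (fun i => (p i)%:C) s.
  move=> hp.
  have h1 : rsummable (fun i => Num.max (p i) 0).
    exists K => A; apply: le_trans (hK A); apply: ler_sum => i _.
    by apply: le_trans (hp i); rewrite ge_max ler_norm normr_ge0.
  have h2 : rsummable (fun i => Num.max (- p i) 0).
    exists K => A; apply: le_trans (hK A); apply: ler_sum => i _.
    by apply: le_trans (hp i); rewrite ge_max -normrN ler_norm normr_ge0.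
  have [|s1 hs1] := real_has_sum _ h1; first by move=> i; rewrite le_max lexx orbT.
  have [|s2 hs2] := real_has_sum _ h2; first by move=> i; rewrite le_max lexx orbT.
  exists (s1%:C + (-1) * s2%:C).
  apply: eq_has_sum (has_sumD hs1 (has_sumZ (-1) hs2)) => i /=.
  rewrite mulN1r -rmorphB; congr (_%:C).
  have [h|/ltW h] := leP 0 (p i); last by rewrite max_l ?oppr_ge0 // sub0r opprK.
  by rewrite max_r ?oppr_le0 // subr0.
have [s1 hs1] := part _ (fun i => normc_Re (f i)).
have [s2 hs2] := part _ (fun i => normc_Im (f i)).
exists (s1 + 'i * s2); apply: eq_has_sum (has_sumD hs1 (has_sumZ 'i hs2)) => i /=.
by rewrite -complexE.
Qed.

Definition usum f : C := xget 0 [set s | has_sum f s]%classic.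

Lemma usum_eq f s : has_sum f s -> usum f = s.
Proof.
by move=> hs; apply: (has_sum_unique _ hs); rewrite /usum; case: xgetP => [_ -> //|/(_ s)].
Qed.

Lemma has_sum_usum f : abs_summable f -> has_sum f (usum f).
Proof. by move=> /abs_summable_has_sum[s hs]; rewrite (usum_eq hs). Qed.

Lemma sum_eq f s : has_sum f s -> summability.sum (f : I -> C^o) = s.
Proof.
move=> hs; have PF := @summability.totally_filter I; apply: cvg_lim => //.
apply/(@pseudometric_normed_Zmodule.cvgrPdist_lt C C^o) => e e0.
have [|A hA] := hs (complex.Re e).
  by have := e0; rewrite ltcE /= => /andP[].
exists A => //= B AB; rewrite distrC normcE_norm.
have -> : e = (complex.Re e)%:C by rewrite RRe_real // gtr0_real.
by rewrite ltcR /summability.partial_sum -(big_seq_fsetE _ _ predT f) hA.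
Qed.

Lemma rsummable_le (g h : I -> R) K : 0 <= K -> (forall i, g i <= K * h i) ->
  rsummable h -> rsummable g.
Proof.
move=> K0 gh [L hL]; exists (K * L) => A.
apply: le_trans (_ : \sum_(i <- A) K * h i <= _); first exact: ler_sum.
by rewrite -mulr_sumr ler_wpM2l.
Qed.

End Basic.

Lemma has_sum_reindex (I J : choiceType) (h : J -> I) (f : I -> C) s :
  bijective h -> has_sum f s -> has_sum (fun j => f (h j)) s.
Proof.
move=> [h' hK h'K] hs e /hs[A hA]; exists (h' @` A) => B AB.
have := hA (h @` B); rewrite big_imfset /=; last by move=> x y _ _ /(can_inj hK).
apply; apply/fsubsetP => x xA; apply/imfsetP; exists (h' x); rewrite ?h'K //=.
by apply: (fsubsetP AB); rewrite in_imfset.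
Qed.

(** Each inner sum is truncated to a finite set that contains the second coordinates of [A]. The
    truncated region then contains [A], so it is close to [s], while the truncation errors add up to
    at most [e / 2]. *)
Lemma has_sum_fubini (I J : choiceType) (f : I * J -> C) s (t : I -> C) :
  has_sum f s -> (forall i, has_sum (fun j => f (i, j)) (t i)) -> has_sum t s.
Proof.
move=> hs ht e e0; have e2 : 0 < e / 2 by rewrite divr_gt0.
have [A hA] := hs _ e2; exists [fset p.1 | p in A] => B AB.
(* The added 1 keeps the denominator positive when [B] is empty. *)
pose d := e / 2 / (#|` B|%:R + 1).
have d0 : 0 < d by rewrite divr_gt0 // ltr_wpDl.
have /choice[D hD] : forall i, exists D : {fset J},
   [fset p.2 | p in A] `<=` D /\ normc (\sum_(j <- D) f (i, j) - t i) < d.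
  move=> i; have [D hD] := ht i _ d0; exists ([fset p.2 | p in A] `|` D).
  by split; [exact: fsubsetUl | apply/hD/fsubsetUr].
pose U : {fset I * J} := [fset ((i, j) : (I * J)%type) | i in B, j in D i].
have AU : A `<=` U.
  apply/fsubsetP => -[i j] ijA; apply/imfset2P; exists i.
    by apply: (fsubsetP AB); apply/imfsetP; exists (i, j).
  exists j => //=; apply: (fsubsetP (hD i).1); apply/imfsetP; exists (i, j) => //.
have hU : \sum_(p <- U) f p = \sum_(i <- B) \sum_(j <- D i) f (i, j).
  by rewrite big_imfset2 //= => -[a b] [a' b'] _ _ [-> ->].
apply: le_lt_trans (normc_triangle _ _ (\sum_(p <- U) f p)) _.
rewrite (splitr e); apply: ler_ltD; last exact: hA.
rewrite hU -sumrB; apply: le_trans (normc_sum _ _ _) _.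
apply: le_trans (_ : \sum_(i <- B) d <= _).
  by apply: ler_sum => i _; rewrite normcB ltW //; exact: (hD i).2.
rewrite big_const_seq count_predT iter_addr_0 -[d *+ _]mulr_natr.
rewrite mulrAC ler_pdivrMr ?ltr_wpDl // ler_pM2l //.
by rewrite lerDl.
Qed.

End HasSum.

(** * Dominated convergence and uniform bounds over the integers *)

Section Summability.
Variable R : realType.
Local Open Scope fset_scope.
Local Open Scope ring_scope.
Local Notation C := R[i].

Lemma rsummable_prod (I J : choiceType) (g : I -> R) (h : J -> R) :
  (forall i, 0 <= g i) -> (forall j, 0 <= h j) -> rsummable g -> rsummable h ->
  rsummable (fun p : I * J => g p.1 * h p.2).
Proof.
move=> g0 h0 [K hK] [L hL]; exists (K * L) => A.
pose t := [seq (i, j) | i <- [fset p.1 | p in A]%fset, j <- [fset p.2 | p in A]%fset].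
apply: le_trans (_ : \sum_(p <- t) g p.1 * h p.2 <= _).
  apply: ler_sum_subset => // [p|[i j] ijA]; first by rewrite mulr_ge0.
  apply/allpairsP; exists (i, j); split=> //; apply/imfsetP; by exists (i, j).
rewrite big_allpairs /=.
under eq_bigr do rewrite -mulr_sumr.
by rewrite -mulr_suml ler_pM // sumr_ge0.
Qed.

Definition clim0 (u : nat -> C) : Prop :=
  forall e : R, 0 < e -> exists N0, forall N, (N0 <= N)%N -> normc (u N) < e.

Lemma clim0D u v : clim0 u -> clim0 v -> clim0 (fun N => u N + v N).
Proof.
move=> hu hv e e0; have e2 : 0 < e / 2 by rewrite divr_gt0.
have [N1 h1] := hu _ e2; have [N2 h2] := hv _ e2.
exists (maxn N1 N2) => N; rewrite geq_max => /andP[N1N N2N].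
by apply: le_lt_trans (le_normcD _ _) _; rewrite (splitr e) ltrD ?h1 ?h2.
Qed.

Lemma clim0_bounded (K : R) (u v : nat -> C) : (forall N, normc (u N) <= K * normc (v N)) ->
  clim0 v -> clim0 u.
Proof.
move=> uv hv e e0; have K1 : 0 < `|K| + 1 by rewrite ltr_wpDl.
have [N0 hN] := hv _ (divr_gt0 e0 K1); exists N0 => N /hN.
rewrite ltr_pdivlMr // mulrC; apply: le_lt_trans; apply: le_trans (uv N) _.
rewrite ler_wpM2r ?normc_ge0 //; apply: le_trans (ler_norm _) _; lra.
Qed.

Lemma clim0_cst (s : C) : clim0 (fun=> s) -> s = 0.
Proof.
by move=> hs; apply: normc_small => e /hs[N /(_ N (leqnn N))]; rewrite subr0.
Qed.

(** Dominated convergence when the index set [A N] moves with [N]: the majorant is small outside a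
    finite set [B], and on [B] the finitely many terms tend to zero. *)
Lemma tannery (I : choiceType) (d : nat -> I -> C) (g : I -> R) (A : nat -> {fset I}) :
  (forall i, 0 <= g i) -> rsummable g ->
  (forall N i, i \in A N -> normc (d N i) <= g i) ->
  (forall i, clim0 (d^~ i)) ->
  clim0 (fun N => \sum_(i <- A N) d N i).
Proof.
move=> g0 sg dg dlim e e0.
have e2 : 0 < e / 2 by rewrite divr_gt0.
have [B hB] := rsummable_tail g0 sg e2.
pose c := e / 2 / (#|` B|%:R + 1).
have c0 : 0 < c by rewrite divr_gt0 // ltr_wpDl.
have /choice[N2 hN2] := fun i => dlim i c c0.
exists (\max_(i <- B) N2 i)%N => N hN.
have {}hN i : i \in B -> normc (d N i) <= c.
  move=> iB; apply/ltW/hN2; apply: leq_trans hN.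
  by rewrite (big_rem i iB) /= leq_maxl.
rewrite (big_fsetID _ (fun i => i \in B)) /=.
apply: le_lt_trans (le_normcD _ _) _; rewrite (splitr e); apply: ler_ltD.
  apply: le_trans (normc_sum _ _ _) _.
  apply: le_trans (_ : \sum_(i <- B) c <= _).
    apply: le_trans (_ : \sum_(i <- [fset x in A N | x \in B]) c <= _).
      by rewrite big_seq [leRHS]big_seq; apply: ler_sum => i; rewrite !inE => /andP[_ /hN].
    apply: ler_sum_subset => // [i|i]; first exact: ltW.
    by rewrite !inE => /andP[].
  rewrite big_const_seq count_predT iter_addr_0 -[c *+ _]mulr_natr.
  rewrite mulrAC ler_pdivrMr ?ltr_wpDl // ler_pM2l //.
  by rewrite lerDl.
apply: le_lt_trans (normc_sum _ _ _) _.
apply: le_lt_trans (_ : \sum_(i <- [fset x in A N | x \notin B]) g i < _).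
  by rewrite big_seq [leRHS]big_seq; apply: ler_sum => i; rewrite !inE => /andP[/dg].
by apply: hB; apply/fdisjointP => i; rewrite !inE => /andP[].
Qed.

Lemma int_sum_le (g : int -> R) K1 K2 : (forall k, 0 <= g k) ->
  (forall N, \sum_(i < N) g (Posz i) <= K1) ->
  (forall N, \sum_(i < N) g (Negz i) <= K2) ->
  forall A : {fset int}, \sum_(k <- A) g k <= K1 + K2.
Proof.
move=> g0 h1 h2 A.
pose N := (\max_(k <- A) absz k)%N.+1.
pose t := [seq Posz i | i <- iota 0 N] ++ [seq Negz i | i <- iota 0 N].
apply: le_trans (_ : \sum_(k <- t) g k <= _).
  apply: ler_sum_subset => // k kA.
  have : (`|k| < N)%N by rewrite ltnS (big_rem k kA) /= leq_maxl.
  rewrite mem_cat; case: k {kA} => k kN; apply/orP; [left|right].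
    by apply/mapP; exists k; rewrite ?mem_iota.
  by apply/mapP; exists k; rewrite ?mem_iota //; apply: ltnW.
rewrite big_cat !big_map -[iota 0 N]/(index_iota 0 N) !big_mkord.
by rewrite lerD.
Qed.

(** The bound is uniform in the mesh. Over the positive points the sum telescopes against
    [2 / (1 + x)], because [(1 + y) ^+ 2 <= 2 * (1 + y ^+ 2)], and is at most 2. The point 0 adds
    [h <= 1], and the negative points add 2 again. *)
Lemma riemann_sum_bound (h : R) (A : {fset int}) : 0 < h <= 1 ->
  \sum_(k <- A) h / (1 + (h * k%:~R) ^+ 2) <= 5.
Proof.
case/andP=> h0 h1.
have key N : \sum_(i < N) h / (1 + (h * i.+1%:R) ^+ 2) <= 2 - 2 / (1 + h * N%:R).
  elim: N => [|N IH]; first by rewrite big_ord0 mulr0 addr0 divr1 subrr.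
  rewrite big_ord_recr /=; move: IH; set s := \sum_(_ < _) _; rewrite -(natr1 N).
  have : 0 <= h * N%:R :> R by rewrite mulr_ge0 // ltW.
  rewrite mulrDr mulr1; move: (h * _) => x x0 IH.
  have p1 : 0 < 1 + (x + h) by lra.
  have p2 : 0 < 1 + x by lra.
  have p3 : 0 < 1 + (x + h) ^+ 2 by rewrite ltr_pwDl ?sqr_ge0.
  have : h / (1 + (x + h) ^+ 2) <= 2 / (1 + x) - 2 / (1 + (x + h)).
    rewrite -mulrBr -(mulrC (1 + (x + h) ^+ 2)^-1).
    have -> : 2 * ((1 + x)^-1 - (1 + (x + h))^-1) = (2 * h) / ((1 + x) * (1 + (x + h))).
      by field; rewrite !gt_eqF.
    rewrite mulrC ler_pdivrMr // mulrAC ler_pdivlMr ?mulr_gt0 //.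
    rewrite [2 * h]mulrC -mulrA ler_pM2l //.
    have := sqr_ge0 (x + h - 1); nra.
  lra.
have key2 N : \sum_(i < N) h / (1 + (h * i.+1%:R) ^+ 2) <= 2.
  apply: le_trans (key N) _; rewrite gerBl divr_ge0 // addr_ge0 //.
  by rewrite mulr_ge0 // ltW.
have -> : (5 : R) = 3 + 2 by lra.
apply: (int_sum_le (g := fun k => h / (1 + (h * k%:~R) ^+ 2))) => [k|N|N].
- by rewrite divr_ge0 ?(ltW h0) // addr_ge0 // sqr_ge0.
- case: N => [|N]; first by rewrite big_ord0; lra.
  rewrite big_ord_recl /= mulr0 expr0n addr0 divr1.
  have -> : (3 : R) = 1 + 2 by lra.
  by apply: lerD => //; apply: le_trans (key2 N).
- apply: le_trans (key2 N); apply: ler_sum => i _.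
  by rewrite NegzE mulrNz mulrN sqrrN.
Qed.

Lemma rsummable_lattice_inv : rsummable (fun k : int => (1 + (k%:~R : R) ^+ 2)^-1).
Proof.
exists 5 => A; have := @riemann_sum_bound 1 A; rewrite ltr01 lexx => /(_ isT).
by under eq_bigr do rewrite !mul1r.
Qed.

End Summability.

(** * Taylor bounds for the exponential, sine and cosine *)

Section RealTrigBounds.
Variable R : realType.
Implicit Types a b x : R.

(** Everything comes from the tangent inequality [1 + x <= expR x]: at [- a] it gives
    [expR a - 1 <= a * expR a]. *)
Lemma expR_taylor1 a : `|expR a - 1 - a| <= a ^+ 2 * expR `|a|.
Proof.
have h1 : 0 <= expR a - 1 - a by have := expR_ge1Dx a; lra.
have h2 : expR a - 1 <= a * expR a.
  have := expR_ge1Dx (- a); rewrite expRN => h.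
  have e0 := expR_gt0 a; have : (1 - a) * expR a <= (expR a)^-1 * expR a by rewrite ler_wpM2r // ltW.
  rewrite mulVf ?gt_eqF //; lra.
rewrite ger0_norm //; have [a0|a0] := leP 0 a.
  by rewrite ger0_norm //; nra.
rewrite (ltr0_norm a0); have : 1 <= expR (- a) by rewrite -expR0 ler_expR; lra.
have e0 := expR_gt0 a; have e1 : expR a <= 1 by rewrite -expR0 ler_expR; lra.
move=> e2; apply: le_trans (_ : a ^+ 2 <= _); nra.
Qed.

Lemma expR_sub1 a : `|expR a - 1| <= `|a| * expR `|a|.
Proof.
have h1 := expR_ge1Dx a; have e0 := expR_gt0 a.
have h2 : expR a - 1 <= a * expR a.
  have := expR_ge1Dx (- a); rewrite expRN => h.
  have : (1 - a) * expR a <= (expR a)^-1 * expR a by rewrite ler_wpM2r // ltW.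
  rewrite mulVf ?gt_eqF //; lra.
have [a0|a0] := leP 0 a; first by rewrite !ger0_norm //; nra.
rewrite (ltr0_norm a0); have : 1 <= expR (- a) by rewrite -expR0 ler_expR; lra.
have e1 : expR a <= 1 by rewrite -expR0 ler_expR; lra.
have d0 : expR a - 1 <= 0 by lra.
move=> e2; rewrite (ler0_norm d0); nra.
Qed.

Lemma abs_sin_le x : `|sin x| <= `|x|.
Proof.
have key (y : R) : 0 < y -> `|sin y| <= y.
  move=> y0; have [] := @MVT R sin cos _ _ y0 (fun x _ => is_derive_sin x).
    exact/continuous_subspaceT/continuous_sin.
  move=> c _; rewrite sin0 !subr0 => ->.
  by rewrite normrM (gtr0_norm y0) ler_piMl ?(ltW y0) // cos_max.
have [x0|x0|->] := ltgtP x 0; last by rewrite sin0.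
  by have := key (- x); rewrite sinN normrN (ltr0_norm x0) oppr_gt0; exact.
by rewrite (gtr0_norm x0); apply: key.
Qed.

(** Since [1 - cos x] is twice the square of [sin (x / 2)], both bounds follow from the one for
    sine. The linear bound serves the mean value argument in [sin_subid], the quadratic one serves
    [cexp_taylor1]. *)
Lemma cos_sub1 x : 0 <= 1 - cos x <= Num.min `|x| (x ^+ 2).
Proof.
have -> : 1 - cos x = sin (x / 2) ^+ 2 * 2.
  have {1}-> : x = (x / 2) *+ 2 by rewrite mulr2n; lra.
  rewrite cos_mulr2n mulr2n.
  have := cos2Dsin2 (x / 2); lra.
have h := abs_sin_le (x / 2); have h1 := sin_max (x / 2).
rewrite normrM (@ger0_norm _ 2^-1) // in h.
have := normr_ge0 (sin (x / 2)); rewrite le_min -(real_normK (num_real (sin _))).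
rewrite -(real_normK (num_real x)).
move: (`|sin _|) (`|x|) (normr_ge0 x) h h1 => s y y0 h h1 s0.
by apply/andP; split; [|apply/andP; split]; nra.
Qed.

Lemma sin_subid x : `|sin x - x| <= x ^+ 2.
Proof.
have key (y : R) : 0 < y -> `|sin y - y| <= y ^+ 2.
  move=> y0; have D (z : R) : is_derive z 1 (fun z => sin z - z) (cos z - 1).
    by apply: is_deriveB.
  have [|c cy] := @MVT R (fun z => sin z - z) (fun z => cos z - 1) _ _ y0 (fun z _ => D z).
    apply/continuous_subspaceT => z; apply: cvgB; last exact: cvg_id.
    exact: continuous_sin.
  rewrite sin0 !subr0 => ->; rewrite normrM (gtr0_norm y0) expr2 ler_wpM2r ?(ltW y0) //.
  have /andP[h1] := cos_sub1 c; rewrite le_min => /andP[h2 _].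
  rewrite distrC ger0_norm //; apply: le_trans h2 _.
  by move: cy; rewrite in_itv /= => /andP[c0 cy]; rewrite gtr0_norm // ltW.
have [x0|x0|->] := ltgtP x 0; last by rewrite sin0 subrr normr0 expr0n.
  have := key (- x); have -> : sin (- x) - - x = - (sin x - x) by rewrite sinN; ring.
  by rewrite normrN sqrrN oppr_gt0; apply.
exact: key.
Qed.

End RealTrigBounds.

Section ComplexExp.
Variable R : realType.
Local Open Scope complex_scope.
Local Notation C := R[i].
Implicit Types z w : C.

Lemma cexpD z w : cexp (z + w) = cexp z * cexp w.
Proof.
case: z w => a b [c d]; apply/eqP; rewrite /cexp eq_complex /= expRD cosD sinD.
by apply/andP; split; apply/eqP; ring.
Qed.

Lemma cexp0 : cexp (0 : C) = 1.
Proof. by rewrite /cexp /= expR0 cos0 sin0 mul1r. Qed.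

Lemma normc_cexp z : normc (cexp z) = expR (complex.Re z).
Proof.
rewrite normcM normc_real gtr0_norm ?expR_gt0 //=.
by rewrite cos2Dsin2 sqrtr1 mulr1.
Qed.

Lemma cexp_neq0 z : cexp z != 0.
Proof. by rewrite -normc_gt0 normc_cexp expR_gt0. Qed.

Lemma cexpN z : cexp (- z) = (cexp z)^-1.
Proof.
by apply: (mulfI (cexp_neq0 z)); rewrite -cexpD subrr cexp0 divff ?cexp_neq0.
Qed.

Lemma cexp_real (x : R) : cexp x%:C = (expR x)%:C.
Proof. by rewrite /cexp /= cos0 sin0 mulr1. Qed.

Lemma cexpMn z k : cexp (z *+ k) = cexp z ^+ k.
Proof. by elim: k => [|k IH]; rewrite ?cexp0 // mulrS cexpD exprS IH. Qed.

Lemma cexpMz_eq1 z (k : int) : cexp z = 1 -> cexp (z *~ k) = 1.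
Proof.
move=> z1; case: k => k; first by rewrite -pmulrn cexpMn z1 expr1n.
by rewrite NegzE mulrNz cexpN -pmulrn cexpMn z1 expr1n invr1.
Qed.

Lemma cexp_2pi_i : cexp (pi_i R *+ 2) = 1.
Proof.
rewrite cexpMn /cexp /pi_i /= expR0 cospi sinpi mul1r.
by rewrite -[-1 +i* 0]/((-1)%:C) -rmorphXn /= sqrrN expr1n.
Qed.

(** With [z = a + i b], the real part of the remainder is [(expR a - 1 - a) - expR a * (1 - cos b)]
    and the imaginary part is [expR a * (sin b - b) + (expR a - 1) * b]. Each of the four terms is
    at most the square of the modulus times its exponential, hence the factor 4. *)
Lemma cexp_taylor1 z : normc (cexp z - 1 - z) <= 4 * normc z ^+ 2 * expR (normc z).
Proof.
have ha := normc_Re z; have hb := normc_Im z; have r0 := normc_ge0 z.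
apply: le_trans (normc_ReIm _) _.
move: ha hb; case: z r0 => a b; set r := normc _ => r0 /= ha hb.
rewrite !(mul0r, mulr0, subr0, oppr0, addr0, add0r).
have E : expR `|a| <= expR r by rewrite ler_expR.
have E1 : expR a <= expR `|a| by rewrite ler_expR ler_norm.
have ea := expR_gt0 a; have er := expR_gt0 r.
have t1 := expR_taylor1 a; have t2 := expR_sub1 a; have t3 := sin_subid b.
have /andP[t4 t4'] := cos_sub1 b.
have {}t4' : 1 - cos b <= b ^+ 2 by move: t4'; rewrite le_min => /andP[].
have a0 := normr_ge0 a; have b0 := normr_ge0 b.
have ab : a ^+ 2 <= r ^+ 2 by rewrite -(real_normK (num_real a)); nra.
have bb : b ^+ 2 <= r ^+ 2 by rewrite -(real_normK (num_real b)); nra.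
have r2 : 0 <= r ^+ 2 by rewrite sqr_ge0.
have -> : expR a * cos b - 1 - a = (expR a - 1 - a) - expR a * (1 - cos b) by ring.
have -> : expR a * sin b - b = expR a * (sin b - b) + (expR a - 1) * b by ring.
have u1 : `|expR a - 1 - a| <= r ^+ 2 * expR r.
  by apply: le_trans t1 _; apply: ler_pM => //; rewrite ?sqr_ge0 ?expR_ge0.
have u2 : `|expR a * (1 - cos b)| <= r ^+ 2 * expR r.
  rewrite normrM (gtr0_norm ea) (ger0_norm t4) mulrC ler_pM ?(ltW ea) //; lra.
have u3 : `|expR a * (sin b - b)| <= r ^+ 2 * expR r.
  rewrite normrM (gtr0_norm ea) mulrC ler_pM ?(ltW ea) //; lra.
have u4 : `|(expR a - 1) * b| <= r ^+ 2 * expR r.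
  rewrite normrM; apply: le_trans (_ : (r * expR r) * r <= _); last by rewrite expr2 mulrAC.
  rewrite ler_pM //; apply: le_trans t2 _; rewrite ler_pM // expR_ge0 //.
apply: le_trans (_ : (`|expR a - 1 - a| + `|expR a * (1 - cos b)|) +
   (`|expR a * (sin b - b)| + `|(expR a - 1) * b|) <= _).
  by apply: lerD; [exact: ler_normB | exact: ler_normD].
lra.
Qed.

End ComplexExp.

(** * Difference estimates for the complex Gaussian *)

Section Gauss.
Variable R : realType.
Local Open Scope complex_scope.
Local Notation C := R[i].
Local Notation piC := ((pi : R)%:C : C).

Definition gauss (y : C) : C := cexp (- (piC * y ^+ 2)).

Lemma gaussD y d : gauss (y + d) = gauss y * cexp (- (piC * (2 * y * d + d ^+ 2))).
Proof. by rewrite /gauss -cexpD; congr cexp; ring. Qed.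

Lemma expR_ge1 (x : R) : (1 <= expR x) = (0 <= x).
Proof. by rewrite leNgt expR_lt1 -leNgt. Qed.

Lemma pi_lt4 : pi < 4 :> R.
Proof. by have := @pihalf_lt2 R; rewrite ltr_pdivrMr // -natrM. Qed.

Lemma normc_pi : normc piC = pi.
Proof. by rewrite normc_real ger0_norm // pi_ge0. Qed.

Lemma normc_nat k : normc (k%:R : C) = k%:R.
Proof. by rewrite -(rmorph_nat (real_complex R)) normc_real normr_nat. Qed.

(** First-order expansion of the quotient [gauss (y + d) / gauss y]. As [pi < 4], the exponent is at
    most [12 * Q ^+ 2 * h], so [cexp_taylor1] contributes 4 * 144 = 576, and the neglected part
    [pi * d ^+ 2] of the exponent contributes 4. *)
Lemma gauss_rem_le y d (Q h : R) : 1 <= Q -> 0 < h <= 1 ->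
  normc y <= Q -> normc d <= Q * h ->
  normc (cexp (- (piC * (2 * y * d + d ^+ 2))) - 1 + 2 * piC * y * d)
    <= 580 * Q ^+ 4 * h ^+ 2 * expR (12 * Q ^+ 2 * h).
Proof.
move=> Q1 /andP[h0 h1] yQ dQ.
set z := - _.
have -> : cexp z - 1 + 2 * piC * y * d = (cexp z - 1 - z) - piC * d ^+ 2.
  by rewrite /z; ring.
have p4 := pi_lt4; have p0 := @pi_ge0 R.
have y0 := normc_ge0 y; have d0 := normc_ge0 d.
have d2 : normc d ^+ 2 <= (Q * h) ^+ 2 by rewrite lerXn2r // nnegrE; nra.
have yd : normc y * normc d <= Q * (Q * h) by apply: ler_pM.
have Q2 : 0 <= Q ^+ 2 by exact: sqr_ge0.
have zQ : normc z <= 12 * Q ^+ 2 * h.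
  rewrite normcN normcM normc_pi.
  apply: le_trans (_ : 4 * (2 * (normc y * normc d) + normc d ^+ 2) <= _).
    apply: ler_pM => //; rewrite ?normc_ge0 // ?(ltW p4) //.
    by apply: le_trans (le_normcD _ _) _; rewrite normcX !normcM normc_nat mulrA.
  have : (Q * h) ^+ 2 <= Q ^+ 2 * h by rewrite exprMn ler_wpM2l // expr2 ger_pMr.
  rewrite (expr2 Q) in Q2 * => h3; nra.
have z0 := normc_ge0 z.
have B0 : 0 <= 12 * Q ^+ 2 * h by apply: le_trans zQ.
have zz : normc z ^+ 2 <= (12 * Q ^+ 2 * h) ^+ 2 by rewrite lerXn2r // nnegrE.
have E1 : 1 <= expR (12 * Q ^+ 2 * h) by rewrite expR_ge1.
have E2 : expR (normc z) <= expR (12 * Q ^+ 2 * h) by rewrite ler_expR.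
apply: le_trans (le_normcD _ _) _; rewrite normcN normcM normc_pi normcX.
have t1 : normc (cexp z - 1 - z) <= 576 * Q ^+ 4 * h ^+ 2 * expR (12 * Q ^+ 2 * h).
  apply: le_trans (cexp_taylor1 _) _; apply: ler_pM; rewrite ?expR_ge0 //.
    by rewrite mulr_ge0 // sqr_ge0.
  by apply: le_trans (_ : 4 * (12 * Q ^+ 2 * h) ^+ 2 <= _); [lra | rewrite le_eqVlt; apply/orP; left; apply/eqP; ring].
have t2 : pi * normc d ^+ 2 <= 4 * Q ^+ 4 * h ^+ 2 * expR (12 * Q ^+ 2 * h).
  apply: le_trans (_ : 4 * Q ^+ 4 * h ^+ 2 <= _); last first.
    by rewrite ler_peMr // !mulr_ge0 ?exprn_ge0 //; lra.
  apply: le_trans (_ : 4 * (Q * h) ^+ 2 <= _); first by apply: ler_pM; rewrite ?sqr_ge0 // ltW.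
  rewrite exprMn mulrA ler_wpM2r ?sqr_ge0 // ler_wpM2l //.
  by apply: ler_weXn2l.
apply: le_trans (lerD t1 t2) _; rewrite le_eqVlt; apply/orP; left; apply/eqP; ring.
Qed.

(** Discrete form of an identity of derivatives: the derivative of [al * gauss (al * x + bt)] when
    [(al, bt)] moves with velocity [(a, b)] equals the x-derivative of
    [(a * x + b) * gauss (al * x + bt)]. Only second-order terms in [h] survive. *)
Lemma gauss_step_le (x b al a bt : C) (Q h : R) :
  0 < h <= 1 -> 1 <= Q -> normc (al * x + bt) <= Q -> normc al <= Q ->
  normc a <= Q -> normc (a * x + b) <= Q ->
  normc ((al + a * h%:C) * gauss ((al + a * h%:C) * x + (bt + b * h%:C))
       - al * gauss (al * x + bt)
       - ((a * (x + h%:C) + b) * gauss (al * (x + h%:C) + bt)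
          - (a * x + b) * gauss (al * x + bt)))
    <= 2400 * normc (gauss (al * x + bt)) * (Q ^+ 6 * h ^+ 2 * expR (12 * Q ^+ 2 * h)).
Proof.
move=> hh Q1 yQ alQ aQ vQ; have /andP[h0 h1] := hh.
set y := al * x + bt in yQ *; set v := a * x + b in vQ *.
pose H := h%:C : C; rewrite -/H.
have nH : normc H = h by rewrite normc_real gtr0_norm.
pose d1 := v * H; pose d2 := al * H.
have -> : (al + a * H) * x + (bt + b * H) = y + d1 by rewrite /y /d1 /v; ring.
have -> : al * (x + H) + bt = y + d2 by rewrite /y /d2; ring.
have -> : a * (x + H) + b = v + a * H by rewrite /v; ring.
have d1Q : normc d1 <= Q * h by rewrite normcM nH ler_wpM2r // ltW.
have d2Q : normc d2 <= Q * h by rewrite normcM nH ler_wpM2r // ltW.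
have r1 := gauss_rem_le Q1 hh yQ d1Q; have r2 := gauss_rem_le Q1 hh yQ d2Q.
rewrite (gaussD y d1) (gaussD y d2); move: r1 r2.
set E1 := cexp _; set E2 := cexp (- (_ * (_ * d2 + _))).
set rr := _ * expR _; set u1 := E1 - 1 + _; set u2 := E2 - 1 + _ => r1 r2.
(* The first-order terms cancel because [al * d1 = v * d2]. *)
have -> : (al + a * H) * (gauss y * E1) - al * gauss y -
   ((v + a * H) * (gauss y * E2) - v * gauss y) =
   gauss y * ((al + a * H) * u1 - (v + a * H) * u2
      + (a * H) * (2 * piC * y) * (d2 - d1)).
  by rewrite /u1 /u2 /d1 /d2; ring.
rewrite normcM [2400 * _]mulrC -[leRHS]mulrA ler_wpM2l ?normc_ge0 //.
have aH : normc (a * H) <= Q by rewrite normcM nH; have := normc_ge0 a; nra.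
have aH' : normc (a * H) <= Q * h by rewrite normcM nH ler_wpM2r // ltW.
have rr0 : 0 <= rr by apply: le_trans r1; exact: normc_ge0.
have t1 : normc ((al + a * H) * u1) <= 2 * Q * rr.
  rewrite normcM; apply: ler_pM; rewrite ?normc_ge0 //.
  apply: le_trans (le_normcD _ _) _; lra.
have t2 : normc ((v + a * H) * u2) <= 2 * Q * rr.
  rewrite normcM; apply: ler_pM; rewrite ?normc_ge0 //.
  apply: le_trans (le_normcD _ _) _; lra.
have t3 : normc ((a * H) * (2 * piC * y) * (d2 - d1)) <= (Q * h) * (8 * Q) * (2 * (Q * h)).
  rewrite normcM; apply: ler_pM; rewrite ?normc_ge0 //.
    rewrite normcM; apply: ler_pM; rewrite ?normc_ge0 //.
    rewrite normcM; apply: ler_pM; rewrite ?normc_ge0 //.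
    by rewrite normcM normc_nat normc_pi; have := pi_lt4; lra.
  by apply: le_trans (le_normcD _ _) _; rewrite normcN; lra.
apply: le_trans (le_normcD _ _) _.
apply: le_trans (lerD (le_normcD _ _) (lexx _)) _; rewrite normcN.
apply: le_trans (lerD (lerD t1 t2) t3) _.
have X1 : 1 <= expR (12 * Q ^+ 2 * h).
  by rewrite expR_ge1; apply: mulr_ge0 (ltW h0); apply: mulr_ge0 (sqr_ge0 _).
rewrite /rr; move: (expR _) X1 => X X1.
have q56 : Q ^+ 5 <= Q ^+ 6 by apply: ler_weXn2l.
have q36 : Q ^+ 3 <= Q ^+ 6 by apply: ler_weXn2l.
have Q50 : 0 <= Q ^+ 5 by apply: exprn_ge0; lra.
have Q30 : 0 <= Q ^+ 3 by apply: exprn_ge0; lra.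
have h20 := sqr_ge0 h.
have s1 : Q ^+ 5 * (h ^+ 2 * X) <= Q ^+ 6 * (h ^+ 2 * X) by rewrite ler_wpM2r // mulr_ge0 //; lra.
have s2 : Q ^+ 3 * h ^+ 2 <= Q ^+ 6 * (h ^+ 2 * X) by apply: ler_pM => //; rewrite ler_peMr.
(* The total is 2320 + 16, rounded up to 2400 once all powers of [Q] are raised to the sixth. *)
have -> : 2 * Q * (580 * Q ^+ 4 * h ^+ 2 * X) + 2 * Q * (580 * Q ^+ 4 * h ^+ 2 * X) + Q * h * (8 * Q) * (2 * (Q * h))
  = 2320 * (Q ^+ 5 * (h ^+ 2 * X)) + 16 * (Q ^+ 3 * h ^+ 2) by ring.
rewrite -(mulrA (Q ^+ 6)).
have s3 : 0 <= Q ^+ 6 * (h ^+ 2 * X) by apply: le_trans s2; rewrite mulr_ge0.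
lra.
Qed.

(** The linear terms for [d] and [- d] cancel. This second difference later yields the quadratic
    decay of the discrete Fourier coefficients. *)
Lemma gauss_diff2_le (y d : C) (Q h : R) : 0 < h <= 1 -> 1 <= Q ->
  normc y <= Q -> normc d <= Q * h ->
  normc (gauss (y + d) - 2 * gauss y + gauss (y - d))
    <= 2400 * normc (gauss y) * (Q ^+ 6 * h ^+ 2 * expR (12 * Q ^+ 2 * h)).
Proof.
move=> hh Q1 yQ dQ; have /andP[h0 h1] := hh.
have dQ' : normc (- d) <= Q * h by rewrite normcN.
have r1 := gauss_rem_le Q1 hh yQ dQ; have r2 := gauss_rem_le Q1 hh yQ dQ'.
rewrite (gaussD y d) (gaussD y (- d)); move: r1 r2.
set E1 := cexp _; set E2 := cexp (- (_ * (_ * - d + _))).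
set u1 := E1 - 1 + _; set u2 := E2 - 1 + _ => r1 r2.
have -> : gauss y * E1 - 2 * gauss y + gauss y * E2 = gauss y * (u1 + u2).
  by rewrite /u1 /u2; ring.
rewrite normcM [2400 * _]mulrC -[leRHS]mulrA ler_wpM2l ?normc_ge0 //.
apply: le_trans (le_normcD _ _) _; apply: le_trans (lerD r1 r2) _.
move: (expR _) (expR_ge0 (12 * Q ^+ 2 * h)) => X X0.
have q46 : Q ^+ 4 <= Q ^+ 6 by apply: ler_weXn2l.
have s : Q ^+ 4 * (h ^+ 2 * X) <= Q ^+ 6 * (h ^+ 2 * X).
  by rewrite ler_wpM2r // mulr_ge0 // sqr_ge0.
have s0 : 0 <= Q ^+ 4 * (h ^+ 2 * X).
  by rewrite !mulr_ge0 ?exprn_ge0 //; lra.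
have -> : 580 * Q ^+ 4 * h ^+ 2 * X = 580 * (Q ^+ 4 * (h ^+ 2 * X)) by ring.
rewrite -(mulrA (Q ^+ 6)); lra.
Qed.

End Gauss.

(** * Uniform decay along tilted lines *)

Section GaussDecay.
Variable R : realType.
Local Open Scope complex_scope.
Local Notation C := R[i].
Local Notation piC := ((pi : R)%:C : C).

Lemma poly_exp_le (c u : R) : 0 < c -> 0 <= u -> u ^+ 4 * expR (- (c * u)) <= (4 / c) ^+ 4.
Proof.
move=> c0 u0.
have -> : expR (- (c * u)) = expR (- (c * u / 4)) ^+ 4.
  by rewrite -expRM_natl; congr expR; field.
rewrite -exprMn lerXn2r ?nnegrE //; [by rewrite mulr_ge0 // expR_ge0|by rewrite divr_ge0 // ltW|].
rewrite expRN ler_pdivrMr ?expR_gt0 //.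
have := expR_ge1Dx (c * u / 4); set E := expR _ => hE.
apply: le_trans (_ : 4 / c * (c * u / 4) <= _).
  by rewrite le_eqVlt; apply/orP; left; apply/eqP; field; rewrite gt_eqF.
by rewrite ler_wpM2l ?divr_ge0 ?(ltW c0) //; lra.
Qed.

Lemma Re_sqr_affine (al bt : C) (x : R) :
  complex.Re ((al * x%:C + bt) ^+ 2) =
  complex.Re (al ^+ 2) * x ^+ 2 + 2 * x * complex.Re (al * bt) + complex.Re (bt ^+ 2).
Proof. by case: al bt => a1 a2 [b1 b2]; rewrite !expr2 /=; ring. Qed.

(** Since [pi >= 2], the quadratic term decays at twice the rate that is claimed; the spare half
    absorbs the cross term by [8 * y * k <= c * y ^+ 2 + (4 * k) ^+ 2 / c], with [k = K ^+ 2]. *)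
Lemma gauss_decay (K c : R) : 0 < c -> 1 <= K -> exists2 C0 : R, 0 < C0 &
  forall (al bt : C) (x : R), normc al <= K -> normc bt <= K ->
  c <= complex.Re (al ^+ 2) ->
  normc (gauss (al * x%:C + bt)) <= C0 * expR (- (c * (1 + x ^+ 2))).
Proof.
move=> c0 K1; exists (expR (c + 16 * K ^+ 4 / c + 4 * K ^+ 2)); first exact: expR_gt0.
move=> al bt x alK btK hc; rewrite normc_cexp -expRD ler_expR.
have -> : complex.Re (- (piC * (al * x%:C + bt) ^+ 2)) =
   - (pi * complex.Re ((al * x%:C + bt) ^+ 2)).
  by case: (_ ^+ 2) => u v /=; rewrite mul0r subr0.
rewrite Re_sqr_affine.
have r1 : `|complex.Re (al * bt)| <= K ^+ 2.
  by apply: le_trans (normc_Re _) _; rewrite normcM expr2; apply: ler_pM; rewrite ?normc_ge0.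
have r2 : `|complex.Re (bt ^+ 2)| <= K ^+ 2.
  by apply: le_trans (normc_Re _) _; rewrite normcX; apply: lerXn2r; rewrite ?nnegrE ?normc_ge0 //; lra.
have p4 := @pi_lt4 R; have p2 := @pi_ge2 R.
have K2 : 0 <= K ^+ 2 by exact: sqr_ge0.
have -> : 16 * K ^+ 4 / c = (4 * K ^+ 2) ^+ 2 / c by field; rewrite gt_eqF.
move: (complex.Re (al ^+ 2)) (complex.Re (al * bt)) (complex.Re (bt ^+ 2)) (K ^+ 2) hc r1 r2 K2.
move=> A B D k hc /ler_normlP[B1 B2] /ler_normlP[D1 D2] k0.
have xx : x ^+ 2 = `|x| ^+ 2 by rewrite real_normK // num_real.
have hx : `|x * B| <= `|x| * k.
  by rewrite normrM ler_wpM2l // ler_norml; apply/andP; split; lra.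
have {}hx : - (`|x| * k) <= x * B by move: hx => /ler_normlP[]; lra.
rewrite xx; have y0 := normr_ge0 x; move: (`|x|) y0 hx => y y0 hx.
have sq : 8 * (y * k) <= c * y ^+ 2 + (4 * k) ^+ 2 / c.
  rewrite -(ler_pM2r c0) [leRHS]mulrDl [X in _ + X]divfK ?gt_eqF //.
  by have := sqr_ge0 (c * y - 4 * k); nra.
have yk : 0 <= y * k by exact: mulr_ge0.
have t1 : c * y ^+ 2 <= A * y ^+ 2 by rewrite ler_wpM2r // sqr_ge0.
have t2 : c * y ^+ 2 - 2 * (y * k) - k <= A * y ^+ 2 + 2 * x * B + D.
  by rewrite -(mulrA 2); lra.
have t3 : pi * (c * y ^+ 2 - 2 * (y * k) - k) <= pi * (A * y ^+ 2 + 2 * x * B + D).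
  by rewrite ler_wpM2l // pi_ge0.
have cy : 0 <= c * y ^+ 2 by rewrite mulr_ge0 ?(ltW c0) // sqr_ge0.
have t4 : 2 * (c * y ^+ 2) <= pi * (c * y ^+ 2) by rewrite ler_wpM2r.
have t5 : pi * (y * k) <= 4 * (y * k) by rewrite ler_wpM2r // ltW.
have t6 : pi * k <= 4 * k by rewrite ler_wpM2r // ltW.
lra.
Qed.

(** The error estimates are used with [Q = K * (1 + |x|)], so their factor [expR (12 * Q ^+ 2 * h)]
    itself grows like a Gaussian in [x]. The threshold [h0] makes it consume at most half of the
    decay rate [c]; the other half beats the polynomial factors. *)
Lemma gauss_uniform (K c : R) : 0 < c -> 1 <= K -> exists D h0 : R,
  [/\ 0 < D, 0 < h0 <= 1 &
  forall (al bt : C) (x : R), normc al <= K -> normc bt <= K ->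
    c <= complex.Re (al ^+ 2) ->
    (1 + `|x|) * normc (gauss (al * x%:C + bt)) <= D / (1 + x ^+ 2) /\
    forall h, 0 < h <= h0 -> normc (gauss (al * x%:C + bt)) *
      ((K * (1 + `|x|)) ^+ 6 * h ^+ 2 * expR (12 * (K * (1 + `|x|)) ^+ 2 * h))
      <= D * h ^+ 2 / (1 + x ^+ 2)].
Proof.
move=> c0 K1; have [C0 C00 hC] := gauss_decay c0 K1.
have K0 : 0 < K by lra.
have k2 : 1 <= K ^+ 2 by rewrite exprn_ege1.
have k0 : 0 < K ^+ 2 by lra.
(* [8 * K ^+ 6] comes from [(2 * K ^+ 2 * X) ^+ 3], which bounds the sixth power of [Q], and
   [(8 / c) ^+ 4] from [poly_exp_le] at the rate [c / 2]. *)
pose D := C0 * (8 * K ^+ 6) * (8 / c) ^+ 4.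
pose h0 := Num.min 1 (c / 2 / (24 * K ^+ 2)).
have h00 : 0 < h0.
  by rewrite lt_min ltr01 /= !divr_gt0 // mulr_gt0.
have c8 : 0 < (8 / c) ^+ 4 by rewrite exprn_gt0 // divr_gt0.
have K6 : 1 <= K ^+ 6 by rewrite exprn_ege1.
exists D, h0; split.
- rewrite /D; apply: mulr_gt0 => //; apply: mulr_gt0 => //; lra.
- by rewrite h00 /= ge_min lexx.
move=> al bt x alK btK hc; have := hC al bt x alK btK hc.
set g := normc _ => gC; have g0 : 0 <= g by exact: normc_ge0.
have xx : x ^+ 2 = `|x| ^+ 2 by rewrite real_normK // num_real.
rewrite xx in gC *; move: (`|x|) (normr_ge0 x) gC => y y0 gC.
set X := 1 + y ^+ 2 in gC *.
have X1 : 1 <= X by rewrite lerDl sqr_ge0.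
have X0 : 0 < X by lra.
have P2 : (1 + y) ^+ 2 <= 2 * X by have := sqr_ge0 (1 - y); rewrite /X; nra.
have P1 : 1 + y <= 2 * X.
  by apply: le_trans P2; rewrite expr2 ler_peMl; lra.
have main : X ^+ 3 * expR (- (c / 2 * X)) <= (8 / c) ^+ 4 / X.
  rewrite ler_pdivlMr // mulrAC -exprSr.
  have -> : 8 / c = 4 / (c / 2) by field; rewrite gt_eqF.
  by apply: poly_exp_le; [rewrite divr_gt0 | exact: ltW].
have e12 : expR (- (c * X)) = expR (- (c / 2 * X)) * expR (- (c / 2 * X)).
  by rewrite -expRD; congr expR; field.
have eX0 := expR_gt0 (- (c / 2 * X)).
have X3 : X <= X ^+ 3 by rewrite -{1}[X]expr1 ler_weXn2l.
split.
  apply: le_trans (_ : (2 * X) * (C0 * expR (- (c * X))) <= _).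
    by apply: ler_pM => //; lra.
  have eX1 : expR (- (c / 2 * X)) <= 1.
    by rewrite expR_le1 oppr_le0 mulr_ge0 // ?(ltW X0) // divr_ge0 // ltW.
  apply: le_trans (_ : C0 * (8 * K ^+ 6) * (X ^+ 3 * expR (- (c / 2 * X))) <= _); last first.
    rewrite /D -[leRHS]mulrA ler_wpM2l //; apply: mulr_ge0 (ltW C00) _; lra.
  rewrite e12.
  have s1 : expR (- (c / 2 * X)) * expR (- (c / 2 * X)) <= expR (- (c / 2 * X)).
    by rewrite ger_pMr.
  have s2 : X * (expR (- (c / 2 * X)) * expR (- (c / 2 * X))) <= X ^+ 3 * expR (- (c / 2 * X)).
    by apply: ler_pM => //; rewrite ?mulr_ge0 // ltW.
  have s3 : 0 <= X ^+ 3 * expR (- (c / 2 * X)).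
    by rewrite mulr_ge0 ?(ltW eX0) // exprn_ge0 // ltW.
  have -> : 2 * X * (C0 * (expR (- (c / 2 * X)) * expR (- (c / 2 * X)))) =
    C0 * (2 * (X * (expR (- (c / 2 * X)) * expR (- (c / 2 * X))))) by ring.
  rewrite -[leRHS]mulrA ler_pM2l //; apply: ler_pM => //; last by lra.
  by apply: mulr_ge0 (ltW X0) _; apply: mulr_ge0; exact: ltW.
move=> h /andP[hp hh].
have hc2 : 24 * K ^+ 2 * h <= c / 2.
  rewrite mulrC -ler_pdivlMr ?mulr_gt0 //; apply: le_trans hh _.
  by rewrite ge_min lexx orbT.
have Q2 : (K * (1 + y)) ^+ 2 <= 2 * K ^+ 2 * X.
  have -> : 2 * K ^+ 2 * X = K ^+ 2 * (2 * X) by ring.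
  by rewrite exprMn ler_wpM2l // ltW.
have Q20 : 0 <= (K * (1 + y)) ^+ 2 by exact: sqr_ge0.
have Q6 : (K * (1 + y)) ^+ 6 <= 8 * K ^+ 6 * X ^+ 3.
  have -> : 8 * K ^+ 6 * X ^+ 3 = (2 * K ^+ 2 * X) ^+ 3 by ring.
  rewrite (exprM _ 2 3) lerXn2r ?nnegrE //; exact: le_trans Q2.
have Eh : expR (12 * (K * (1 + y)) ^+ 2 * h) <= expR (c / 2 * X).
  rewrite ler_expR; apply: le_trans (_ : 24 * K ^+ 2 * h * X <= _); last first.
    by rewrite ler_wpM2r // ltW.
  have -> : 24 * K ^+ 2 * h * X = 12 * (2 * K ^+ 2 * X) * h by ring.
  by rewrite ler_wpM2r ?(ltW hp) // ler_wpM2l.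
apply: le_trans (_ : (C0 * expR (- (c * X))) * (8 * K ^+ 6 * X ^+ 3 * h ^+ 2 * expR (c / 2 * X)) <= _).
  apply: ler_pM => //.
    by rewrite mulr_ge0 ?expR_ge0 // mulr_ge0 ?sqr_ge0 // (exprM _ 2 3) exprn_ge0.
  apply: ler_pM => //; rewrite ?expR_ge0 //.
    by rewrite mulr_ge0 ?sqr_ge0 // (exprM _ 2 3) exprn_ge0.
  by rewrite ler_wpM2r ?sqr_ge0.
have -> : C0 * expR (- (c * X)) * (8 * K ^+ 6 * X ^+ 3 * h ^+ 2 * expR (c / 2 * X))
  = C0 * (8 * K ^+ 6) * h ^+ 2 * (X ^+ 3 * expR (- (c / 2 * X))).
  rewrite e12; have : expR (- (c / 2 * X)) * expR (c / 2 * X) = 1.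
    by rewrite -expRD addNr expR0.
  move: (expR (- (c / 2 * X))) (expR (c / 2 * X)) => E E' EE.
  transitivity (C0 * (8 * K ^+ 6) * h ^+ 2 * (X ^+ 3 * E) * (E * E')); first by ring.
  by rewrite EE mulr1.
have -> : D * h ^+ 2 / X = C0 * (8 * K ^+ 6) * h ^+ 2 * ((8 / c) ^+ 4 / X).
  by rewrite /D; ring.
rewrite ler_wpM2l //; apply: mulr_ge0 (sqr_ge0 _).
by apply: mulr_ge0 (ltW C00) _; lra.
Qed.

End GaussDecay.

(** * Riemann sums of the Gaussian do not see the line *)

Section RiemannSums.
Variable R : realType.
Local Open Scope complex_scope.
Local Notation C := R[i].

Lemma lattice_bound (f : int -> C) (D h : R) (A : {fset int}) : 0 < h <= 1 ->
  (forall l, normc (f l) <= D / (1 + (h * l%:~R) ^+ 2)) ->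
  \sum_(l <- A) normc (f l) <= D / h * 5.
Proof.
move=> hh fD; have /andP[h0 _] := hh.
have D0 : 0 <= D.
  by apply: le_trans (normc_ge0 (f 0)) _; have := fD 0; rewrite mulr0 expr0n addr0 divr1.
apply: le_trans (_ : \sum_(l <- A) D / h * (h / (1 + (h * l%:~R) ^+ 2)) <= _).
  by apply: ler_sum => l _; rewrite mulrA divfK ?gt_eqF.
by rewrite -mulr_sumr ler_wpM2l ?riemann_sum_bound // divr_ge0 // ltW.
Qed.

Lemma lattice_summable (f : int -> C) (D h : R) : 0 < h <= 1 ->
  (forall l, normc (f l) <= D / (1 + (h * l%:~R) ^+ 2)) -> abs_summable f.
Proof. by move=> hh fD; exists (D / h * 5) => A; apply: lattice_bound. Qed.

Lemma lattice_sum_le (f : int -> C) s (D h : R) : 0 < h <= 1 ->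
  (forall l, normc (f l) <= D / (1 + (h * l%:~R) ^+ 2)) -> has_sum f s ->
  normc s <= D / h * 5.
Proof. by move=> hh fD hs; apply: (has_sum_norm_le hs) => A; apply: lattice_bound. Qed.

Lemma has_sum_shift (f : int -> C) s (k : int) :
  has_sum f s -> has_sum (fun l => f (l + k)) s.
Proof. by apply: has_sum_reindex; exists (fun l => l - k) => l; ring. Qed.

Lemma ler_scale1 (K x : R) : 0 <= K -> K <= K * (1 + `|x|).
Proof. by move=> K0; rewrite ler_peMr // lerDl. Qed.

Lemma normc_affine_le (a b : C) (x K : R) : normc a <= K -> normc b <= K ->
  normc (a * x%:C + b) <= K * (1 + `|x|).
Proof.
move=> aK bK; apply: le_trans (le_normcD _ _) _; rewrite normcM normc_real.
by rewrite mulrDr mulr1 addrC lerD // ler_wpM2r.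
Qed.

Definition gauss_sample (h : R) (al bt : C) (l : int) : C :=
  al * gauss (al * (h * l%:~R)%:C + bt).

(** The open sector of arguments between [- pi / 4] and [pi / 4], where the real part of [al ^+ 2]
    is positive and the Gaussian decays along the line. *)
Definition in_sector (al : C) : bool := `|complex.Im al| < complex.Re al.

(** The quantity [Re z - |Im z|] stays at least [m] on the segment from 1 to [al], and the real part
    of [z ^+ 2] is [(Re z - |Im z|) * (Re z + |Im z|)], hence at least [m ^+ 2]. *)
Lemma sector_path (al : C) : in_sector al -> exists2 c : R, 0 < c &
  forall t : R, 0 <= t <= 1 -> c <= complex.Re ((1 + t%:C * (al - 1)) ^+ 2).
Proof.
rewrite /in_sector; case: al => p q /= qp.
pose m := Num.min 1 (p - `|q|); have m0 : 0 < m by rewrite lt_min ltr01 subr_gt0.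
exists (m ^+ 2); first by rewrite exprn_gt0.
move=> t /andP[t0 t1]; rewrite !(mul0r, subr0, addr0, add0r).
have m1 : m <= 1 by rewrite ge_min lexx.
have m2 : m <= p - `|q| by rewrite ge_min lexx orbT.
have : q * q = `|q| ^+ 2 by rewrite real_normK ?num_real.
rewrite ?expr2; move: (`|q|) (normr_ge0 q) m2 {qp} => u u0 m2 qu.
have r : m <= 1 - t + t * p - t * u by nra.
have tu : 0 <= t * u by exact: mulr_ge0.
have -> : (1 + t * (p - 1)) * (1 + t * (p - 1)) - t * q * (t * q) =
  (1 - t + t * p - t * u) ^+ 2 + 2 * (1 - t + t * p - t * u) * (t * u).
  transitivity ((1 + t * (p - 1)) ^+ 2 - t ^+ 2 * (q * q)); first by ring.
  by rewrite qu; ring.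
move: (1 - t + t * p - t * u) r => z r.
move: (t * u) tu => w tu; nra.
Qed.

(* The path from [(1, 0)] to [(al, bt)] is cut into steps of the mesh size [h]:
   along a step the summand changes by an x-difference, which telescopes, up to
   an error of order [h ^+ 2]. *)
Lemma gauss_sample_invariance (al bt : C) : in_sector al -> exists D h0 : R,
  0 < h0 /\ forall N : nat, (0 < N)%N -> N%:R^-1 <= h0 ->
  [/\ forall l, normc (gauss_sample N%:R^-1 al bt l) <= D / (1 + (N%:R^-1 * l%:~R) ^+ 2),
   abs_summable (gauss_sample N%:R^-1 al bt),
   forall l, normc (gauss (al * (N%:R^-1 * l%:~R + N%:R^-1)%:C + bt)
     - 2 * gauss (al * (N%:R^-1 * l%:~R)%:C + bt)
     + gauss (al * (N%:R^-1 * l%:~R - N%:R^-1)%:C + bt))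
     <= D * N%:R^-1 ^+ 2 / (1 + (N%:R^-1 * l%:~R) ^+ 2) &
   normc (usum (gauss_sample N%:R^-1 al bt) - usum (gauss_sample N%:R^-1 1 0)) <= D].
Proof.
move=> sec; have [c c0 hc] := sector_path sec.
pose K := 1 + normc (al - 1) + normc bt.
have a0 := normc_ge0 (al - 1); have b0 := normc_ge0 bt.
have K1 : 1 <= K by rewrite /K; lra.
have K0 : 0 < K by lra.
have aK : normc (al - 1) <= K by rewrite /K; lra.
have bK : normc bt <= K by rewrite /K; lra.
have [D [h0 [D0 /andP[h00 h01] hD]]] := gauss_uniform c0 K1.
exists ((12000 + K) * D), h0; split=> // N N0 hN.
set h := _^-1 in hN *.
have hp : 0 < h by rewrite invr_gt0 ltr0n.
have h1 : h <= 1 by exact: le_trans h01.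
have hh : 0 < h <= 1 by rewrite hp.
have hh0 : 0 < h <= h0 by rewrite hp.
pose A (t : R) : C := 1 + t%:C * (al - 1); pose B (t : R) : C := t%:C * bt.
have nA t : 0 <= t <= 1 -> normc (A t) <= K.
  move=> /andP[t0 t1]; apply: le_trans (le_normcD _ _) _.
  by rewrite normc1 normcM normc_real ger0_norm // /K; nra.
have nB t : 0 <= t <= 1 -> normc (B t) <= K.
  by move=> /andP[t0 t1]; rewrite normcM normc_real ger0_norm // /K; nra.
have x2 (x : R) : 0 < 1 + x ^+ 2 by rewrite ltr_pwDl // sqr_ge0.
have g0 (z : C) : 0 <= normc (gauss z) by exact: normc_ge0.
have bnd t l : 0 <= t <= 1 ->
    normc (gauss_sample h (A t) (B t) l) <= K * D / (1 + (h * l%:~R) ^+ 2).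
  move=> ht; rewrite normcM -mulrA; apply: ler_pM; rewrite ?normc_ge0 ?nA //.
  have [H _] := hD (A t) (B t) (h * l%:~R) (nA t ht) (nB t ht) (hc t ht).
  by apply: le_trans H; rewrite ler_peMl // lerDl.
have sm t : 0 <= t <= 1 -> abs_summable (gauss_sample h (A t) (B t)).
  by move=> ht; apply: (lattice_summable hh) => l; exact: bnd.
pose S t := usum (gauss_sample h (A t) (B t)).
(* Summing an error of order [h ^+ 2] over a grid of mesh [h] costs a factor [5 / h], which gives
   12000 = 5 * 2400 and one power of [h]; the [1 / h] steps together then cost a constant. *)
have step t : 0 <= t -> t + h <= 1 -> normc (S (t + h) - S t) <= 12000 * D * h.
  move=> t0 th; have ht : 0 <= t <= 1 by rewrite t0 /=; lra.
  have ht' : 0 <= t + h <= 1 by rewrite th andbT; lra.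
  pose v l := ((al - 1) * (h * l%:~R)%:C + bt) * gauss (A t * (h * l%:~R)%:C + B t).
  have sv : abs_summable v.
    apply: (@lattice_summable _ (K * D) h hh) => l; rewrite normcM.
    have [H _] := hD (A t) (B t) (h * l%:~R) (nA t ht) (nB t ht) (hc t ht).
    rewrite -mulrA; apply: le_trans (_ : K * ((1 + `|h * l%:~R|) *
        normc (gauss (A t * (h * l%:~R)%:C + B t))) <= _); last by rewrite ler_wpM2l // ltW.
    rewrite mulrA ler_wpM2r //; exact: normc_affine_le aK bK.
  have hv := has_sum_usum sv; have hv1 := has_sum_shift 1 hv.
  have := has_sumD (has_sumD (has_sum_usum (sm _ ht')) (has_sumZ (-1) (has_sum_usum (sm _ ht))))
     (has_sumZ (-1) (has_sumD hv1 (has_sumZ (-1) hv))).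
  rewrite -/(S _) -/(S _).
  have -> : S (t + h) + -1 * S t + -1 * (usum v + -1 * usum v) = S (t + h) - S t by ring.
  move=> /(lattice_sum_le (D := 2400 * D * h ^+ 2) hh) H.
  have -> : 12000 * D * h = 2400 * D * h ^+ 2 / h * 5 by field; rewrite gt_eqF.
  apply: H => l.
  pose x := h * l%:~R : R; pose Q := K * (1 + `|x|).
  have Q1 : 1 <= Q by apply: le_trans K1 (ler_scale1 _ (ltW K0)).
  have KQ : K <= Q by exact: ler_scale1 (ltW K0).
  have yQ : normc (A t * x%:C + B t) <= Q.
    exact: normc_affine_le (nA t ht) (nB t ht).
  have vQ : normc ((al - 1) * x%:C + bt) <= Q.
    exact: normc_affine_le aK bK.
  have aQ : normc (al - 1) <= Q by exact: le_trans KQ.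
  have [_ H] := hD (A t) (B t) x (nA t ht) (nB t ht) (hc t ht).
  have {}H := H h hh0; have := gauss_step_le hh Q1 yQ (le_trans (nA t ht) KQ) aQ vQ.
  set E1 := (X in normc X <= _ -> _); set E2 := (X in _ -> normc X <= _).
  have -> : E1 = E2.
    have Et : A (t + h) = A t + (al - 1) * h%:C by rewrite /A rmorphD /=; ring.
    have Eb : B (t + h) = B t + bt * h%:C by rewrite /B rmorphD /=; ring.
    have Ex : (h * (l + 1)%:~R)%:C = x%:C + h%:C by rewrite -rmorphD intrD mulrDr mulr1.
    by rewrite /E1 /E2 /gauss_sample /v Et Eb Ex -/x !mulN1r.
  move=> H2; apply: le_trans H2 _; rewrite -mulrA.
  have -> : 2400 * D * h ^+ 2 / (1 + x ^+ 2) = 2400 * (D * h ^+ 2 / (1 + x ^+ 2)) by ring.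
  by apply: ler_wpM2l H; exact: ler0n.
have telescope j : (j <= N)%N -> normc (S (h * j%:R) - S 0) <= 12000 * D * (h * j%:R).
  elim: j => [|j IH] jN; first by rewrite !mulr0 subrr normc0.
  have -> : h * j.+1%:R = h * j%:R + h by rewrite -(natr1 j) mulrDr mulr1.
  apply: le_trans (normc_triangle _ _ (S (h * j%:R))) _; rewrite addrC mulrDr.
  apply: lerD; first exact/IH/ltnW.
  apply: step; first by rewrite mulr_ge0 // ltW.
  have -> : h * j%:R + h = h * j.+1%:R by rewrite -(natr1 j) mulrDr mulr1.
  by rewrite mulrC ler_pdivrMr ?ltr0n // mul1r ler_nat.
have A1 : A 1 = al by rewrite /A mul1r; ring.
have B1 : B 1 = bt by rewrite /B mul1r.
have A0 : A 0 = 1 by rewrite /A mul0r addr0.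
have B0 : B 0 = 0 by rewrite /B mul0r.
have t1 : 0 <= (1 : R) <= 1 by rewrite ler01 lexx.
have KD : K * D <= (12000 + K) * D by apply: (ler_wpM2r (ltW D0)); clear; lra.
split.
- move=> l; have := bnd 1 l t1; rewrite A1 B1 => H; apply: le_trans H _.
  by rewrite ler_wpM2r // invr_ge0 ltW.
- by have := sm 1 t1; rewrite A1 B1.
- move=> l; pose x := h * l%:~R : R; pose Q := K * (1 + `|x|); rewrite -/x.
  have Q1 : 1 <= Q by apply: le_trans K1 (ler_scale1 _ (ltW K0)).
  have KQ : K <= Q by exact: ler_scale1 (ltW K0).
  have := nA 1 t1; have := nB 1 t1; rewrite A1 B1 => nb na.
  have yQ : normc (al * x%:C + bt) <= Q.
    exact: normc_affine_le na nb.
  have dQ : normc (al * h%:C) <= Q * h.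
    by rewrite normcM normc_real (gtr0_norm hp) ler_wpM2r ?(ltW hp) // (le_trans na).
  have := hc 1 t1; rewrite -/(A 1) A1 => hca.
  have [_ H] := hD al bt x na nb hca.
  have := gauss_diff2_le hh Q1 yQ dQ; set E1 := (X in normc X <= _ -> _).
  set E2 := (X in _ -> normc X <= _).
  have -> : E1 = E2.
    rewrite /E1 /E2 rmorphD rmorphB /= (mulrDr al) (mulrBr al).
    by rewrite (addrAC _ _ bt) (addrAC _ _ bt).
  move=> H2; apply: le_trans H2 _; rewrite -mulrA.
  apply: le_trans (ler_wpM2l (ler0n _ _) (H h hh0)) _.
  rewrite -!mulrA (mulrA D); apply: ler_wpM2r; last by clear -K0; lra.
  apply: mulr_ge0; first exact: mulr_ge0 (ltW D0) (ltW hp).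
  by apply: divr_ge0 (ltW hp) _; exact: ltW.
- have := telescope N (leqnn N); rewrite mulVf ?pnatr_eq0 -?lt0n // mulr1 /S A1 B1 A0 B0.
  by move=> H; apply: le_trans H _; apply: (ler_wpM2r (ltW D0)); clear -K0; lra.
Qed.

End RiemannSums.

(** * Additive characters and their orthogonality on a finite grid *)

Section Characters.
Variable R : realType.
Local Open Scope complex_scope.
Local Notation C := R[i].

Definition e2pi (z : C) : C := cexp (pi_i R *+ 2 * z).

Lemma e2piD z w : e2pi (z + w) = e2pi z * e2pi w.
Proof. by rewrite /e2pi mulrDr cexpD. Qed.

Lemma e2pi0 : e2pi 0 = 1.
Proof. by rewrite /e2pi mulr0 cexp0. Qed.

Lemma e2pi_int (k : int) : e2pi k%:~R = 1.
Proof. by rewrite /e2pi mulrzr cexpMz_eq1 // cexp_2pi_i. Qed.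

Lemma e2piMn z k : e2pi (z *+ k) = e2pi z ^+ k.
Proof. by rewrite /e2pi mulrnAr cexpMn. Qed.

Lemma e2piDint z (k : int) : e2pi (z + k%:~R) = e2pi z.
Proof. by rewrite e2piD e2pi_int mulr1. Qed.

Lemma e2pi_real (t : R) : e2pi t%:C = cos (pi *+ 2 * t) +i* sin (pi *+ 2 * t).
Proof.
rewrite /e2pi; have -> : pi_i R *+ 2 * t%:C = 0 +i* (pi *+ 2 * t).
  by rewrite /pi_i mulr2n; apply/eqP; rewrite eq_complex /=; apply/andP; split; apply/eqP; ring.
by rewrite /cexp /= expR0 mul1r.
Qed.

Lemma normc_e2pi_real (t : R) : normc (e2pi t%:C) = 1.
Proof. by rewrite e2pi_real /= cos2Dsin2 sqrtr1. Qed.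

Lemma sin_pi_ge (t : R) : 0 <= t <= 2^-1 -> t / 4 <= sin (pi * t).
Proof.
move=> /andP[t0 t1]; have p4 := @pi_lt4 R; have p2 := @pi_ge2 R.
have x0 : 0 <= pi * t by rewrite mulr_ge0 // pi_ge0.
have x4 : pi * t <= 4 * t by rewrite ler_wpM2r // ltW.
have xt : 2 * t <= pi * t by rewrite ler_wpM2r.
have xp : pi * t <= pi / 2 by rewrite ler_wpM2l // pi_ge0.
have small (x : R) : 0 <= x <= 2^-1 -> x / 2 <= sin x.
  move=> /andP[h0 h1]; have := sin_subid x; move=> /ler_normlP[h2 _]; nra.
have [h|h] := leP (pi * t) 2^-1.
  by apply: le_trans (small _ _); [lra | rewrite x0].
apply: le_trans (_ : sin 2^-1 <= _).
  by apply: le_trans (small _ _); [lra | rewrite lexx andbT; lra].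
by rewrite ltW // ltr_sin // in_itv /=; apply/andP; split; lra.
Qed.

(** The quantity equals [- 4 * sin (pi * t) ^+ 2]. It is the factor by which summation by parts
    divides, so it has to be bounded below. *)
Lemma e2pi_diff2_ge (t : R) : `|t| <= 2^-1 ->
  t ^+ 2 / 4 <= normc (e2pi t%:C - 2 + e2pi (- t)%:C).
Proof.
move=> t2; rewrite !e2pi_real mulrN cosN sinN.
have -> : cos (pi *+ 2 * t) +i* sin (pi *+ 2 * t) - 2 + (cos (pi *+ 2 * t) -i* sin (pi *+ 2 * t))
    = (- (4 * sin (pi * `|t|) ^+ 2))%:C :> C.
  have -> : pi *+ 2 * t = (pi * t) *+ 2 by rewrite mulrnAl.
  rewrite cos_mulr2n cos2sin2.
  have -> : sin (pi * `|t|) ^+ 2 = sin (pi * t) ^+ 2.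
    by have [t0|t0] := ger0P t; rewrite ?mulrN ?sinN ?sqrrN.
  apply/eqP; rewrite eq_complex /=; apply/andP; split; apply/eqP; ring.
rewrite normc_real normrN (@ger0_norm _ (4 * _)); last exact: mulr_ge0 (sqr_ge0 _).
have := @sin_pi_ge `|t|; rewrite normr_ge0 t2 => /(_ isT).
have -> : t ^+ 2 = `|t| ^+ 2 by rewrite real_normK // num_real.
move: (sin (pi * `|t|)) => s; move: (`|t|) (normr_ge0 t) => u u0 su; nra.
Qed.

Lemma e2pi_frac_neq1 (j N : nat) : (0 < j < N)%N -> e2pi (j%:R / N%:R)%:C != 1.
Proof.
move=> /andP[j0 jN]; rewrite e2pi_real eq_complex /=; apply/negP => /andP[/eqP h _].
have N0 : 0 < (N%:R : R) by rewrite ltr0n (ltn_trans j0).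
have s0 : 0 < sin (pi * (j%:R / N%:R) : R).
  apply: sin_gt0_pi; apply/andP; split.
    by apply: mulr_gt0 (pi_gt0 _) _; rewrite divr_gt0 // ltr0n.
  by rewrite gtr_pMr ?pi_gt0 // ltr_pdivrMr // mul1r ltr_nat.
move: h; rewrite (mulrnAl pi) cos_mulr2n cos2sin2.
have := exprn_gt0 2 s0; rewrite mulr2n; lra.
Qed.

(** The residues modulo the odd number [2 L + 1], centred at 0, so that a residue divided by the
    modulus has absolute value at most 1/2, as [e2pi_diff2_ge] requires. *)
Definition sym_range (L : nat) : {fset int} :=
  [fset Posz i - Posz L | i in iota 0 L.*2.+1]%fset.

Lemma mem_sym_range L (r : int) : (r \in sym_range L) = (`|r| <= L)%N.
Proof.
apply/imfsetP/idP => [[j]|rL]; first by rewrite mem_iota => /andP[_ jL] ->; lia.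
by exists (absz (r + Posz L)); rewrite ?mem_iota; lia.
Qed.

Lemma sum_sym_range (V : nmodType) L (F : int -> V) :
  \sum_(r <- sym_range L) F r = \sum_(i < L.*2.+1) F (Posz i - Posz L).
Proof.
rewrite /sym_range; move: L.*2.+1 => N.
rewrite big_imfset /=; last by move=> i j _ _; lia.
by rewrite -(big_mkord predT (fun i => F (Posz i - Posz L))) /index_iota subn0 undup_id ?iota_uniq.
Qed.

(** A geometric series in [e2pi (- t)], shifted to begin at [- L]. On the grid of mesh [1 / N] it
    isolates the integers among the grid points. *)
Lemma sum_roots_of_unity L (l : int) : let N := L.*2.+1 in
  \sum_(r <- sym_range L) e2pi (- (r%:~R * (N%:R^-1 * l%:~R)%:C)) =
  if (N%:Z %| l)%Z then N%:R else 0.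
Proof.
move=> N; have N0 : (N%:R : R) != 0 by rewrite pnatr_eq0.
pose t := (N%:R^-1 * l%:~R)%:C : C.
have Nt : t *+ N = l%:~R.
  rewrite /t -rmorphMn -mulr_natl mulrA divff // mul1r; exact: rmorph_int.
pose z := e2pi (- t); pose c := e2pi (t *+ L).
rewrite sum_sym_range -/t.
have -> : \sum_(i < N) e2pi (- ((Posz i - Posz L)%:~R * t)) = c * \sum_(i < N) z ^+ i.
  rewrite mulr_sumr; apply: eq_bigr => i _; rewrite /z /c -e2piMn -e2piD.
  by rewrite intrB mulrBl opprB mulNrn -!pmulrn !mulr_natl.
have zN : z ^+ N = 1 by rewrite /z -e2piMn mulNrn Nt -rmorphN e2pi_int.
case: ifP => [/dvdzP[k lk]|Nl].
  have tk : t = k%:~R.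
    by rewrite /t lk intrM mulrCA mulVf // mulr1; exact: rmorph_int.
  have z1 : z = 1 by rewrite /z tk -rmorphN e2pi_int.
  have c1 : c = 1 by rewrite /c tk e2piMn e2pi_int expr1n.
  rewrite c1 mul1r; under eq_bigr do rewrite z1 expr1n.
  by rewrite sumr_const card_ord.
have z1 : z != 1.
  (* Modulo an integer, [- t] is the proper fraction given by the residue of [- l], to which
     [e2pi_frac_neq1] applies. *)
  rewrite /z; have -> : - t = ((`|(- l %% N)%Z|)%N%:R / N%:R)%:C + (- l %/ N)%Z%:~R.
    have E : (`|(- l %% N)%Z|)%N%:R = ((- l %% N)%Z)%:~R :> R.
      by rewrite -[in RHS](@gez0_abs (- l %% N)%Z) // modz_ge0.
    rewrite E -(rmorph_int (real_complex R)) -rmorphN -rmorphD; congr (_%:C).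
    have -> : - (N%:R^-1 * l%:~R) = N%:R^-1 * (- l)%:~R :> R by rewrite rmorphN mulrN.
    rewrite {1}(divz_eq (- l) N) intrD intrM mulrDr addrC mulrC; congr (_ + _).
    by rewrite mulrCA mulVf // mulr1.
  rewrite e2piDint; apply: e2pi_frac_neq1; rewrite absz_gt0.
  have lt : ((- l %% N)%Z < N)%R by rewrite ltz_pmod.
  have ge : (0 <= (- l %% N)%Z)%R by rewrite modz_ge0.
  apply/andP; split; last by rewrite -ltz_nat gez0_abs.
  by apply/negP => /eqP /dvdz_mod0P; rewrite dvdzE abszN -dvdzE Nl.
apply/eqP; rewrite mulf_eq0; apply/orP; right.
have : (z - 1) * \sum_(i < N) z ^+ i = 0 by rewrite -subrX1 zN subrr.
by move/eqP; rewrite mulf_eq0 subr_eq0 (negPf z1).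
Qed.

End Characters.

(** * Poisson summation at a finite mesh *)

Section Poisson.
Variable R : realType.
Local Open Scope complex_scope.
Local Notation C := R[i].
Local Notation piC := ((pi : R)%:C : C).

Lemma has_sum_inj (I J : choiceType) (h : J -> I) (h' : I -> J) (f : I -> C) s :
  cancel h h' -> (forall i, h (h' i) != i -> f i = 0) ->
  has_sum f s -> has_sum (fun j => f (h j)) s.
Proof.
move=> hK f0 hs e /hs[A hA]; exists [fset h' x | x in A]%fset => B AB.
have := hA ((h @` B) `|` A)%fset (fsubsetUr _ _).
rewrite (fset_sum_setD _ (fsubsetUl _ _)) [X in _ + X - _]big1_seq ?addr0.
  by rewrite big_imfset //= => x y _ _ /(can_inj hK).
move=> x /andP[_]; rewrite !inE => /andP[xB /orP[|xA]]; first by rewrite (negPf xB).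
apply: f0; apply: contra xB => /eqP <-; rewrite in_imfset //=.
by apply: (fsubsetP AB); rewrite in_imfset.
Qed.

Lemma has_sum_pos_neq0 (I : choiceType) (g : I -> R) (i0 : I) s :
  (forall i, 0 <= g i) -> 0 < g i0 -> has_sum (fun i => (g i)%:C) s -> s != 0.
Proof.
move=> g0 gi hs; apply/eqP => s0; have [A hA] := hs _ gi.
have := hA (i0 |` A)%fset (fsubsetUr _ _); rewrite s0 subr0 -rmorph_sum normc_real.
rewrite ger0_norm ?sumr_ge0 // ltNge => /negP; apply.
rewrite (big_rem i0) ?in_fset1U ?eqxx //= lerDl; exact: sumr_ge0.
Qed.

Lemma has_sum_sum (I : choiceType) (J : Type) (s : seq J) (f : J -> I -> C) (t : J -> C) :
  (forall j, has_sum (f j) (t j)) ->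
  has_sum (fun i => \sum_(j <- s) f j i) (\sum_(j <- s) t j).
Proof.
move=> h; elim: s => [|j s IH].
  rewrite big_nil; apply: (@eq_has_sum _ _ (fun _ => 0)) => [i|e e0]; first by rewrite big_nil.
  by exists fset0 => B _; rewrite big1 // subr0 normc0.
rewrite big_cons; apply: eq_has_sum (has_sumD (h j) IH) => i /=.
by rewrite big_cons.
Qed.

Lemma in_sector_neq0 (al : C) : in_sector al -> al != 0.
Proof.
by apply: contraTneq => ->; rewrite /in_sector /= normr0 ltxx.
Qed.

Lemma in_sectorV (al : C) : in_sector al -> in_sector al^-1.
Proof.
move=> sa; have := in_sector_neq0 sa; move: sa; rewrite /in_sector.
case: al => a b /=; rewrite eq_complex /= => ba a0.
have d0 : 0 < a ^+ 2 + b ^+ 2.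
  have a1 : 0 < a by apply: le_lt_trans ba.
  by rewrite ltr_pwDl ?sqr_ge0 // exprn_gt0.
by rewrite ?mulNr normrN normrM (gtr0_norm (x := _^-1)) ?invr_gt0 // ltr_pM2r ?invr_gt0.
Qed.

Lemma in_sector1 : in_sector (1 : C).
Proof. by rewrite /in_sector /= normr0 ltr01. Qed.

Lemma in_sector_Re_sqr (al : C) : in_sector al -> 0 < complex.Re (al ^+ 2).
Proof.
move=> /sector_path[c c0 /(_ 1)]; rewrite ler01 lexx => /(_ isT) h.
by apply: lt_le_trans c0 _; move: h; rewrite mul1r addrC subrK.
Qed.

Lemma gauss_lattice_bound (al bt : C) : in_sector al -> exists2 D : R, 0 <= D &
  forall x : R, normc (gauss (al * x%:C + bt)) <= D / (1 + x ^+ 2).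
Proof.
move=> /in_sector_Re_sqr c0; pose K := 1 + normc al + normc bt.
have := normc_ge0 al; have := normc_ge0 bt => b0 a0.
have K1 : 1 <= K by rewrite /K; lra.
have [D [h0 [D0 _ hD]]] := gauss_uniform c0 K1; exists D; first exact: ltW.
move=> x; have [||H _] := hD al bt x _ _ (lexx _); rewrite /K; try lra.
by apply: le_trans H; rewrite ler_peMl ?normc_ge0 // lerDl.
Qed.

(** For [al] in the sector this is the Fourier transform at [r] of [x -> al * gauss (al * (x + w))],
    that is, a term of the dual series. *)
Definition fourier_mode (al w : C) (r : int) : C := gauss (r%:~R / al) * e2pi (r%:~R * w).

Lemma intC (k : int) : (k%:~R : R)%:C = k%:~R :> C.
Proof. exact: (rmorph_int (real_complex R)). Qed.

Lemma pi_iE : pi_i R = 'i * piC.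
Proof. by rewrite /pi_i; apply/eqP; rewrite eq_complex /=; apply/andP; split; apply/eqP; ring. Qed.

(** Completing the square turns the mode into a Gaussian sampled on a line of slope [al^-1], so the
    decay bound for lines also covers the dual series. *)
Lemma fourier_modeE (al w : C) (r : int) : al != 0 ->
  fourier_mode al w r = gauss (al^-1 * (r%:~R : R)%:C - 'i * al * w) * gauss (al * w).
Proof.
move=> a0; rewrite /fourier_mode /gauss /e2pi -!cexpD intC pi_iE; congr cexp.
move: (r%:~R : C) => q; apply/eqP; rewrite -subr_eq0; apply/eqP.
transitivity (('i * 'i + 1) * (piC * al ^+ 2 * w ^+ 2)); first by field.
by rewrite -expr2 sqr_i addNr mul0r.
Qed.

Lemma fourier_mode_bound (al w : C) : in_sector al -> exists2 D : R, 0 <= D &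
  forall r, normc (fourier_mode al w r) <= D / (1 + (r%:~R) ^+ 2).
Proof.
move=> sa; have [D D0 hD] := gauss_lattice_bound (- ('i * al * w)) (in_sectorV sa).
exists (D * normc (gauss (al * w))); first by rewrite mulr_ge0 ?normc_ge0.
move=> r; rewrite fourier_modeE ?in_sector_neq0 // normcM [leRHS]mulrAC.
by rewrite ler_wpM2r ?normc_ge0.
Qed.

Lemma fourier_mode_summable (al w : C) : in_sector al -> abs_summable (fourier_mode al w).
Proof.
move=> /(fourier_mode_bound w)[D D0 hD].
apply: (@lattice_summable _ _ D 1); first by rewrite ltr01 lexx.
by move=> l; rewrite mul1r.
Qed.

(** Completing the square: multiplication by a character moves the line of summation by
    ['i * r / al], at the price of the factor [fourier_mode]. Twisted Riemann sums thereby fall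
    under [gauss_sample_invariance]. *)
Lemma gauss_sample_mode (al w : C) (h : R) (r l : int) : al != 0 ->
  gauss_sample h al (al * w) l * e2pi (- (r%:~R * (h * l%:~R)%:C)) =
  gauss_sample h al (al * w + 'i * r%:~R / al) l * fourier_mode al w r.
Proof.
move=> a0; rewrite /gauss_sample /fourier_mode -[LHS]mulrA -[RHS]mulrA; congr (_ * _).
rewrite /gauss /e2pi -!cexpD pi_iE; congr cexp.
move: (h * l%:~R)%:C (r%:~R : C) => x q.
have i2 : 'i * 'i = -1 :> C by rewrite -expr2 sqr_i.
transitivity (- (piC * (al * x + al * w) ^+ 2) - 2 * ('i * piC) * q * x); first by ring.
transitivity (- (piC * (al * x + al * w) ^+ 2) - 2 * ('i * piC) * q * x
  - (('i * 'i) + 1) * piC * q ^+ 2 / al ^+ 2).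
  by rewrite i2 addNr !mul0r subr0.
by field.
Qed.

(** The discrete Fourier coefficient of the sampled Gaussian, already in the form that
    [gauss_sample_mode] gives it. *)
Definition fourier_coef (al w : C) (h : R) (r : int) : C :=
  h%:C * usum (gauss_sample h al (al * w + 'i * r%:~R / al)) * fourier_mode al w r.

Lemma has_sum_fourier_coef (al w : C) (h : R) (r : int) : al != 0 ->
  abs_summable (gauss_sample h al (al * w)) ->
  has_sum (fun l => h%:C * (gauss_sample h al (al * w) l * e2pi (- (r%:~R * (h * l%:~R)%:C))))
    (fourier_coef al w h r).
Proof.
move=> a0 sa; rewrite /fourier_coef -mulrA; apply: has_sumZ.
have m0 : fourier_mode al w r != 0 by rewrite mulf_neq0 // cexp_neq0.
have [s hs] : exists s, has_sum (fun l => gauss_sample h al (al * w) l *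
     e2pi (- (r%:~R * (h * l%:~R)%:C))) s.
  apply: abs_summable_has_sum; have [K hK] := sa; exists K => A.
  apply: le_trans (hK A); apply: ler_sum => l _.
  by rewrite normcM -intC -rmorphM -rmorphN normc_e2pi_real mulr1.
suff -> : usum (gauss_sample h al (al * w + 'i * r%:~R / al)) = s / fourier_mode al w r.
  by rewrite divfK.
apply: usum_eq; rewrite [s / _]mulrC; apply: eq_has_sum (has_sumZ _ hs) => l /=.
by rewrite gauss_sample_mode // mulrCA mulVf // mulr1.
Qed.

(** The identity is exact for each mesh: summing over all residues leaves only the integer grid
    points, so the right-hand side does not change with [L]. *)
Lemma sum_fourier_coef (al w : C) (L : nat) : let h := L.*2.+1%:R^-1 : R in al != 0 ->
  abs_summable (gauss_sample h al (al * w)) ->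
  has_sum (fun k : int => al * gauss (al * k%:~R + al * w))
    (\sum_(r <- sym_range L) fourier_coef al w h r).
Proof.
move=> h a0 sa; set N := L.*2.+1.
have N0 : (N%:R : R) != 0 by rewrite pnatr_eq0.
have NZ : (N%:Z != 0)%R by [].
have hN : h%:C * N%:R = 1 :> C.
  by rewrite -(rmorph_nat (real_complex R)) -rmorphM mulVf.
have hs := has_sum_sum (sym_range L) (fun r => has_sum_fourier_coef r a0 sa).
have := @has_sum_inj _ _ (fun k : int => k * N) (fun l => (l %/ N)%Z) _ _ _ _ hs.
have -> : (fun k : int => \sum_(r <- sym_range L) h%:C * (gauss_sample h al (al * w) (k * N) *
   e2pi (- (r%:~R * (h * (k * N)%:~R)%:C)))) = (fun k => al * gauss (al * k%:~R + al * w)).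
  apply/funext => k; rewrite -!mulr_sumr sum_roots_of_unity dvdz_mull //.
  rewrite mulrCA hN mulr1 /gauss_sample.
  have -> : h * (k * N)%:~R = k%:~R by rewrite intrM mulrCA (mulVf N0) mulr1.
  by rewrite intC.
apply=> [k|l]; first by rewrite mulzK.
move=> lN; rewrite -!mulr_sumr sum_roots_of_unity; case: ifP => [Nl|_]; last by rewrite !mulr0.
by rewrite divzK ?eqxx in lN.
Qed.

(** Summation by parts. Shifting [l] by one multiplies the twisted sum by [e2pi] of plus or minus
    [t = r * h], so [e2pi t - 2 + e2pi (- t)] times it is the twisted sum of second differences, of
    order [h]. Dividing by at least [t ^+ 2 / 4] bounds [r ^+ 2] times the coefficient; the direct
    bound [5 * D] provides the summand 1 of the denominator. Both are uniform in the mesh, as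
    [tannery] demands. *)
Lemma normc_fourier_coef_le (al w : C) (L : nat) (D : R) (r : int) :
  let h := L.*2.+1%:R^-1 : R in al != 0 ->
  (forall l, normc (gauss_sample h al (al * w) l) <= D / (1 + (h * l%:~R) ^+ 2)) ->
  (forall l, normc (gauss (al * (h * l%:~R + h)%:C + al * w)
     - 2 * gauss (al * (h * l%:~R)%:C + al * w)
     + gauss (al * (h * l%:~R - h)%:C + al * w))
     <= D * h ^+ 2 / (1 + (h * l%:~R) ^+ 2)) ->
  r \in sym_range L ->
  normc (fourier_coef al w h r) <= (5 + 20 * normc al) * D / (1 + (r%:~R) ^+ 2).
Proof.
move=> h a0 hD hD2; rewrite mem_sym_range => rL.
have hp : 0 < h by rewrite invr_gt0 ltr0n.
have hh : 0 < h <= 1 by rewrite hp /= invf_le1 ?ltr0n // ler1n.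
have sa := lattice_summable hh hD.
pose f l := gauss_sample h al (al * w) l * e2pi (- (r%:~R * (h * l%:~R)%:C)).
have hf0 := has_sum_fourier_coef r a0 sa; rewrite -/(f _) in hf0.
pose s := (h%:C)^-1 * fourier_coef al w h r.
have hC : h%:C != 0 :> C by rewrite -normc_eq0 normc_real normr_eq0 gt_eqF.
have hf : has_sum f s.
  by apply: eq_has_sum (has_sumZ _ hf0) => l /=; rewrite mulKf.
have cs : fourier_coef al w h r = h%:C * s by rewrite mulVKf.
have nf l : normc (f l) <= D / (1 + (h * l%:~R) ^+ 2).
  by rewrite normcM -intC -rmorphM -rmorphN normc_e2pi_real mulr1.
have b1 : normc (fourier_coef al w h r) <= 5 * D.
  have := lattice_sum_le hh nf hf; rewrite cs (normcM h%:C) normc_real (gtr0_norm hp).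
  rewrite -ler_pdivlMl // => H; apply: le_trans H _; rewrite le_eqVlt; apply/orP; left.
  by apply/eqP; ring.
pose t : R := r%:~R * h.
have th : `|t| <= 2^-1.
  rewrite normrM (gtr0_norm hp) ler_pdivrMr ?ltr0n // -intr_norm.
  rewrite mulrC ler_pdivlMr // -abszE -pmulrn -(natrM _ _ 2) ler_nat; lia.
have hsum := has_sumD (has_sumD (has_sumZ (e2pi t%:C) (has_sum_shift 1 hf))
   (has_sumZ (-2) hf)) (has_sumZ (e2pi (- t)%:C) (has_sum_shift (-1) hf)).
have E : forall l, e2pi t%:C * f (l + 1) + -2 * f l + e2pi (- t)%:C * f (l + -1) =
  al * (gauss (al * (h * l%:~R + h)%:C + al * w)
     - 2 * gauss (al * (h * l%:~R)%:C + al * w)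
     + gauss (al * (h * l%:~R - h)%:C + al * w)) * e2pi (- (r%:~R * (h * l%:~R)%:C)).
  move=> l; rewrite /f /gauss_sample !intrD !mulrDr mulr1 mulrN1.
  have e1 : e2pi t%:C * e2pi (- (r%:~R * (h * l%:~R + h)%:C)) = e2pi (- (r%:~R * (h * l%:~R)%:C)).
    by rewrite -e2piD /t -intC; congr e2pi; rewrite !rmorphM !rmorphD /=; ring.
  have e2 : e2pi (- t)%:C * e2pi (- (r%:~R * (h * l%:~R - h)%:C)) = e2pi (- (r%:~R * (h * l%:~R)%:C)).
    by rewrite -e2piD /t -intC; congr e2pi; rewrite !rmorphN !rmorphM !rmorphB /=; ring.
  move: e1 e2; set a1 := e2pi t%:C; set a2 := e2pi (- t)%:C.
  set E0 := e2pi (- (_ * (h * _)%:C)); set E1 := e2pi (- (_ * (_ + _)%:C)).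
  set E2 := e2pi (- (_ * (_ - _)%:C)).
  set G1 := gauss (al * (_ + _)%:C + _); set G0 := gauss (al * (h * _)%:C + _).
  set G2 := gauss (al * (_ - _)%:C + _).
  move: a1 a2 E0 E1 E2 G1 G0 G2 => a1 a2 E0 E1 E2 G1 G0 G2 e1 e2.
  transitivity (al * G1 * (a1 * E1) + - 2 * (al * G0 * E0) + al * G2 * (a2 * E2)); first by ring.
  by rewrite e1 e2; ring.
have b2 := lattice_sum_le (D := normc al * (D * h ^+ 2)) hh _ (eq_has_sum E hsum).
have {}b2 : normc (fourier_coef al w h r) * (r%:~R) ^+ 2 <= 20 * normc al * D.
  have {}b2 : normc (e2pi t%:C * s + -2 * s + e2pi (- t)%:C * s) <=
      normc al * (D * h ^+ 2) / h * 5.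
    apply: b2 => l; rewrite normcM -intC -rmorphM -rmorphN normc_e2pi_real mulr1 normcM -mulrA.
    by apply: ler_wpM2l; rewrite ?normc_ge0.
  have := e2pi_diff2_ge th; rewrite cs (normcM h%:C) normc_real (gtr0_norm hp).
  move: b2; rewrite -!mulrDl (normcM _ s).
  move: (normc (_ + _ + _)) (normc s) (normc_ge0 s) (normc al) => u v v0 a.
  have -> : a * (D * h ^+ 2) / h * 5 = 5 * a * D * h by field; rewrite gt_eqF.
  move=> uv tu; have : t ^+ 2 / 4 * v <= 5 * a * D * h.
    by apply: le_trans uv; rewrite ler_wpM2r.
  rewrite /t exprMn => H; clear -H hp.
  rewrite -(ler_pM2r hp); lra.
rewrite ler_pdivlMr ?ltr_pwDl ?sqr_ge0 // mulrDr mulr1; lra.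
Qed.

End Poisson.

(** * Passage to the limit in the rank-one formula *)

Section PoissonLimit.
Variable R : realType.
Local Open Scope complex_scope.
Local Notation C := R[i].

Definition mesh (L : nat) : R := L.*2.+1%:R^-1.

Lemma mesh_gt0 L : 0 < mesh L. Proof. by rewrite invr_gt0 ltr0n. Qed.

Lemma mesh_le1 L : mesh L <= 1.
Proof. by rewrite invf_le1 ?ltr0n // ler1n. Qed.

Lemma mesh_small (e : R) : 0 < e -> exists L0, forall L, (L0 <= L)%N -> mesh L < e.
Proof.
move=> e0; exists (Num.bound e^-1) => L hL.
rewrite -[e]invrK ltf_pV2 ?posrE ?ltr0n ?invr_gt0 //.
have := archi_boundP (ltW (_ : 0 < e^-1)); rewrite invr_gt0 => /(_ e0).
by move=> h; apply: lt_le_trans h _; rewrite ler_nat; lia.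
Qed.

Lemma clim0_shift (u : nat -> C) L0 : clim0 (fun j => u (L0 + j)%N) -> clim0 u.
Proof.
move=> h e /h[N0 hN]; exists (L0 + N0)%N => N hL.
have := hN (N - L0)%N; have -> : (L0 + (N - L0) = N)%N by lia.
by apply; lia.
Qed.

Definition gauss_mean (L : nat) : C :=
  (mesh L)%:C * usum (gauss_sample (mesh L) 1 0).

(** By [gauss_sample_invariance] the two unnormalised sums differ by a bounded amount, and the
    factor [mesh L] sends it to 0. *)
Lemma fourier_coef_cvg (al w : C) (r : int) : in_sector al ->
  clim0 (fun L => fourier_coef al w (mesh L) r - gauss_mean L * fourier_mode al w r).
Proof.
move=> sa e e0.
have [D [h0 [h00 hD]]] := gauss_sample_invariance (al * w + 'i * r%:~R / al) sa.
pose c := `|D| * normc (fourier_mode al w r) + 1.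
have c0 : 0 < c by rewrite ltr_wpDl // mulr_ge0 // normc_ge0.
have [L0 hL0] : exists L0, forall L, (L0 <= L)%N -> mesh L < Num.min h0 (e / c).
  by apply: mesh_small; rewrite lt_min h00 divr_gt0.
exists L0 => L /hL0; rewrite lt_min => /andP[/ltW hh hc].
have [_ _ _ h4] := hD _ (ltn0Sn L.*2) hh.
rewrite /fourier_coef /gauss_mean -mulrBl -mulrBr (normcM (_ * _)) (normcM _%:C).
rewrite normc_real gtr0_norm ?mesh_gt0 //.
apply: le_lt_trans (_ : mesh L * c < e); last by rewrite -ltr_pdivlMr.
rewrite -mulrA ler_wpM2l ?(ltW (mesh_gt0 L)) //.
apply: le_trans (_ : `|D| * normc (fourier_mode al w r) <= _); last by rewrite /c lerDl.
by rewrite ler_wpM2r ?normc_ge0 // (le_trans h4) // ler_norm.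
Qed.

(** The left side [F] of the finite identity is the same for all fine meshes, and [tannery] allows
    each coefficient to be replaced by its limiting form. The limit of [gauss_mean] is still unknown
    at this point. *)
Lemma poisson_pre (al w : C) : in_sector al -> exists2 F : C,
  has_sum (fun k : int => al * gauss (al * k%:~R + al * w)) F &
  clim0 (fun L => F - gauss_mean L * usum (fourier_mode al w)).
Proof.
move=> sa; have a0 := in_sector_neq0 sa.
have [D [h0 [h00 hD]]] := gauss_sample_invariance (al * w) sa.
have [D1 [h1 [h10 hD1]]] := gauss_sample_invariance 0 (@in_sector1 R).
have [Dm Dm0 hDm] := fourier_mode_bound w sa.
have [L0 hL0] : exists L0, forall L, (L0 <= L)%N -> mesh L < Num.min h0 h1.
  by apply: mesh_small; rewrite lt_min h00.
have hm L : (L0 <= L)%N -> mesh L <= h0 /\ mesh L <= h1.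
  by move=> /hL0; rewrite lt_min => /andP[/ltW ? /ltW].
have hsum L : (L0 <= L)%N ->
    has_sum (fun k : int => al * gauss (al * k%:~R + al * w))
      (\sum_(r <- sym_range L) fourier_coef al w (mesh L) r).
  move=> /hm[m0 _]; apply: sum_fourier_coef => //.
  by have [_ ? _ _] := hD _ (ltn0Sn L.*2) m0.
have mesh01 L : 0 < mesh L <= 1 by rewrite mesh_gt0 mesh_le1.
pose F := \sum_(r <- sym_range L0) fourier_coef al w (mesh L0) r.
exists F; first exact: hsum.
have FE j : \sum_(r <- sym_range (L0 + j)) fourier_coef al w (mesh (L0 + j)) r = F.
  by apply: has_sum_unique (hsum _ (leq_addr _ _)) (hsum _ (leqnn _)).
have kap j : normc (gauss_mean (L0 + j)) <= 5 * D1.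
  have [_ m1] := hm _ (leq_addr j L0).
  have [b1 b2 _ _] := hD1 _ (ltn0Sn (L0 + j).*2) m1.
  have := lattice_sum_le (mesh01 (L0 + j)%N) b1 (has_sum_usum b2).
  rewrite /gauss_mean normcM normc_real (gtr0_norm (mesh_gt0 _)).
  have mp := mesh_gt0 (L0 + j); rewrite -ler_pdivlMl // => H.
  by apply: le_trans H _; rewrite le_eqVlt; apply/orP; left; apply/eqP; ring.
have D10 : 0 <= 5 * D1 by apply: le_trans (kap 0%N); exact: normc_ge0.
have D0 : 0 <= D.
  have [m0 _] := hm _ (leqnn L0); have [b1 _ _ _] := hD _ (ltn0Sn L0.*2) m0.
  by apply: le_trans (normc_ge0 _) (le_trans (b1 0) _); rewrite mulr0 expr0n addr0 divr1.
pose d j r := fourier_coef al w (mesh (L0 + j)) r - gauss_mean (L0 + j) * fourier_mode al w r.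
pose B := (5 + 20 * normc al) * D + 5 * D1 * Dm.
have B0 : 0 <= B.
  have := normc_ge0 al => na; apply: addr_ge0; last exact: mulr_ge0.
  by apply: mulr_ge0 => //; lra.
have p2 (r : int) : 0 < 1 + (r%:~R : R) ^+ 2 by rewrite ltr_pwDl // sqr_ge0.
have lim1 : clim0 (fun j => \sum_(r <- sym_range (L0 + j)) d j r).
  apply: (@tannery _ _ _ (fun r => B * (1 + (r%:~R) ^+ 2)^-1)).
  - by move=> r; rewrite mulr_ge0 // invr_ge0 ltW.
  - by apply: rsummable_le B0 _ (rsummable_lattice_inv R).
  - move=> j r rj; apply: le_trans (le_normcD _ _) _; rewrite normcN /B mulrDl.
    apply: lerD.
      have [m0 _] := hm _ (leq_addr j L0).
      have [b1 _ b3 _] := hD _ (ltn0Sn (L0 + j).*2) m0.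
      exact: normc_fourier_coef_le.
    by rewrite (normcM (gauss_mean _)) -[leRHS]mulrA; exact: ler_pM (normc_ge0 _) (normc_ge0 _) (kap j) (hDm r).
  - move=> r e /(fourier_coef_cvg w r sa)[N0 hN]; exists N0 => j jN.
    by apply: hN; lia.
have lim2 : clim0 (fun j => \sum_(r <- sym_range (L0 + j)) fourier_mode al w r
     - usum (fourier_mode al w)).
  move=> e e0; have [A hA] := has_sum_usum (fourier_mode_summable w sa) e0.
  exists (\max_(r <- A) absz r)%N => j hj; apply: hA.
  apply/fsubsetP => r rA; rewrite mem_sym_range.
  apply: leq_trans (leq_addl _ _); apply: leq_trans hj.
  by rewrite (big_rem r rA) /= leq_maxl.
have lim3 : clim0 (fun j => gauss_mean (L0 + j) *
   (\sum_(r <- sym_range (L0 + j)) fourier_mode al w r - usum (fourier_mode al w))).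
  apply: (clim0_bounded (K := 5 * D1)) lim2 => j.
  by rewrite normcM ler_wpM2r ?normc_ge0.
apply: (@clim0_shift _ L0); have := clim0D lim1 lim3.
congr clim0; apply/funext => j; rewrite /d sumrB FE -mulr_sumr.
by rewrite mulrBr addrA subrK.
Qed.

(** For [al = 1] and [w = 0] both sides of [poisson_pre] are the same series of positive terms, with
    sum [F]. So [F * (1 - gauss_mean L)] tends to 0 with [F != 0], which stands in for evaluating
    the Gaussian integral. *)
Lemma gauss_mean_cvg1 : clim0 (fun L => 1 - gauss_mean L).
Proof.
have s1 := @in_sector1 R; have [F hF hl] := poisson_pre 0 s1.
have FE : usum (fourier_mode 1 0) = F.
  apply: usum_eq; apply: eq_has_sum hF => k.
  by rewrite /fourier_mode divr1 !mulr0 e2pi0 mulr1 !mul1r addr0.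
have F0 : F != 0.
  apply: (@has_sum_pos_neq0 _ _ (fun k : int => expR (- (pi * (k%:~R) ^+ 2))) 0) => [k||].
  - exact: expR_ge0.
  - exact: expR_gt0.
  - apply: eq_has_sum hF => k.
    by rewrite mulr0 addr0 !mul1r /gauss -intC -rmorphXn -rmorphM -rmorphN cexp_real.
rewrite FE in hl; apply: (clim0_bounded (K := normc F^-1)) hl => L.
by rewrite -normcM (_ : F^-1 * _ = 1 - gauss_mean L) //; field.
Qed.

Theorem poisson_gauss (al w : C) : in_sector al ->
  has_sum (fun k : int => al * gauss (al * k%:~R + al * w)) (usum (fourier_mode al w)).
Proof.
move=> sa; have [F hF hl] := poisson_pre w sa.
suff -> : usum (fourier_mode al w) = F by [].
set s := usum _ in hl *; apply/esym/eqP; rewrite -subr_eq0; apply/eqP; apply: clim0_cst.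
have h2 : clim0 (fun L => - ((1 - gauss_mean L) * s)).
  apply: (clim0_bounded (K := normc s)) gauss_mean_cvg1 => L.
  by rewrite normcN normcM mulrC.
have := clim0D hl h2; congr clim0; apply/funext => L; ring.
Qed.

End PoissonLimit.

(** * Completing squares with the Schur complement *)

Section Schur.
Variables (F : fieldType) (n : nat).
Implicit Types (A : 'M[F]_(1 + n)).

Definition pivot A : F := A 0 0.
(** Meant for symmetric matrices: the upper right block is replaced by the transpose of the lower
    left one. *)
Definition schur A : 'M[F]_n :=
  drsubmx A - (pivot A)^-1 *: (dlsubmx A *m (dlsubmx A)^T).

Lemma ulsubmx_pivot A : ulsubmx A = (pivot A)%:M.
Proof.
rewrite [LHS]mx11_scalar; congr (_%:M); rewrite !mxE; congr (A _ _); exact: val_inj.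
Qed.

Lemma sym_block A : A^T = A ->
  A = block_mx (pivot A)%:M (dlsubmx A)^T (dlsubmx A) (drsubmx A).
Proof. by move=> sA; rewrite trmx_dlsub sA -ulsubmx_pivot submxK. Qed.

Lemma tr_schur A : A^T = A -> (schur A)^T = schur A.
Proof.
move=> sA; rewrite /schur linearB linearZ /= trmx_mul trmxK.
by rewrite trmx_drsub sA.
Qed.

Lemma schur_form m (x : 'M[F]_(m, 1)) (y : 'M[F]_(m, n)) A : A^T = A -> pivot A != 0 ->
  row_mx x y *m A *m (row_mx x y)^T =
  pivot A *: ((x + (pivot A)^-1 *: (y *m dlsubmx A)) *m (x + (pivot A)^-1 *: (y *m dlsubmx A))^T)
  + y *m schur A *m y^T.
Proof.
move=> sA p0; rewrite {1}(sym_block sA) /schur.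
move: (pivot A) p0 (dlsubmx A) (drsubmx A) => a a0 b D.
set w := a^-1 *: (y *m b).
have yb : y *m b = a *: w by rewrite /w scalerA mulfV // scale1r.
have ybT : b^T *m y^T = a *: w^T by rewrite -trmx_mul yb linearZ.
have yS : y *m (D - a^-1 *: (b *m b^T)) *m y^T = y *m D *m y^T - a *: (w *m w^T).
  rewrite mulmxBr mulmxBl -scalemxAr -scalemxAl -!mulmxA ybT (mulmxA y b) yb.
  by rewrite -scalemxAl -scalemxAr !scalerA mulVf // mul1r.
rewrite yS mul_row_block tr_row_mx mul_row_col mul_mx_scalar yb.
rewrite (mulmxDl (x *m b^T)) -(mulmxA x) ybT [in RHS]linearD /=.
rewrite -scalerDr -scalemxAl -scalemxAr [in RHS]mulmxDr scalerDr.
rewrite [in RHS](mulmxDl x w w^T) [in RHS]scalerDr -!addrA; congr (_ + (_ + _)).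
by rewrite addrC subrK.
Qed.

(** For the inverse form the square is completed the other way round: the first coordinate enters
    through the inverse pivot alone and shifts the others. The row [row_mx x w] solves
    [row_mx x w *m A = row_mx k y]. *)
Lemma pivot_schur_dual (A B : 'M[F]_(1 + n)) (k : 'M[F]_1) (y : 'rV[F]_n) (S' : 'M[F]_n) :
  A^T = A -> pivot A != 0 -> A *m B = 1%:M -> schur A *m S' = 1%:M ->
  row_mx k y *m B *m (row_mx k y)^T =
  (pivot A)^-1 *: (k *m k^T) +
  (y - (pivot A)^-1 *: (k *m (dlsubmx A)^T)) *m S'
    *m (y - (pivot A)^-1 *: (k *m (dlsubmx A)^T))^T.
Proof.
move=> sA p0 AB SS.
have S'S := mulmx1C SS.
pose y' := y - (pivot A)^-1 *: (k *m (dlsubmx A)^T).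
pose w := y' *m S'; pose x := (pivot A)^-1 *: (k - w *m dlsubmx A).
have wS : w *m schur A = y' by rewrite /w -mulmxA S'S mulmx1.
have E : row_mx x w *m A = row_mx k y.
  rewrite (sym_block sA) mul_row_block mul_mx_scalar.
  rewrite /x scalerA mulfV // scale1r subrK; congr row_mx.
  have -> : drsubmx A = schur A + (pivot A)^-1 *: (dlsubmx A *m (dlsubmx A)^T).
    by rewrite /schur subrK.
  rewrite mulmxDr wS -scalemxAl mulmxBl scalerBr.
  by rewrite -scalemxAr mulmxA addrCA -addrA subrK addNr addr0.
have -> : row_mx k y *m B = row_mx x w by rewrite -E -mulmxA AB mulmx1.
rewrite tr_row_mx mul_row_col -/y' -/w /x -scalemxAl mulmxBl scalerBr -addrA.
congr (_ + _).
have -> : y'^T = y^T - (pivot A)^-1 *: (dlsubmx A *m k^T).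
  by rewrite /y' linearB linearZ /= trmx_mul trmxK.
by rewrite mulmxBr -scalemxAr mulmxA addrC.
Qed.

End Schur.

(** * Gaussian sums over integral matrices, uniformly in the shift *)

Section UniformGaussianBound.
Variable R : realType.
Local Open Scope fset_scope.
Local Open Scope ring_scope.

Lemma posdef_pivot n (A : 'M[R]_(1 + n)) : posdef A -> 0 < pivot A.
Proof.
move=> pA; have := pA (row_mx 1%:M 0).
have -> : (row_mx 1%:M 0 : 'rV_(1 + n)) *m A *m (row_mx 1%:M 0)^T = (pivot A)%:M.
  rewrite -{1}[A]submxK mul_row_block !mul0mx !mul1mx !addr0 tr_row_mx mul_row_col.
  by rewrite trmx0 mulmx0 addr0 trmx1 mulmx1 ulsubmx_pivot.
rewrite [(_%:M) 0 0]mxE; apply; apply/eqP => /(congr1 lsubmx).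
rewrite row_mxKl linear0 => /matrixP/(_ 0 0); rewrite !mxE => /eqP.
by rewrite oner_eq0.
Qed.

Lemma posdef_schur n (A : 'M[R]_(1 + n)) : A^T = A -> posdef A -> posdef (schur A).
Proof.
move=> sA pA y y0; have a0 : pivot A != 0 by rewrite gt_eqF // posdef_pivot.
pose x : 'M[R]_1 := - ((pivot A)^-1 *: (y *m dlsubmx A)).
have := pA (row_mx x y); rewrite schur_form // /x addNr mul0mx scaler0 add0r; apply.
apply: contra_neq y0 => /(congr1 rsubmx); rewrite row_mxKr => ->.
by apply/matrixP => i j; rewrite !mxE.
Qed.

Lemma posdef_scale n (A : 'M[R]_n) c : 0 < c -> posdef A -> posdef (c *: A).
Proof.
by move=> c0 pA x /pA h; rewrite -scalemxAr -scalemxAl mxE mulr_gt0.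
Qed.

Definition zreal (m n : nat) (x : 'M[int]_(m, n)) : 'M[R]_(m, n) := map_mx intr x.

Definition gform m n (M : 'M[R]_m) (Y : 'M[R]_n) (u v : 'M[R]_(m, n)) : R :=
  expR (- \tr (M *m (v *m Y *m v^T)) + \tr (u^T *m v)).

(** Uniformity in the real shift [s] is what the induction needs: once the square is completed, the
    first column runs over a lattice translated by a vector that depends on the other columns. *)
Definition gform_bounded m n (M : 'M[R]_m) (Y : 'M[R]_n) : Prop :=
  forall u, exists K : R, forall (s : 'M[R]_(m, n)) (A : {fset 'M[int]_(m, n)}),
    \sum_(x <- A) gform M Y u (zreal x + s) <= K.

Lemma gauss1_bound (p u : R) : 0 < p -> exists2 K : R, 0 <= K & forall x,
  expR (- (p * x ^+ 2) + u * x) <= K / (1 + x ^+ 2).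
Proof.
move=> p0; exists (expR (u ^+ 2 / (2 * p)) * (1 + 2 / p)).
  by rewrite mulr_ge0 ?expR_ge0 // addr_ge0 // divr_ge0 // ltW.
move=> x; have x2 := sqr_ge0 x.
rewrite ler_pdivlMr ?ltr_pwDl //.
have h1 : - (p * x ^+ 2) + u * x <= u ^+ 2 / (2 * p) - p * x ^+ 2 / 2.
  rewrite -subr_ge0.
  have -> : u ^+ 2 / (2 * p) - p * x ^+ 2 / 2 - (- (p * x ^+ 2) + u * x)
     = (u - p * x) ^+ 2 / (2 * p) by field; rewrite gt_eqF.
  by rewrite divr_ge0 ?sqr_ge0 // mulr_ge0 // ltW.
apply: le_trans (_ : expR (u ^+ 2 / (2 * p) - p * x ^+ 2 / 2) * (1 + x ^+ 2) <= _).
  by apply: ler_wpM2r; rewrite ?ler_expR ?addr_ge0.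
rewrite expRD -mulrA ler_wpM2l ?expR_ge0 // expRN mulrC ler_pdivrMr ?expR_gt0 //.
have := expR_ge1Dx (p * x ^+ 2 / 2); set E := expR _ => hE.
apply: le_trans (_ : (1 + 2 / p) * (1 + p * x ^+ 2 / 2) <= _); last first.
  by rewrite ler_wpM2l // addr_ge0 // divr_ge0 // ltW.
rewrite -subr_ge0.
have -> : (1 + 2 / p) * (1 + p * x ^+ 2 / 2) - (1 + x ^+ 2) = p * x ^+ 2 / 2 + 2 / p.
  by field; rewrite gt_eqF.
by rewrite addr_ge0 // ?divr_ge0 ?(ltW p0) // mulr_ge0 // ltW.
Qed.

Lemma gauss1_sum_bound (p u : R) : 0 < p -> exists K : R, forall (t : R) (A : {fset int}),
  \sum_(k <- A) expR (- (p * (k%:~R + t) ^+ 2) + u * (k%:~R + t)) <= K.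
Proof.
move=> /gauss1_bound - /(_ u)[K K0 hK]; exists (3 * K * 5) => t A.
(* An integral shift permutes the integers, so only the fractional part matters, and
   [1 + x ^+ 2 <= 3 * (1 + (x + t') ^+ 2)] when [t'] lies between 0 and 1. *)
pose t' := t - (Num.floor t)%:~R.
have t01 : 0 <= t' <= 1.
  have := floor_le t; have := lt_succ_floor t; rewrite intrD /t'; lra.
pose B := [fset k + Num.floor t | k in A].
apply: le_trans (_ : \sum_(k <- B) (3 * K) * (1 / (1 + (1 * k%:~R) ^+ 2)) <= _).
  rewrite big_imfset /=; last by move=> x y _ _ /addIr.
  apply: ler_sum => k _; rewrite (mul1r (_%:~R)).
  have -> : k%:~R + t = (k + Num.floor t)%:~R + t'.
    by rewrite intrD /t'; ring.
  move: (k + Num.floor t) => {}k.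
  apply: le_trans (hK _) _; move: (k%:~R) => x.
  have -> : 3 * K * (1 / (1 + x ^+ 2)) = K * (3 / (1 + x ^+ 2)) by ring.
  rewrite ler_wpM2l // ler_pdivlMr ?ltr_pwDl ?sqr_ge0 //.
  rewrite mulrC ler_pdivrMr ?ltr_pwDl ?sqr_ge0 //.
  have /andP[t0 t1] := t01; have := sqr_ge0 (2 * x + 3 * t'); nra.
rewrite -mulr_sumr ler_wpM2l ?mulr_ge0 //.
by apply: riemann_sum_bound; rewrite ltr01 lexx.
Qed.

Lemma gform_schur m n (M : 'M[R]_m) (Y : 'M[R]_(1 + n)) (u1 x : 'M[R]_(m, 1))
    (u2 y : 'M[R]_(m, n)) : Y^T = Y -> pivot Y != 0 ->
  gform M Y (row_mx u1 u2) (row_mx x y) =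
  gform M (pivot Y)%:M u1 (x + (pivot Y)^-1 *: (y *m dlsubmx Y)) *
  gform M (schur Y) (u2 - (pivot Y)^-1 *: (u1 *m (dlsubmx Y)^T)) y.
Proof.
move=> sY p0; rewrite /gform -expRD schur_form //; congr expR.
set w := _ *: _; rewrite mul_mx_scalar -scalemxAl mulmxDr mxtraceD opprD.
rewrite -!addrA; congr (_ + _); rewrite [in RHS]addrCA; congr (_ + _).
rewrite tr_row_mx mul_col_row mxtrace_block linearB linearZ /= trmx_mul trmxK.
rewrite mulmxBl mulmxDr mxtraceD -addrA; congr (_ + _).
rewrite linearB /= -scalemxAl -scalemxAr !mxtraceZ mulmxA.
rewrite -(mulmxA (dlsubmx Y)) (mxtrace_mulC (dlsubmx Y)).
by rewrite addrC subrK.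
Qed.

Lemma zreal_row_mx m n (x : 'M[int]_(m, 1)) (y : 'M[int]_(m, n)) :
  zreal (row_mx x y) = row_mx (zreal x) (zreal y).
Proof. exact: map_row_mx. Qed.

Lemma gform_boundedT m n (M : 'M[R]_m) (Y : 'M[R]_n) : M^T = M -> Y^T = Y ->
  gform_bounded M Y -> gform_bounded Y M.
Proof.
move=> sM sY h u; have [K hK] := h u^T; exists K => s A.
have := hK s^T [fset x^T | x in A]; rewrite big_imfset /=; last by move=> x y _ _ /trmx_inj.
congr (_ <= _); apply: eq_bigr => x _; rewrite /zreal -matrix.map_trmx -linearD /=.
rewrite /gform !trmxK; move: (map_mx _ x + s) => v; congr expR; congr (- _ + _).
  by rewrite mxtrace_mulC -!mulmxA mxtrace_mulC -!mulmxA.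
by rewrite -[LHS]mxtrace_tr trmx_mul trmxK mxtrace_mulC.
Qed.

Lemma gform_bounded_step m (M : 'M[R]_m) :
  (forall a : R, 0 < a -> @gform_bounded m 1 M a%:M) ->
  forall n (Y : 'M[R]_n), Y^T = Y -> posdef Y -> gform_bounded M Y.
Proof.
move=> h1; elim=> [|n IH] Y sY pY u.
  exists 1 => s A; apply: le_trans (_ : \sum_(x <- [:: 0 : 'M[int]_(m, 0)]) (1 : R) <= _).
    apply: le_trans (_ : \sum_(x <- A) (1 : R) <= _).
      apply: ler_sum => x _; rewrite /gform [zreal x + s]thinmx0.
      by rewrite trmx0 !mulmx0 !mxtrace0 oppr0 addr0 expR0.
    by apply: ler_sum_subset => // x _; rewrite [x]thinmx0 mem_head.
  by rewrite big_seq1.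
rewrite -[n.+1]/(1 + n)%N in Y sY pY u *.
have p0 := posdef_pivot pY; have p0' : pivot Y != 0 by rewrite gt_eqF.
have [K1 hK1] := h1 _ p0 (lsubmx u).
have [K2 hK2] := IH _ (tr_schur sY) (posdef_schur sY pY)
   (rsubmx u - (pivot Y)^-1 *: (lsubmx u *m (dlsubmx Y)^T)).
have K10 : 0 <= K1 by have := hK1 0 fset0; rewrite big_seq_fset0.
exists (K1 * K2) => s A.
pose A1 := [fset lsubmx (x : 'M[int]_(m, 1 + n)) | x in A].
pose A2 := [fset rsubmx (x : 'M[int]_(m, 1 + n)) | x in A].
apply: le_trans (_ : \sum_(x <- [seq row_mx x y | y <- A2, x <- A1]) gform M Y u (zreal x + s) <= _).
  apply: ler_sum_subset => // [x|x xA]; first exact: expR_ge0.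
  apply/allpairsP; exists (rsubmx (x : 'M[int]_(m, 1 + n)), lsubmx (x : 'M[int]_(m, 1 + n))).
  by rewrite /= hsubmxK !in_imfset.
rewrite big_allpairs_dep /=.
apply: le_trans (_ : \sum_(y <- A2) K1 * gform M (schur Y)
   (rsubmx u - (pivot Y)^-1 *: (lsubmx u *m (dlsubmx Y)^T)) (zreal y + rsubmx s) <= _); last first.
  by rewrite -mulr_sumr ler_wpM2l.
apply: ler_sum => y _.
apply: le_trans (_ : \sum_(x <- A1) gform M (pivot Y)%:M (lsubmx u)
   (zreal x + (lsubmx s + (pivot Y)^-1 *: ((zreal y + rsubmx s) *m dlsubmx Y))) *
   gform M (schur Y) (rsubmx u - (pivot Y)^-1 *: (lsubmx u *m (dlsubmx Y)^T))
     (zreal y + rsubmx s) <= _); last first.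
  by rewrite -mulr_suml ler_wpM2r ?expR_ge0.
apply: ler_sum => x _; rewrite addrA -gform_schur // hsubmxK.
by rewrite zreal_row_mx -[s in leLHS]hsubmxK add_row_mx.
Qed.

Lemma gform_bounded_row n (Y : 'M[R]_n) c : 0 < c -> Y^T = Y -> posdef Y ->
  @gform_bounded 1 n c%:M Y.
Proof.
move=> c0; apply: gform_bounded_step => a a0 u.
have [K hK] := gauss1_sum_bound (u 0 0) (mulr_gt0 c0 a0); exists K => s A.
have := hK (s 0 0) [fset (x : 'M[int]_1) 0 0 | x in A]; rewrite big_imfset /=; last first.
  by move=> x y _ _ xy; apply/matrixP => i j; rewrite !ord1.
congr (_ <= _); apply: eq_bigr => x _; rewrite /gform.
have -> : zreal x + s = ((x 0 0)%:~R + s 0 0)%:M.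
  by rewrite [LHS]mx11_scalar !mxE.
move: (_ + s 0 0) => v; rewrite [u in RHS]mx11_scalar !tr_scalar_mx -!scalar_mxM !mxtrace_scalar.
by rewrite !mulr1n; congr expR; ring.
Qed.

(** The induction on columns is used twice: the row case, transposed, is the one-column base case
    for a general [M]. *)
Lemma gform_bounded_posdef m n (M : 'M[R]_m) (Y : 'M[R]_n) : M^T = M -> Y^T = Y ->
  posdef M -> posdef Y -> gform_bounded M Y.
Proof.
move=> sM sY pM; move: sY; apply: gform_bounded_step => a a0.
by apply: gform_boundedT => //; [exact: tr_scalar_mx | exact: gform_bounded_row].
Qed.

End UniformGaussianBound.

(** * Real-linear maps on complex matrices; absolute convergence of theta *)

Section ComplexMatrices.
Variable R : realType.
Local Open Scope complex_scope.
Local Notation C := R[i].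

Lemma ReD (z w : C) : complex.Re (z + w) = complex.Re z + complex.Re w.
Proof. by case: z w => a b []. Qed.

Lemma ImD (z w : C) : complex.Im (z + w) = complex.Im z + complex.Im w.
Proof. by case: z w => a b []. Qed.

Lemma ReZ (r : R) (z : C) : complex.Re (r%:C * z) = r * complex.Re z.
Proof. by case: z => a b /=; rewrite mul0r subr0. Qed.

Lemma ImZ (r : R) (z : C) : complex.Im (r%:C * z) = r * complex.Im z.
Proof. by case: z => a b /=; rewrite mul0r addr0. Qed.

Section RealLinear.
Variable f : C -> R.
Hypotheses (fD : forall z w, f (z + w) = f z + f w)
  (fZ : forall (r : R) z, f (r%:C * z) = r * f z).

Lemma rlin0 : f 0 = 0.
Proof. by have := fZ 0 0; rewrite !(mulr0, mul0r). Qed.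

Lemma rlin_sum (I : Type) (s : seq I) (F : I -> C) :
  f (\sum_(i <- s) F i) = \sum_(i <- s) f (F i).
Proof. exact: (big_morph f fD rlin0). Qed.

Lemma rlin_tr n (A : 'M[C]_n) : f (\tr A) = \tr (map_mx f A).
Proof. by rewrite /mxtrace rlin_sum; apply: eq_bigr => i _; rewrite mxE. Qed.

Lemma rlin_mulmxl m n p (A : 'M[R]_(m, n)) (B : 'M[C]_(n, p)) :
  map_mx f (toC A *m B) = A *m map_mx f B.
Proof.
apply/matrixP => i j; rewrite !mxE rlin_sum; apply: eq_bigr => k _.
by rewrite !mxE fZ.
Qed.

Lemma rlin_mulmxr m n p (A : 'M[C]_(m, n)) (B : 'M[R]_(n, p)) :
  map_mx f (A *m toC B) = map_mx f A *m B.
Proof.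
apply/matrixP => i j; rewrite !mxE rlin_sum; apply: eq_bigr => k _.
by rewrite !mxE mulrC fZ mulrC.
Qed.

Lemma rlin_mxD m n (A B : 'M[C]_(m, n)) : map_mx f (A + B) = map_mx f A + map_mx f B.
Proof. by apply/matrixP => i j; rewrite !mxE fD. Qed.

End RealLinear.

Lemma ztoCE m n (x : 'M[int]_(m, n)) : ztoC R x = toC (zreal R x).
Proof. by apply/matrixP => i j; rewrite !mxE intC. Qed.

Lemma toCM m n p (A : 'M[R]_(m, n)) (B : 'M[R]_(n, p)) : toC (A *m B) = toC A *m toC B.
Proof. exact: map_mxM. Qed.

Lemma toCT m n (A : 'M[R]_(m, n)) : toC A^T = (toC A)^T.
Proof. by apply/matrixP => i j; rewrite !mxE. Qed.

Lemma toC_tr n (A : 'M[R]_n) : \tr (toC A) = (\tr A)%:C.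
Proof. by rewrite /mxtrace rmorph_sum; apply: eq_bigr => i _; rewrite mxE. Qed.

Lemma toC_pivot n (A : 'M[R]_(1 + n)) : pivot (toC A) = (pivot A)%:C.
Proof. by rewrite /pivot mxE. Qed.

Lemma toC_schur n (A : 'M[R]_(1 + n)) : schur (toC A) = toC (schur A).
Proof.
rewrite /schur toC_pivot -fmorphV.
apply/matrixP => i j; rewrite !mxE rmorphB rmorphM rmorph_sum /=; congr (_ - _ * _).
by apply: eq_bigr => k _; rewrite !mxE rmorphM.
Qed.

Lemma expquad_summable n (A : 'M[R]_n) (p c : C) (l : 'rV[C]_n) :
  A^T = A -> posdef A -> 0 < complex.Re p ->
  abs_summable (fun x : 'rV[int]_n =>
    cexp (c - p * \tr (ztoC R x *m toC A *m (ztoC R x)^T) + \tr (ztoC R x *m l^T))).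
Proof.
move=> sA pA p0.
have sA' : (complex.Re p *: A)^T = complex.Re p *: A by rewrite linearZ /= sA.
have [K hK] := gform_bounded_row ltr01 sA' (posdef_scale p0 pA) (map_mx (@complex.Re R) l).
exists (expR (complex.Re c) * K) => B; apply: le_trans (ler_wpM2l (expR_ge0 _) (hK 0 B)).
rewrite mulr_sumr; apply: ler_sum => x _.
rewrite normc_cexp /gform -expRD ler_expR addr0 mul1mx ztoCE.
rewrite !ReD -addrA lerD2l le_eqVlt; apply/orP; left; apply/eqP; congr (_ + _).
  rewrite -!toCT -!toCM toC_tr.
  have -> : complex.Re (- (p * (\tr (zreal R x *m A *m (zreal R x)^T))%:C)) =
     - (complex.Re p * \tr (zreal R x *m A *m (zreal R x)^T)).
    by case: p {p0 sA' hK} => a b /=; rewrite mulr0 subr0.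
  by rewrite -scalemxAr -scalemxAl mxtraceZ.
rewrite (rlin_tr ReD ReZ) (rlin_mulmxl ReD ReZ) [RHS]mxtrace_mulC.
by congr (\tr (_ *m _)); apply/matrixP => i j; rewrite !mxE.
Qed.

(** The modulus of a term is a [gform] with form [pi] times the imaginary part of [Om] and linear
    part [- 2 * pi * M] times the imaginary part of [Z]. *)
Lemma theta_summable m n (M : 'M[int]_m) (Om : 'M[C]_n) (Z : 'M[C]_(m, n)) :
  M^T = M -> posdef (zreal R M) -> siegel Om ->
  abs_summable (fun x : 'M[int]_(m, n) =>
    cexp (pi_i R * \tr (ztoC R M *m (ztoC R x *m Om *m (ztoC R x)^T
      + (ztoC R x *m Z^T) *+ 2)))).
Proof.
move=> sM pM [sO pO].
have sMr : (zreal R M)^T = zreal R M by rewrite /zreal matrix.map_trmx sM.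
set Y := map_mx _ Om in pO.
have sY : (pi *: Y)^T = pi *: Y by rewrite linearZ /= /Y matrix.map_trmx sO.
have [K hK] := gform_bounded_posdef sMr sY pM (posdef_scale (pi_gt0 R) pO)
  (- (2 * pi) *: (zreal R M *m map_mx (@complex.Im R) Z)).
exists K => B; apply: le_trans (hK 0 B).
rewrite le_eqVlt; apply/orP; left; apply/eqP; apply: eq_bigr => x _.
rewrite normc_cexp /gform addr0; congr expR.
have -> : forall t : C, complex.Re (pi_i R * t) = - (pi * complex.Im t).
  by move=> [a b]; rewrite /= mul0r sub0r.
rewrite !ztoCE (rlin_tr ImD ImZ) (rlin_mulmxl ImD ImZ) (rlin_mxD ImD) -toCT.
rewrite (rlin_mulmxr ImD ImZ) (rlin_mulmxl ImD ImZ) mulr2n (rlin_mxD ImD) (rlin_mulmxl ImD ImZ).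
rewrite mulmxDr mxtraceD mulrDr opprD; congr (_ + _).
  by rewrite -scalemxAr -scalemxAl -scalemxAr mxtraceZ.
rewrite [X in \tr (X *m _)]linearZ /= -scalemxAl mxtraceZ trmx_mul sMr -mulmxA.
rewrite [in RHS]mxtrace_mulC -mulmxA matrix.map_trmx mulmxDr mxtraceD; ring.
Qed.

End ComplexMatrices.

(** * Poisson summation over a lattice, one coordinate at a time *)

Section LatticePoisson.
Variable R : realType.
Local Open Scope complex_scope.
Local Notation C := R[i].
Local Notation piC := ((pi : R)%:C : C).

Lemma mx11_tr (F : pzRingType) (A : 'M[F]_1) : A = (\tr A)%:M.
Proof. by rewrite [LHS]mx11_scalar trace_mx11. Qed.

Lemma scalar_mx_add (F : pzRingType) n (c d : F) : (c + d)%:M = c%:M + d%:M :> 'M[F]_n.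
Proof. exact: raddfD. Qed.

Lemma trmx_scale (F : pzRingType) m n (c : F) (A : 'M[F]_(m, n)) : (c *: A)^T = c *: A^T.
Proof. exact: linearZ. Qed.

(** The matrix stays real and only the scalar [be] is complex, so each coordinate meets a Gaussian
    whose slope is a positive multiple of [be]. *)
Definition quad_term n (A : 'M[R]_n) (be : C) (z : 'rV[C]_n) (x : 'rV[int]_n) : C :=
  cexp (- (piC / be ^+ 2 * \tr (ztoC R x *m toC A *m (ztoC R x)^T))
        + pi_i R *+ 2 * \tr (ztoC R x *m z^T)).

Definition dual_term n (B : 'M[R]_n) (be : C) (z : 'rV[C]_n) (x : 'rV[int]_n) : C :=
  cexp (- (piC * be ^+ 2 * \tr ((ztoC R x + z) *m toC B *m (ztoC R x + z)^T))).

Lemma Re_pi_scale (z : C) : complex.Re (piC * z) = pi * complex.Re z.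
Proof. exact: ReZ. Qed.

Lemma quad_term_summable n (A : 'M[R]_n) be z : A^T = A -> posdef A -> in_sector be ->
  abs_summable (quad_term A be z).
Proof.
move=> sA pA sb.
have p0 : 0 < complex.Re (piC / be ^+ 2).
  rewrite Re_pi_scale -exprVn mulr_gt0 ?pi_gt0 //.
  exact/in_sector_Re_sqr/in_sectorV.
have := expquad_summable 0 ((pi_i R *+ 2) *: z) sA pA p0.
congr abs_summable; apply/funext => x; rewrite /quad_term sub0r.
by rewrite trmx_scale -scalemxAr mxtraceZ.
Qed.

Lemma dual_term_summable n (B : 'M[R]_n) be z : B^T = B -> posdef B -> in_sector be ->
  abs_summable (dual_term B be z).
Proof.
move=> sB pB sb.
have p0 : 0 < complex.Re (piC * be ^+ 2).
  by rewrite Re_pi_scale mulr_gt0 ?pi_gt0 //; exact: in_sector_Re_sqr.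
have := expquad_summable (- (piC * be ^+ 2 * \tr (z *m toC B *m z^T)))
  (- (2 * (piC * be ^+ 2)) *: (z *m toC B)) sB pB p0.
congr abs_summable; apply/funext => x; rewrite /dual_term; congr cexp.
move: (ztoC R x) => X; rewrite trmx_scale -scalemxAr mxtraceZ trmx_mul -toCT sB.
rewrite linearD /= !mulmxDr !mulmxDl !mxtraceD mulmxA.
have -> : \tr (z *m toC B *m X^T) = \tr (X *m toC B *m z^T).
  by rewrite -[LHS]mxtrace_tr !trmx_mul trmxK -toCT sB mulmxA.
ring.
Qed.

(** In the induction the shift [z' k] differs from a fixed vector by a real one, so the sums of
    moduli do not depend on [k]. *)
Lemma quad_term_real_shift n (A : 'M[R]_n) be z (r : 'rV[R]_n) x :
  normc (quad_term A be (z + toC r) x) = normc (quad_term A be z x).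
Proof.
rewrite /quad_term (_ : (z + toC r)^T = z^T + (toC r)^T); last exact: linearD.
rewrite mulmxDr mxtraceD mulrDr addrA cexpD normcM.
have -> : ztoC R x *m (toC r)^T = toC (zreal R x *m r^T) by rewrite ztoCE -toCT toCM.
by rewrite toC_tr -/(e2pi _) normc_e2pi_real mulr1.
Qed.

Definition consz n (p : int * 'rV[int]_n) : 'rV[int]_(1 + n) := row_mx p.1%:M p.2.

Lemma consz_bij n : bijective (@consz n).
Proof.
exists (fun x => (lsubmx x 0 0, rsubmx x)) => [[k y]|x]; rewrite /consz /=.
  by rewrite row_mxKl row_mxKr mxE.
by rewrite -mx11_scalar hsubmxK.
Qed.

Lemma swap_bij (I J : Type) : bijective (fun p : I * J => (p.2, p.1)).
Proof. by exists (fun p => (p.2, p.1)) => -[]. Qed.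

Section Step.
Variables (n : nat) (A B : 'M[R]_(1 + n)) (be : C) (z : 'rV[C]_(1 + n)).
Hypotheses (sA : A^T = A) (pA : posdef A) (AB : A *m B = 1%:M) (sb : in_sector be).

Let a := pivot A.
Let b := dlsubmx A.
Let al : C := be / (Num.sqrt a)%:C.
Let z1 : C := \tr (lsubmx z).
Let s (y : 'rV[int]_n) : C := \tr (ztoC R y *m toC b).
Let z' (k : int) : 'rV[C]_n := rsubmx z - (a%:C)^-1 *: ((k%:~R + z1) *: (toC b)^T).
Let w (y : 'rV[int]_n) : C := z1 + 'i * s y / be ^+ 2.
Let rest (y : 'rV[int]_n) : C :=
  cexp (- (piC / be ^+ 2 * (s y ^+ 2 / a%:C + \tr (ztoC R y *m toC (schur A) *m (ztoC R y)^T)))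
    + pi_i R *+ 2 * \tr (ztoC R y *m (rsubmx z)^T)).

Lemma step_a0 : 0 < a. Proof. exact: posdef_pivot. Qed.

Lemma step_aC : a%:C != 0 :> C.
Proof. by rewrite -normc_gt0 normc_real normr_gt0 gt_eqF // step_a0. Qed.

Lemma step_be0 : be != 0. Proof. exact: in_sector_neq0. Qed.

Lemma step_al2 : al ^+ 2 = be ^+ 2 / a%:C.
Proof.
rewrite /al expr_div_n; congr (_ / _).
by rewrite -rmorphXn sqr_sqrtr // ltW // step_a0.
Qed.

Lemma step_al : in_sector al.
Proof.
rewrite /al -fmorphV mulrC; have : 0 < (Num.sqrt a)^-1 by rewrite invr_gt0 sqrtr_gt0 step_a0.
move: sb; rewrite /in_sector ReZ ImZ => h c0.
by rewrite normrM (gtr0_norm c0) ltr_pM2l.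
Qed.

Lemma step_pivotC : pivot (toC A) = a%:C. Proof. exact: toC_pivot. Qed.

Lemma step_bC : dlsubmx (toC A) = toC b.
Proof. by apply/matrixP => i j; rewrite !mxE. Qed.

Lemma ztoC_consz (k : int) (y : 'rV[int]_n) : ztoC R (consz (k, y)) = row_mx (k%:~R)%:M (ztoC R y).
Proof. by rewrite /ztoC /consz map_row_mx map_scalar_mx. Qed.

(** For fixed [y] the first coordinate runs over a dual series of the rank-one formula, with slope
    [al = be / sqrt a] and a shift [w y] that carries the mixed term of the form. *)
Lemma quad_term_consz (k : int) (y : 'rV[int]_n) :
  quad_term A be z (consz (k, y)) = fourier_mode al (w y) k * rest y.
Proof.
have a0 := step_aC; have b0 := step_be0.
rewrite /quad_term /fourier_mode /rest /gauss /e2pi -!cexpD; congr cexp.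
have zE : z^T = col_mx (lsubmx z)^T (rsubmx z)^T by rewrite -tr_row_mx hsubmxK.
rewrite ztoC_consz schur_form -?toCT ?sA ?step_pivotC ?step_aC //.
rewrite toC_schur step_bC mxtraceD mxtraceZ zE mul_row_col mxtraceD.
rewrite {1 2}(mx11_tr (ztoC R y *m toC b)) -/(s y) scale_scalar_mx -scalar_mx_add.
rewrite tr_scalar_mx -scalar_mxM mxtrace_scalar mulr1n.
rewrite (mx11_tr (lsubmx z)) -/z1 tr_scalar_mx -scalar_mxM mxtrace_scalar mulr1n.
rewrite exprMn exprVn step_al2 /w pi_iE.
move: (\tr (ztoC R y *m toC (schur A) *m (ztoC R y)^T)) (\tr (ztoC R y *m (rsubmx z)^T)) => q t.
move: (s y) (k%:~R : C) => sy kk.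
apply/eqP; rewrite -subr_eq0; apply/eqP.
transitivity (- (2 * piC / be ^+ 2 * kk * sy) * ('i * 'i + 1)); first by field; rewrite ?a0 ?b0.
by rewrite -expr2 sqr_i addNr mulr0.
Qed.

(** After Poisson summation in the first coordinate the roles change: for fixed [k], what depends on
    [y] is a Gaussian for the Schur complement, shifted by [z' k]. *)
Lemma mixed_term (k : int) (y : 'rV[int]_n) :
  al * gauss (al * k%:~R + al * w y) * rest y =
  al * gauss (al * k%:~R + al * z1) * quad_term (schur A) be (z' k) y.
Proof.
have a0 := step_aC; have b0 := step_be0.
rewrite /quad_term /rest /gauss -[LHS]mulrA -[RHS]mulrA -!cexpD; congr (_ * cexp _).
have -> : \tr (ztoC R y *m (z' k)^T) = \tr (ztoC R y *m (rsubmx z)^T)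
    - (a%:C)^-1 * ((k%:~R + z1) * s y).
  have -> : (z' k)^T = (rsubmx z)^T - (a%:C)^-1 *: ((k%:~R + z1) *: toC b).
    by rewrite /z' [LHS]raddfB /= !trmx_scale trmxK.
  by rewrite mulmxBr -!scalemxAr [LHS]raddfB /= !mxtraceZ.
have e (u : C) : (al * k%:~R + al * u) ^+ 2 = be ^+ 2 / a%:C * (k%:~R + u) ^+ 2.
  by rewrite -step_al2; ring.
rewrite !e /w pi_iE.
move: (\tr (ztoC R y *m toC (schur A) *m (ztoC R y)^T)) (\tr (ztoC R y *m (rsubmx z)^T)) => q t.
move: (s y) (k%:~R : C) => sy kk.
apply/eqP; rewrite -subr_eq0; apply/eqP.
transitivity (- (piC / be ^+ 2 * sy ^+ 2 / a%:C) * ('i * 'i + 1)); first by field; rewrite ?a0 ?b0.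
by rewrite -expr2 sqr_i addNr mulr0.
Qed.

Lemma schur_dual : schur A *m drsubmx B = 1%:M.
Proof.
have a0 : a != 0 by rewrite gt_eqF // step_a0.
have := AB; rewrite {1}(sym_block sA) -[B in LHS]submxK mulmx_block scalar_mx_block.
move=> /eq_block_mx[_ e1 _ e2]; rewrite /schur mulmxBl -scalemxAl -mulmxA.
move: e1; rewrite mul_scalar_mx => /eqP; rewrite addrC addr_eq0 => /eqP ->.
by rewrite mulmxN -scalemxAr scalerN scalerA mulVf // scale1r opprK addrC.
Qed.

Lemma dual_term_consz (k : int) (y : 'rV[int]_n) :
  dual_term B be z (consz (k, y)) =
  gauss (al * k%:~R + al * z1) * dual_term (drsubmx B) be (z' k) y.
Proof.
have a0 := step_aC.
rewrite /dual_term /gauss -cexpD; congr cexp.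
have E : ztoC R (consz (k, y)) + z = row_mx (k%:~R + z1)%:M (ztoC R y + rsubmx z).
  by rewrite ztoC_consz -{1}[z]hsubmxK add_row_mx (mx11_tr (lsubmx z)) -scalar_mx_add.
have SC : schur (toC A) *m toC (drsubmx B) = 1%:M.
  by rewrite toC_schur -toCM schur_dual; exact: map_mx1.
have ABC : toC A *m toC B = 1%:M by rewrite -toCM AB; exact: map_mx1.
rewrite E (pivot_schur_dual _ _ _ _ ABC SC) -?toCT ?sA ?step_pivotC ?step_aC //.
rewrite step_bC !mul_scalar_mx tr_scalar_mx scale_scalar_mx.
have -> : ztoC R y + rsubmx z - a%:C^-1 *: ((k%:~R + z1) *: (toC b)^T) = ztoC R y + z' k.
  by rewrite /z' addrA.
rewrite mxtraceD mxtraceZ mxtrace_scalar mulr1n -mulrDr exprMn step_al2.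
by move: (\tr _) => q; field.
Qed.

(** A mixed double series [G] lies between the two sides: it is transformed in the first coordinate
    only. Summed over [k] first it gives the left side by [poisson_gauss]; summed over [y] first it
    gives the right side by the induction hypothesis. *)
Lemma poisson_step (c : C) :
  (forall z0, exists S, has_sum (quad_term (schur A) be z0) (c * be ^+ n * S) /\
     has_sum (dual_term (drsubmx B) be z0) S) ->
  posdef B -> B^T = B ->
  exists S, has_sum (quad_term A be z) (c / (Num.sqrt a)%:C * be ^+ n.+1 * S) /\
     has_sum (dual_term B be z) S.
Proof.
move=> IH pB sB.
have /choice[D hD] := fun k => IH (z' k).
pose g (k : int) : C := gauss (al * k%:~R + al * z1).
have hL := has_sum_usum (quad_term_summable z sA pA sb); set SL := usum _ in hL.
have hL' := has_sum_reindex (swap_bij _ _) (has_sum_reindex (@consz_bij n) hL).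
have hR := has_sum_usum (dual_term_summable z sB pB sb); set SR := usum _ in hR.
have hR' := has_sum_reindex (@consz_bij n) hR.
pose T y := rest y * usum (fourier_mode al (w y)).
have hT : has_sum T SL.
  apply: has_sum_fubini hL' _ => y /=.
  apply: eq_has_sum (has_sumZ (rest y) (has_sum_usum (fourier_mode_summable (w y) step_al))) => k.
  by rewrite /= quad_term_consz mulrC.
pose G (p : int * 'rV[int]_n) : C := al * g p.1 * quad_term (schur A) be (z' p.1) p.2.
have zE k : z' k = (rsubmx z - (a%:C)^-1 *: (z1 *: (toC b)^T)) + toC (- (a^-1 *: (k%:~R *: b^T))).
  apply/matrixP => i j; rewrite !mxE rmorphN !rmorphM /= fmorphV intC; ring.
have sG : abs_summable G.
  have [K K0 hK] := gauss_lattice_bound (al * z1) step_al.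
  have s1 : rsummable (fun k : int => normc (al * g k)).
    apply: (rsummable_le (K := normc al * K) _ _ (rsummable_lattice_inv R)).
      by rewrite mulr_ge0 ?normc_ge0.
    move=> k; rewrite normcM -mulrA ler_wpM2l ?normc_ge0 //.
    by have := hK k%:~R; rewrite intC.
  have s2 := quad_term_summable (rsubmx z - (a%:C)^-1 *: (z1 *: (toC b)^T))
     (tr_schur sA) (posdef_schur sA pA) sb.
  have := rsummable_prod (fun=> normc_ge0 _) (fun=> normc_ge0 _) s1 s2.
  congr rsummable; apply/funext => -[k y]; rewrite /G /= (normcM (al * g k)) zE.
  by rewrite quad_term_real_shift.
have hG := has_sum_usum sG; set SG := usum _ in hG.
have hG' := has_sum_reindex (swap_bij _ _) hG.
have hT' : has_sum T SG.
  apply: has_sum_fubini hG' _ => y /=.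
  apply: eq_has_sum (has_sumZ (rest y) (poisson_gauss (w y) step_al)) => k.
  by rewrite mulrC mixed_term.
have {}hT' : SL = SG := has_sum_unique hT hT'.
have h1 : has_sum (fun k => al * g k * (c * be ^+ n * D k)) SG.
  apply: has_sum_fubini hG _ => k.
  by apply: eq_has_sum (has_sumZ (al * g k) (hD k).1) => y.
have h2 : has_sum (fun k => g k * D k) SR.
  apply: has_sum_fubini hR' _ => k.
  apply: eq_has_sum (has_sumZ (g k) (hD k).2) => y; by rewrite /= dual_term_consz.
have E : SG = (al * (c * be ^+ n)) * SR.
  apply: has_sum_unique h1 _; apply: eq_has_sum (has_sumZ _ h2) => k.
  rewrite /=; ring.
exists SR; split => //.
have -> : c / (Num.sqrt a)%:C * be ^+ n.+1 * SR = SL; last by [].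
by rewrite hT' E /al exprS; ring.
Qed.

End Step.

Lemma sym_inverse (F : comUnitRingType) n (A B : 'M[F]_n) : A^T = A -> A *m B = 1%:M -> B^T = B.
Proof.
move=> sA AB; have BA : B^T *m A = 1%:M by rewrite -{1}sA -trmx_mul AB trmx1.
by rewrite -[LHS]mulmx1 -AB mulmxA BA mul1mx.
Qed.

Lemma posdef_inverse n (A B : 'M[R]_n) : A^T = A -> posdef A -> A *m B = 1%:M -> posdef B.
Proof.
move=> sA pA AB x x0; have sB := sym_inverse sA AB.
have BA := mulmx1C AB.
have := pA (x *m B); rewrite trmx_mul sB !mulmxA -(mulmxA x B A) BA mulmx1; apply.
by apply: contra_neq x0 => xB; rewrite -[x]mulmx1 -BA mulmxA xB mul0mx.
Qed.

(** The constant is built as the inverse square root of the product of the successive pivots. It is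
    chosen before [be] and [z], which makes the later multiplier independent of the point. *)
Theorem poisson_lattice n (A : 'M[R]_n) : A^T = A -> posdef A ->
  exists2 c : C, c != 0 & forall (B : 'M[R]_n) (be : C) (z : 'rV[C]_n),
    A *m B = 1%:M -> in_sector be ->
    exists S, has_sum (quad_term A be z) (c * be ^+ n * S) /\ has_sum (dual_term B be z) S.
Proof.
elim: n A => [|n IH] A sA pA.
  exists 1; first exact: oner_neq0.
  move=> B be z _ _; exists 1; rewrite mulr1 mulr1.
  have single (f : 'rV[int]_0 -> C) : (forall x, f x = 1) -> has_sum f 1.
    move=> f1 e e0; exists [fset (0 : 'rV[int]_0)]%fset => D hD.
    suff -> : D = [fset (0 : 'rV[int]_0)]%fset by rewrite big_seq_fset1 f1 subrr normc0.
    apply/eqP; rewrite eqEfsubset hD andbT; apply/fsubsetP => x _.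
    by rewrite inE [x]thinmx0.
  split; apply: single => x.
    by rewrite /quad_term [ztoC R x]thinmx0 !mul0mx !mxtrace0 !mulr0 oppr0 addr0 cexp0.
  by rewrite /dual_term [ztoC R x + z]thinmx0 !mul0mx !mxtrace0 !mulr0 oppr0 cexp0.
rewrite -[n.+1]/(1 + n)%N in A sA pA *.
have [c c0 hc] := IH _ (tr_schur sA) (posdef_schur sA pA).
have p0 : (Num.sqrt (pivot A))%:C != 0 :> C.
  by rewrite -normc_gt0 normc_real normr_gt0 gt_eqF // sqrtr_gt0 posdef_pivot.
exists (c / (Num.sqrt (pivot A))%:C); first by rewrite mulf_neq0 ?invr_eq0.
move=> B be z AB sb; apply: poisson_step => //.
- by move=> z0; apply: hc => //; exact: schur_dual.
- exact: posdef_inverse AB.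
- exact: sym_inverse AB.
Qed.

End LatticePoisson.

(** * Block symplectic matrices *)

Section SymplecticBlocks.
Variables (S : comNzRingType) (n : nat).

Lemma symplectic_block (A B C D : 'M[S]_n) :
  A^T *m C = C^T *m A -> B^T *m D = D^T *m B -> A^T *m D - C^T *m B = 1%:M ->
  symplectic (block_mx A B C D).
Proof.
move=> h1 h2 h3; apply/eqP; rewrite /symp_form tr_block_mx !mulmx_block.
rewrite !(mulmx0, mulmx1, mulmxN, add0r, addr0) !mulNmx h1 h2 ![- _ + _]addrC !subrr h3.
have h4 : D^T *m A - B^T *m C = 1%:M.
  by have := congr1 trmx h3; rewrite trmx1 raddfB /= !trmx_mul !trmxK.
by rewrite -h4 opprB.
Qed.

Lemma symplectic_unipotent (T : 'M[S]_n) : T^T = T -> symplectic (block_mx 1%:M T 0 1%:M).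
Proof.
move=> sT; apply: symplectic_block; rewrite ?trmx1 ?trmx0 ?(mulmx0, mul0mx, mulmx1, mul1mx) //.
by rewrite subr0.
Qed.

Lemma symplectic_levi (U V : 'M[S]_n) : U^T *m V = 1%:M -> symplectic (block_mx U 0 0 V).
Proof.
by move=> h; apply: symplectic_block; rewrite ?trmx0 ?(mulmx0, mul0mx) // subr0.
Qed.

(** In the [i]-th coordinate plane it acts by [(u, w) -> (- w, u)]; on the other planes it is the
    identity. *)
Definition coord_inversion (i : 'I_n) : 'M[S]_(n + n) :=
  let E := delta_mx i i in block_mx (1%:M - E) (- E) E (1%:M - E).

Lemma symplectic_coord_inversion i : symplectic (coord_inversion i).
Proof.
rewrite /coord_inversion; set E : 'M[S]_n := delta_mx i i.
have sE : E^T = E by rewrite /E trmx_delta.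
have EE : E *m E = E by rewrite /E mul_delta_mx.
have tr1E : (1%:M - E)^T = 1%:M - E by rewrite raddfB /= trmx1 sE.
have tE : (- E)^T = - E by rewrite raddfN /= sE.
apply: symplectic_block; rewrite ?tr1E ?sE ?tE.
- by rewrite mulmxBl mulmxBr mul1mx mulmx1.
- by rewrite mulNmx mulmxN mulmxBl mulmxBr mul1mx mulmx1.
- rewrite !(mulmxBl, mulmxBr, mul1mx, mulmx1, mulmxN) EE subrr subr0 opprK.
  by rewrite subrK.
Qed.

Lemma symplectic_pairing p q (g : sp S n) (x : 'M[S]_(n + n, p)) (y : 'M[S]_(n + n, q)) :
  (g *m x)^T *m symp_form S n *m (g *m y) = x^T *m symp_form S n *m y.
Proof.
by rewrite trmx_mul -!mulmxA (mulmxA (symp_form S n)) (mulmxA g^T) (mulmxA g^T) (eqP (spP g)).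
Qed.

Lemma symp_form_col p q (u w : 'M[S]_(n, p)) (u' w' : 'M[S]_(n, q)) :
  (col_mx u w)^T *m symp_form S n *m col_mx u' w' = u^T *m w' - w^T *m u'.
Proof.
rewrite tr_col_mx /symp_form mul_row_block !(mulmx0, mulmx1, mulmxN) add0r addr0.
by rewrite mul_row_col mulNmx addrC.
Qed.

Lemma symp_form_sub (v : 'cV[S]_(n + n)) (u' w' : 'cV[S]_n) :
  v^T *m symp_form S n *m col_mx u' w' = (usubmx v)^T *m w' - (dsubmx v)^T *m u'.
Proof. by rewrite -{1}[v]vsubmxK symp_form_col. Qed.

End SymplecticBlocks.

(** * Generators of the integral symplectic group *)

Section SymplecticGeneration.
Variables (n : nat) (P : sp int n -> Prop).
Hypothesis P_one : P 1%g.
Hypothesis P_mul : forall g h : sp int n, P g -> P h -> P (g * h)%g.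
Hypothesis P_inv : forall g : sp int n, P g -> P g^-1%g.
Hypothesis P_unipotent : forall (g : sp int n) (T : 'M[int]_n), T^T = T ->
  sp_mx g = block_mx 1%:M T 0 1%:M -> P g.
Hypothesis P_levi : forall (g : sp int n) (U V : 'M[int]_n), U^T *m V = 1%:M ->
  sp_mx g = block_mx U 0 0 V -> P g.
Hypothesis P_inversion : forall (g : sp int n) (i : 'I_n),
  sp_mx g = coord_inversion int i -> P g.

Local Notation V := 'cV[int]_(n + n).
Let del (i : 'I_n) : 'cV[int]_n := delta_mx i 0.

Definition fixes (k : nat) (g : sp int n) : Prop := forall i : 'I_n, (i < k)%N ->
  g *m col_mx (del i) 0 = col_mx (del i) 0 /\ g *m col_mx 0 (del i) = col_mx 0 (del i).

Definition vanishes (k : nat) (v : V) : Prop := forall i : 'I_n, (i < k)%N ->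
  usubmx v i 0 = 0 /\ dsubmx v i 0 = 0.

Lemma sp_mulE (g h : sp int n) : sp_mx (g * h)%g = sp_mx g *m sp_mx h.
Proof. by []. Qed.

Lemma fixes_mul k g h : fixes k g -> fixes k h -> fixes k (g * h)%g.
Proof.
move=> hg hh i ik; have [g1 g2] := hg i ik; have [h1 h2] := hh i ik.
by rewrite sp_mulE -!mulmxA h1 h2.
Qed.

Lemma tr_del_mul (u : 'cV[int]_n) i : u^T *m del i = (u i 0)%:M.
Proof. by rewrite /del -colE; apply/matrixP => a b; rewrite !mxE !ord1. Qed.

Lemma del_tr_mul (u : 'cV[int]_n) i : (del i)^T *m u = (u i 0)%:M.
Proof. by rewrite -[LHS]trmxK trmx_mul trmxK tr_del_mul tr_scalar_mx. Qed.

(** A vector vanishes in this sense exactly when it is symplectically orthogonal to the first [k]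
    coordinate pairs, and [g] fixes these pairs and preserves the form. *)
Lemma fixes_vanishes k (g : sp int n) v : fixes k g -> vanishes k v -> vanishes k (g *m v).
Proof.
move=> hg hv i ik; have [g1 g2] := hg i ik; have [v1 v2] := hv i ik.
have := symplectic_pairing g v (col_mx (del i) 0).
have := symplectic_pairing g v (col_mx 0 (del i)).
rewrite g1 g2 !symp_form_sub !mulmx0 !subr0 !sub0r !tr_del_mul v1 v2.
move=> /matrixP/(_ 0 0); rewrite !mxE eqxx !mulr1n => ->.
by move=> /matrixP/(_ 0 0); rewrite !mxE eqxx !mulr1n oppr0 => /eqP; rewrite oppr_eq0 => /eqP ->.
Qed.

(** Requiring [fixes k] keeps what was achieved for the first [k] pairs while later ones are
    treated. *)
Definition reach (k : nat) (v v' : V) : Prop :=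
  exists g : sp int n, [/\ P g, fixes k g & g *m v = v'].

Lemma reach_refl k v : reach k v v.
Proof.
exists 1%g; split=> //; last exact: mul1mx.
by move=> i _; rewrite !mul1mx.
Qed.

Lemma reach_trans k v2 v1 v3 : reach k v1 v2 -> reach k v2 v3 -> reach k v1 v3.
Proof.
move=> [g [pg fg <-]] [h [ph fh <-]]; exists (h * g)%g; split; [exact: P_mul|exact: fixes_mul|].
by rewrite sp_mulE mulmxA.
Qed.

Lemma reach_vanishes k v v' : reach k v v' -> vanishes k v -> vanishes k v'.
Proof. by move=> [g [_ fg <-]]; apply: fixes_vanishes. Qed.

Lemma reach_unipotent k (T : 'M[int]_n) (u w : 'cV[int]_n) : T^T = T ->
  (forall i : 'I_n, (i < k)%N -> T *m del i = 0) ->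
  reach k (col_mx u w) (col_mx (u + T *m w) w).
Proof.
move=> sT Tk; exists (Sp (symplectic_unipotent sT)); split.
- by apply: (@P_unipotent _ T).
- move=> i ik; rewrite /= !mul_block_col !(mul1mx, mul0mx, mulmx0) !addr0 ?add0r Tk //.
- by rewrite /= mul_block_col !(mul1mx, mul0mx) add0r.
Qed.

Lemma reach_levi k (A B : 'M[int]_n) (u w : 'cV[int]_n) : A^T *m B = 1%:M ->
  (forall i : 'I_n, (i < k)%N -> A *m del i = del i /\ B *m del i = del i) ->
  reach k (col_mx u w) (col_mx (A *m u) (B *m w)).
Proof.
move=> AB hk; exists (Sp (symplectic_levi AB)); split.
- by apply: (@P_levi _ A B).
- move=> i /hk[Ai Bi].
  by rewrite /= !mul_block_col !(mul0mx, mulmx0) !addr0 ?add0r Ai Bi.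
- by rewrite /= mul_block_col !mul0mx addr0 add0r.
Qed.

Lemma delta_mul (i j l : 'I_n) : delta_mx i j *m del l = if j == l then del i else 0.
Proof.
rewrite /del; case: eqVneq => [->|jl]; first by rewrite mul_delta_mx.
by rewrite mul_delta_mx_0.
Qed.

Lemma delta_mul_col (i j : 'I_n) (u : 'cV[int]_n) : delta_mx i j *m u = u j 0 *: del i.
Proof.
apply/matrixP => a b; rewrite !mxE (bigD1 j) //= mxE eqxx andbT big1 ?addr0.
  by rewrite (ord1 b) eqxx andbT mulrC.
by move=> l lj; rewrite mxE (negPf lj) andbF mul0r.
Qed.

Lemma reach_inversion k (i : 'I_n) (u w : 'cV[int]_n) : (k <= i)%N ->
  reach k (col_mx u w) (col_mx (u - (u i 0 + w i 0) *: del i) (w + (u i 0 - w i 0) *: del i)).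
Proof.
move=> ki; exists (Sp (symplectic_coord_inversion int i)); split.
- by apply: (@P_inversion _ i).
- move=> l lk; have il : (i == l) = false.
    by apply/eqP => E; move: lk; rewrite -E ltnNge ki.
  rewrite /= /coord_inversion !mul_block_col !mulmx0 !mulmxBl !mulNmx !mul1mx !delta_mul il.
  by rewrite !subr0 !addr0 !add0r ?oppr0.
- rewrite /= /coord_inversion mul_block_col !mulmxBl !mulNmx !mul1mx !delta_mul_col.
  congr col_mx; first by rewrite scalerDl opprD addrA.
  by rewrite scalerBl addrCA.
Qed.

Definition size1 (u : 'cV[int]_n) : nat := (\sum_i absz (u i 0%R))%N.

Lemma size1_lt (u u' : 'cV[int]_n) (i : 'I_n) : (absz (u' i 0%R) < absz (u i 0%R))%N ->
  (forall j, j != i -> u' j 0 = u j 0) -> (size1 u' < size1 u)%N.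
Proof.
move=> lt eq; rewrite /size1 (bigD1 i) //= [X in (_ < X)%N](bigD1 i) //= -addSn leq_add //.
by apply: leq_sum => j /eq ->.
Qed.

(* Euclid's algorithm in each coordinate plane. *)
Lemma reach_dsub0 k (v : V) : vanishes k v -> exists u, reach k v (col_mx u 0).
Proof.
move: {2}(size1 (dsubmx v)).+1 (ltnSn (size1 (dsubmx v))) => N.
elim: N v => // N IH v; rewrite ltnS => vN vk.
have [w0|[i wi]] : dsubmx v = 0 \/ exists i, dsubmx v i 0 != 0.
- have [/existsP[i wi]|/existsPn h] := boolP [exists i, dsubmx v i 0 != 0]; first by right; exists i.
  by left; apply/matrixP => i j; rewrite (ord1 j) [RHS]mxE; apply/eqP; have := h i; rewrite negbK.
- by exists (usubmx v); rewrite -w0 vsubmxK; exact: reach_refl.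
have ki : (k <= i)%N by rewrite leqNgt; apply/negP => /vk[_ w0]; rewrite w0 eqxx in wi.
move: vN vk wi; rewrite -[v]vsubmxK col_mxKd.
move: (usubmx v) (dsubmx v) => u w wN vk wi.
pose q := divz (u i 0) (w i 0).
have s1 : reach k (col_mx u w) (col_mx (u + (- q) *: delta_mx i i *m w) w).
  apply: reach_unipotent; first by rewrite trmx_scale trmx_delta.
  move=> l lk; rewrite -scalemxAl delta_mul; case: eqP => [E|_]; last by rewrite scaler0.
  by move: lk; rewrite -E ltnNge ki.
have {}s1 := reach_trans s1 (reach_inversion _ _ ki).
set v' := col_mx (_ - _) _ in s1.
have [||u' hu'] := IH v'.
- apply: leq_trans wN; rewrite /v' col_mxKd; apply: (@size1_lt _ _ i).
    rewrite -scalemxAl delta_mul_col !mxE eqxx /= !mulr1.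
    have -> : w i 0 + (u i 0 + - q * w i 0 - w i 0) = modz (u i 0) (w i 0).
      by rewrite /modz /q; ring.
    have := ltz_pmod (u i 0) (_ : 0 < `|w i 0|); rewrite normr_gt0 => /(_ wi).
    rewrite modz_abs => lt; have ge := modz_ge0 (u i 0) wi.
    by rewrite -ltz_nat !abszE ger0_norm.
  by move=> j ji; rewrite !mxE (negPf ji) /= mulr0 addr0.
- exact: reach_vanishes s1 vk.
- by exists u'; exact: reach_trans s1 hu'.
Qed.

Lemma levi_elementary (i j : 'I_n) (c : int) : i != j ->
  (1%:M + c *: delta_mx i j)^T *m (1%:M - c *: delta_mx j i) = 1%:M :> 'M[int]_n.
Proof.
move=> ij; rewrite [X in X *m _]raddfD /= trmx1 trmx_scale trmx_delta.
rewrite mulmxDl mul1mx mulmxBr mulmx1 -scalemxAl -scalemxAr mul_delta_mx_0 //.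
by rewrite !scaler0 subr0 subrK.
Qed.

Lemma reach_elementary k (i j : 'I_n) (c : int) (u : 'cV[int]_n) : i != j ->
  (k <= i)%N -> (k <= j)%N ->
  reach k (col_mx u 0) (col_mx (u + (c * u j 0) *: del i) 0).
Proof.
move=> ij ki kj.
have := @reach_levi k _ _ u 0 (levi_elementary c ij).
rewrite mulmx0 mulmxDl mul1mx -scalemxAl delta_mul_col scalerA; apply.
move=> l lk; have neq (x : 'I_n) : (k <= x)%N -> (x == l) = false.
  by move=> kx; apply/eqP => E; move: lk; rewrite -E ltnNge kx.
rewrite mulmxDl mulmxBl mul1mx -!scalemxAl !delta_mul !neq //.
by rewrite !scaler0 addr0 subr0.
Qed.

(** Euclid's algorithm between coordinates: elementary Levi moves reduce the larger of two nonzero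
    entries modulo the other, and [size1] decreases. *)
Lemma reach_usub_single k (u : 'cV[int]_n) : vanishes k (col_mx u 0) -> u != 0 ->
  exists (i : 'I_n) (c : int), (k <= i)%N /\ reach k (col_mx u 0) (col_mx (c *: del i) 0).
Proof.
move: {2}(size1 u).+1 (ltnSn (size1 u)) => N.
elim: N u => // N IH u; rewrite ltnS => uN vk u0.
have hk (i : 'I_n) : u i 0 != 0 -> (k <= i)%N.
  move=> ui; rewrite leqNgt; apply/negP => /vk[]; rewrite col_mxKu => E.
  by rewrite E eqxx in ui.
have [i ui] : exists i, u i 0 != 0.
  apply/existsP; apply: contraNT u0 => /existsPn h; apply/eqP/matrixP => i j.
  by rewrite (ord1 j) [RHS]mxE; apply/eqP; have := h i; rewrite negbK.
have [/existsP[j /andP[ji uj]]|/existsPn h] := boolP [exists j, (j != i) && (u j 0 != 0)]; last first.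
  exists i, (u i 0); split; first exact: hk.
  suff {1}-> : u = u i 0 *: del i by exact: reach_refl.
  apply/matrixP => l m; rewrite (ord1 m) !mxE eqxx andbT.
  have [->|li] := eqVneq l i; first by rewrite mulr1.
  by rewrite mulr0; apply/eqP; have := h l; rewrite li /= negbK.
have step (a b : 'I_n) : a != b -> u a 0 != 0 -> u b 0 != 0 ->
    (absz (u b 0%R) <= absz (u a 0%R))%N ->
    exists (i : 'I_n) (c : int), (k <= i)%N /\ reach k (col_mx u 0) (col_mx (c *: del i) 0).
  move=> ab ua ub le; set q := divz (u a 0) (u b 0).
  have s1 := reach_elementary (- q) u ab (hk _ ua) (hk _ ub).
  set u' := _ + _ in s1.
  have E : u' a 0 = modz (u a 0) (u b 0).
    by rewrite /u' !mxE !eqxx /= mulr1 /modz /q; ring.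
  have Eb : u' b 0 = u b 0 by rewrite /u' !mxE eq_sym (negPf ab) /= mulr0 addr0.
  have [|||l [c [kl hc]]] := IH u'.
  - apply: leq_trans uN; apply: (@size1_lt _ _ a).
      apply: leq_trans le; rewrite E.
      have := ltz_pmod (u a 0) (_ : 0 < `|u b 0|); rewrite normr_gt0 => /(_ ub).
      rewrite modz_abs => lt; have ge := modz_ge0 (u a 0) ub.
      by rewrite -ltz_nat !abszE ger0_norm.
    by move=> l la; rewrite /u' !mxE (negPf la) /= mulr0 addr0.
  - exact: reach_vanishes s1 vk.
  - by apply: contraNneq ub => u'0; rewrite -Eb u'0 mxE.
  - by exists l, c; split=> //; exact: reach_trans s1 hc.
have [le|lt] := leqP (absz (u j 0)) (absz (u i 0)); first by apply: (step i j) => //; rewrite eq_sym.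
by apply: (step j i) => //; exact: ltnW.
Qed.

Lemma sp_mulVE (g : sp int n) (v : V) : sp_mx g^-1%g *m (g *m v) = v.
Proof. by rewrite mulmxA sp_mulVmx mul1mx. Qed.

Lemma sp_injective (g : sp int n) (v : V) : g *m v = 0 -> v = 0.
Proof. by move=> gv; rewrite -(sp_mulVE g v) gv mulmx0. Qed.

(** An invertible integral matrix carries a primitive vector to a primitive one, so the scalar is a
    unit of the integers. *)
Lemma sp_scale_unit (g : sp int n) (i j : 'I_n) (c : int) :
  g *m col_mx (del i) 0 = col_mx (c *: del j) 0 -> c * c = 1.
Proof.
move=> E; have E' : c *: (sp_mx g^-1%g *m col_mx (del j) 0) = col_mx (del i) 0.
  by rewrite scalemxAr scale_col_mx scaler0 -E sp_mulVE.
have := congr1 (fun x : V => usubmx x i 0) E'; rewrite col_mxKu [RHS]mxE !eqxx.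
rewrite [LHS]mxE [LHS]mxE /= => h.
move: h; set y := (_ *m _) _ _ => h.
have : (c %| c * y)%Z by rewrite dvdz_mulr.
rewrite h dvdz1 => /eqP c1; have cn : `|c| = 1 by rewrite -abszE c1.
by rewrite -expr2 -(real_normK (num_real c)) cn expr1n.
Qed.

(** If [i = m], the sign -1 is removed by applying the inversion twice. Otherwise [c * c = 1] times
    the [m]-th basis vector is added, and the [i]-th entry is then cleared with it. *)
Lemma reach_basis_u k (i : 'I_n) (c : int) (m : 'I_n) : (k <= i)%N -> m = k :> nat -> c * c = 1 ->
  reach k (col_mx (c *: del i) 0) (col_mx (del m) 0).
Proof.
move=> ki mk cc.
have km : (k <= m)%N by rewrite mk.
have [->|im] := eqVneq i m.
  have [c1|c1] : c = 1 \/ c = -1.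
    have : (c - 1) * (c + 1) = 0 by rewrite -subr_sqr_1 expr2 cc subrr.
    by move/eqP; rewrite mulf_eq0 subr_eq0 addr_eq0 => /orP[/eqP|/eqP]; [left|right].
    by rewrite c1 scale1r; exact: reach_refl.
  have s1 := reach_inversion (c *: del m) 0 km.
  have s2 := reach_trans s1 (reach_inversion _ _ km).
  apply: reach_trans s2 _; rewrite c1; set v := col_mx _ _; set v' := col_mx _ _.
  suff -> : v = v' by exact: reach_refl.
  rewrite /v /v'; congr col_mx; apply/matrixP => a b; rewrite !mxE (ord1 b) !eqxx /=;
    case: (a == m) => /=; ring.
have mi : m != i by rewrite eq_sym.
have s1 := reach_elementary c (c *: del i) mi km ki.
have a1 : (c *: del i) i 0 = c by rewrite !mxE !eqxx mulr1.
rewrite a1 cc scale1r in s1.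
have s2 := reach_elementary (- c) (c *: del i + del m) im ki km.
have a2 : (c *: del i + del m) m 0 = 1 by rewrite !mxE !eqxx (negPf mi) mulr0 add0r.
rewrite a2 mulr1 scaleNr addrAC subrr add0r in s2.
exact: reach_trans s1 s2.
Qed.

Lemma reach_basis_w k (m : 'I_n) (u w : 'cV[int]_n) : m = k :> nat ->
  vanishes k (col_mx u w) -> w m 0 = 1 ->
  exists g : sp int n, [/\ P g, fixes k g, g *m col_mx (del m) 0 = col_mx (del m) 0 &
    g *m col_mx u w = col_mx 0 (del m)].
Proof.
move=> mk vk wm.
have uk (i : 'I_n) : (i < k)%N -> u i 0 = 0 by move=> /vk[]; rewrite col_mxKu.
have wk (i : 'I_n) : (i < k)%N -> w i 0 = 0 by move=> /vk[_]; rewrite col_mxKd.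
have dk (i : 'I_n) : (i < k)%N -> del m i 0 = 0.
  by move=> ik; rewrite mxE -val_eqE /= mk (ltn_eqF ik).
have dk' (i : 'I_n) : (i < k)%N -> del i m 0 = 0.
  by move=> ik; rewrite mxE -val_eqE /= mk (gtn_eqF ik).
have dm : del m m 0 = 1 by rewrite mxE !eqxx.
pose x := w - del m.
have xm : x m 0 = 0 by rewrite mxE wm [X in 1 + X]mxE dm subrr.
have xk (i : 'I_n) : (i < k)%N -> x i 0 = 0.
  by move=> ik; rewrite mxE wk // [X in 0 + X]mxE dk // subrr.
(* As [x m 0 = 0], the matrix [A] fixes the [m]-th basis vector, while [B] subtracts [x] from [w]
   and leaves that basis vector. *)
pose A : 'M[int]_n := 1%:M + del m *m x^T.
pose B : 'M[int]_n := 1%:M - x *m (del m)^T.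
have AB : A^T *m B = 1%:M.
  rewrite /A /B [X in X *m _]raddfD /= trmx1 trmx_mul trmxK mulmxDl mul1mx mulmxBr mulmx1.
  by rewrite -mulmxA (mulmxA (del m)^T) del_tr_mul xm mul_scalar_mx scale0r mulmx0 subr0 subrK.
have Adel (i : 'I_n) : A *m del i = del i + x i 0 *: del m.
  by rewrite mulmxDl mul1mx -mulmxA tr_del_mul mul_mx_scalar.
have Bw (y : 'cV[int]_n) : B *m y = y - y m 0 *: x.
  by rewrite mulmxBl mul1mx -mulmxA del_tr_mul mul_mx_scalar.
pose u' := A *m u.
(* A symmetric matrix with [m]-th column [- u'], supported on the [m]-th row and column: it clears
   the upper half and does not disturb the earlier pairs. *)
pose T : 'M[int]_n := - (u' *m (del m)^T + del m *m u'^T - u' m 0 *: (del m *m (del m)^T)).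
have sT : T^T = T.
  rewrite /T {T}; move: u' (del m) => y d.
  by apply/matrixP => a b; rewrite !mxE !big_ord1 !mxE; ring.
have Tdel (i : 'I_n) : T *m del i = - (del m i 0 *: u' + u' i 0 *: del m - (u' m 0 * del m i 0) *: del m).
  rewrite /T {T sT}; move: u' => y.
  rewrite mulNmx mulmxBl mulmxDl -!mulmxA -scalemxAl -mulmxA !tr_del_mul !mul_mx_scalar.
  by rewrite scalerA.
have u'k (i : 'I_n) : (i < k)%N -> u' i 0 = 0.
  move=> ik; rewrite /u' mulmxDl mul1mx !mxE uk // add0r big1 // => j _.
  by rewrite mxE big_ord1 dk // mul0r mul0r.
exists (Sp (symplectic_unipotent sT) * Sp (symplectic_levi AB))%g.
have act (y z : 'cV[int]_n) : (Sp (symplectic_unipotent sT) * Sp (symplectic_levi AB))%g *m col_mx y z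
   = col_mx (A *m y + T *m (B *m z)) (B *m z).
  by rewrite sp_mulE -mulmxA /= !mul_block_col !(mul0mx, mul1mx) !addr0 !add0r.
split.
- by apply: P_mul; [apply: (@P_unipotent _ T) | apply: (@P_levi _ A B)].
- move=> i ik; rewrite !act !mulmx0 addr0 Adel xk // scale0r addr0; split=> //.
  by rewrite Bw dk' // scale0r subr0 Tdel dk // u'k // !scale0r mulr0 scale0r subr0 addr0 oppr0 addr0.
- by rewrite act !mulmx0 addr0 Adel xm scale0r addr0.
- have Bwm : B *m w = del m by rewrite Bw wm scale1r /x opprB addrC subrK.
  rewrite act Bwm Tdel dm scale1r mulr1 addrK; congr col_mx; exact: subrr.
Qed.

Lemma del_lshift (i : 'I_n) : col_mx (del i) 0 = delta_mx (lshift n i) 0 :> V.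
Proof.
apply/matrixP => a b; rewrite !mxE; case: splitP => j aj; rewrite !mxE -!val_eqE /= aj //.
by rewrite gtn_eqF // (leq_trans (ltn_ord i)) // leq_addr.
Qed.

Lemma del_rshift (i : 'I_n) : col_mx 0 (del i) = delta_mx (rshift n i) 0 :> V.
Proof.
apply/matrixP => a b; rewrite !mxE; case: splitP => j aj; rewrite !mxE -!val_eqE /= aj ?eqn_add2l //.
by rewrite ltn_eqF // (leq_trans (ltn_ord j)) // leq_addr.
Qed.

Lemma fixes_all (g : sp int n) : fixes n g -> g = 1%g.
Proof.
move=> fg; apply: val_inj; apply/matrixP => a b /=.
have E : col b g = delta_mx b 0.
  rewrite colE; case: (splitP b) => j bj.
    have -> : b = lshift n j by exact: val_inj.
    by rewrite -del_lshift (fg j (ltn_ord j)).1.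
  have -> : b = rshift n j by exact: val_inj.
  by rewrite -del_rshift (fg j (ltn_ord j)).2.
have := congr1 (fun x : V => x a 0) E; rewrite mxE => ->.
by rewrite !mxE eqxx andbT.
Qed.

Lemma P_cancel (h g : sp int n) : P h -> P (h * g)%g -> P g.
Proof. by move=> /P_inv ph phg; rewrite -(mulKg h g); exact: P_mul. Qed.

(** Induction on the number [k] of coordinate pairs not yet fixed. Generators bring the image of the
    first vector of the next pair back to its place, and then, without moving it, the image of the
    second. *)
Theorem sp_generated (g : sp int n) : P g.
Proof.
suff H k : (k <= n)%N -> forall g, fixes (n - k) g -> P g.
  by apply: (H n) => // i; rewrite subnn.
elim: k => [_ {}g|k IH kn {}g fg]; first by rewrite subn0 => /fixes_all ->.
have mlt : (n - k.+1 < n)%N by lia.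
pose m := Ordinal mlt.
have dk (i : 'I_n) : (i < n - k.+1)%N -> del m i 0 = 0.
  by move=> ik; rewrite mxE -val_eqE /= (ltn_eqF ik).
have d1 : del m m 0 = 1 by rewrite mxE !eqxx.
have v1 : vanishes (n - k.+1) (col_mx (del m) 0).
  by move=> i ik; rewrite col_mxKu col_mxKd dk // mxE.
have v2 : vanishes (n - k.+1) (col_mx 0 (del m)).
  by move=> i ik; rewrite col_mxKu col_mxKd dk // mxE.
have vg := fixes_vanishes fg v1.
have [u r1] := reach_dsub0 vg.
have [h1 [_ _ E1]] := r1.
have u0 : u != 0.
  apply/eqP => u0; move: E1; rewrite u0 col_mx0 mulmxA -sp_mulE => /sp_injective.
  move/(congr1 (fun x : V => usubmx x m 0)); rewrite col_mxKu d1 !mxE => /eqP.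
  by rewrite oner_eq0.
have [i [c [ki r2]]] := reach_usub_single (reach_vanishes r1 vg) u0.
have r3 := reach_trans r1 r2.
have cc : c * c = 1.
  have [h3 [_ _]] := r3; rewrite mulmxA -sp_mulE; exact: sp_scale_unit.
have [h [ph fh Eh]] := reach_trans r3 (@reach_basis_u _ i c m ki erefl cc).
apply: (P_cancel ph).
have fhg := fixes_mul fh fg; set g1 := (h * g)%g in fhg *.
have E : g1 *m col_mx (del m) 0 = col_mx (del m) 0 by rewrite /g1 sp_mulE -mulmxA.
have vF := fixes_vanishes fhg v2.
(* The pairing of the two vectors is preserved and the first is already fixed, so this entry is
   1. *)
have wm : dsubmx (g1 *m col_mx 0 (del m)) m 0 = 1.
  have := symplectic_pairing g1 (col_mx (del m) 0) (col_mx 0 (del m)).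
  rewrite E -{1}[g1 *m _]vsubmxK !symp_form_col !trmx0 !mul0mx !subr0 !del_tr_mul.
  by move=> /matrixP/(_ 0 0); rewrite d1 !mxE eqxx !mulr1n => ->.
rewrite -[g1 *m _]vsubmxK in vF.
have [h2 [ph2 fh2 e1 e2]] := @reach_basis_w _ m _ _ erefl vF wm.
apply: (P_cancel ph2); apply: IH; first exact: ltnW.
move=> j; have -> : (n - k = (n - k.+1).+1)%N by lia.
rewrite ltnS leq_eqVlt => /orP[/eqP jm|]; last exact: fixes_mul.
have -> : j = m by exact: val_inj.
rewrite (sp_mulE h2 g1) -!(mulmxA (sp_mx h2)) E e1; split=> //.
by rewrite -[g1 *m _]vsubmxK e2.
Qed.

End SymplecticGeneration.

Lemma invmx_mul (F : comUnitRingType) k (A B : 'M[F]_k) :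
  A \in unitmx -> B \in unitmx -> invmx (A *m B) = invmx B *m invmx A.
Proof.
move=> uA uB; have uAB : A *m B \in unitmx by rewrite unitmx_mul uA.
apply: (can_inj (mulKmx uAB)); rewrite mulmxV // -mulmxA mulKVmx // mulmxV //.
Qed.

(** * The symplectic action on the Siegel upper half space *)

Section SiegelAction.
Variables (R : realType) (n : nat).
Local Open Scope complex_scope.
Local Notation C := R[i].
Implicit Types (g h : sp R n) (Om : 'M[C]_n).

Definition sp_num g Om : 'M[C]_n := toC (ulsubmx g) *m Om + toC (ursubmx g).

Definition sp_act g Om : 'M[C]_n := sp_num g Om *m invmx (sp_den g Om).

Lemma map_mx_idE p q (A : 'M[C]_(p, q)) : map_mx id A = A.
Proof. by apply/matrixP => i j; rewrite mxE. Qed.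

Definition cj p q (A : 'M[C]_(p, q)) : 'M[C]_(p, q) := map_mx conjc A.

Lemma cj_toC p q (A : 'M[R]_(p, q)) : cj (toC A) = toC A.
Proof. by apply/matrixP => i j; rewrite !mxE conjc_real. Qed.

Lemma cjM p q r (A : 'M[C]_(p, q)) (B : 'M[C]_(q, r)) : cj (A *m B) = cj A *m cj B.
Proof. exact: map_mxM. Qed.

Lemma cj_tr p q (A : 'M[C]_(p, q)) : (cj A)^T = cj A^T.
Proof. by apply/matrixP => i j; rewrite !mxE. Qed.

Lemma cj_sub Om : cj Om - Om = (- (2 * 'i)) *: toC (map_mx (@complex.Im R) Om).
Proof.
apply/matrixP => i j; rewrite !mxE; case: (Om i j) => a b /=.
by apply/eqP; rewrite eq_complex /=; apply/andP; split; apply/eqP; ring.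
Qed.

Lemma toC_sp_col g Om :
  toC g *m col_mx Om 1%:M = col_mx (sp_num g Om) (sp_den g Om).
Proof.
rewrite -{1}[sp_mx g]submxK /toC map_block_mx mul_block_col !mulmx1.
by [].
Qed.

(** Both instances say that [g] preserves the pairing of columns over [Om]: the identity yields the
    symmetry of the image point, and conjugation relates the imaginary parts. *)
Lemma sp_num_den_cj g Om (f : C -> C) : (f = id \/ f = conjc) ->
  (map_mx f (sp_num g Om))^T *m sp_den g Om - (map_mx f (sp_den g Om))^T *m sp_num g Om
  = (map_mx f Om)^T - Om.
Proof.
move=> hf; rewrite -symp_form_col -[X in (X)^T]map_col_mx -toC_sp_col.
have -> : map_mx f (toC g *m col_mx Om 1%:M) = toC g *m map_mx f (col_mx Om 1%:M).
  case: hf => ->; first by rewrite !map_mx_idE.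
  by rewrite -[LHS]/(cj _) cjM cj_toC.
have := symplectic_pairing (sp_map (real_complex R) g) (map_mx f (col_mx Om 1%:M)) (col_mx Om 1%:M).
rewrite /= => ->; rewrite map_col_mx symp_form_col.
have -> : map_mx f (1%:M : 'M[C]_n) = 1%:M.
  case: hf => ->; first by rewrite map_mx_idE.
  exact: map_mx1.
by rewrite trmx1 mulmx1 mul1mx.
Qed.

Lemma sp_num_den_sym g Om : Om^T = Om ->
  (sp_num g Om)^T *m sp_den g Om = (sp_den g Om)^T *m sp_num g Om.
Proof.
move=> sO; have := @sp_num_den_cj g Om id (or_introl erefl); rewrite !map_mx_idE sO subrr.
by move/eqP; rewrite subr_eq0 => /eqP.
Qed.

Lemma Re_hermitian (Y : 'M[R]_n) (v : 'rV[C]_n) :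
  complex.Re ((cj v *m toC Y *m v^T) 0 0) =
  (map_mx (@complex.Re R) v *m Y *m (map_mx (@complex.Re R) v)^T) 0 0 +
  (map_mx (@complex.Im R) v *m Y *m (map_mx (@complex.Im R) v)^T) 0 0.
Proof.
set a := map_mx _ v; set b := map_mx (@complex.Im R) v.
have vE : v = toC a + 'i *: toC b by apply/matrixP => i j; rewrite !mxE -complexE.
have cvE : cj v = toC a - 'i *: toC b.
  apply/matrixP => i j; rewrite !mxE; case: (v i j) => x y /=.
  by apply/eqP; rewrite eq_complex /=; apply/andP; split; apply/eqP; ring.
have -> : cj v *m toC Y *m v^T = toC (a *m Y *m a^T + b *m Y *m b^T)
     + 'i *: toC (a *m Y *m b^T - b *m Y *m a^T).
  have E (A B : 'M[C]_(1, n)) (Y' : 'M[C]_n) : (A - 'i *: B) *m Y' *m (A + 'i *: B)^T =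
      A *m Y' *m A^T + B *m Y' *m B^T + 'i *: (A *m Y' *m B^T - B *m Y' *m A^T).
    have -> : (A + 'i *: B)^T = A^T + 'i *: B^T by rewrite raddfD /= trmx_scale.
    rewrite mulmxDr !mulmxBl -!scalemxAl -!scalemxAr scalerBr.
    move: (A *m Y' *m A^T) (B *m Y' *m A^T) (A *m Y' *m B^T) (B *m Y' *m B^T) => X1 X2 X3 X4.
    have i2 : 'i * 'i = -1 :> C by rewrite -expr2 sqr_i.
    rewrite scalerA i2; apply/matrixP => k l; rewrite !mxE; ring.
  have tB (X1 X2 : 'M[R]_1) : toC (X1 - X2) = toC X1 - toC X2 by exact: map_mxB.
  have tD (X1 X2 : 'M[R]_1) : toC (X1 + X2) = toC X1 + toC X2 by exact: map_mxD.
  by rewrite cvE {1}vE E tB tD !toCM !toCT.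
by rewrite !mxE /= mul0r mul1r subr0 addr0.
Qed.

Lemma hermitian_pos (Y : 'M[R]_n) (v : 'rV[C]_n) : posdef Y -> v != 0 ->
  0 < complex.Re ((cj v *m toC Y *m v^T) 0 0).
Proof.
move=> pY v0; rewrite Re_hermitian.
have nn (x : 'rV[R]_n) : 0 <= (x *m Y *m x^T) 0 0.
  have [->|/pY/ltW//] := eqVneq x 0; by rewrite !mul0mx mxE.
have [a0|a0] := eqVneq (map_mx (@complex.Re R) v) 0; last by rewrite ltr_wpDr // pY.
have [b0|b0] := eqVneq (map_mx (@complex.Im R) v) 0; last by rewrite ltr_wpDl // pY.
case/eqP: v0; apply/matrixP => i j; move/matrixP/(_ i j): a0; move/matrixP/(_ i j): b0.
by rewrite !mxE; case: (v i j) => x y /= -> ->.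
Qed.

Lemma two_i_neq0 : - (2 * 'i) != 0 :> C.
Proof. by rewrite oppr_eq0 mulf_neq0 ?pnatr_eq0 // eq_complex /= oner_eq0 andbF. Qed.

(** A vector annihilated by the denominator would be isotropic for the Hermitian form of the
    imaginary part of [Om], which is definite. *)
Lemma sp_den_unit g Om : siegel Om -> sp_den g Om \in unitmx.
Proof.
move=> [sO pO]; rewrite -unitmx_tr -row_free_unit -kermx_eq0; apply/negPn/negP => /rowV0Pn[v].
move=> /sub_kermxP vd v0; have dv : sp_den g Om *m v^T = 0.
  by rewrite -[LHS]trmxK trmx_mul trmxK vd trmx0.
have := hermitian_pos pO v0; have := @sp_num_den_cj g Om conjc (or_intror erefl).
rewrite -!/(cj _) (cj_tr Om) sO cj_sub => E.
have : cj v *m ((cj (sp_num g Om))^T *m sp_den g Om - (cj (sp_den g Om))^T *m sp_num g Om) *m v^T = 0.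
  rewrite mulmxBr mulmxBl -!mulmxA dv !mulmx0 mulmxA cj_tr -cjM vd.
  have -> : cj (0 : 'M[C]_(1, n)) = 0 by exact: map_mx0.
  by rewrite mul0mx subrr.
rewrite E -scalemxAr -scalemxAl => /eqP; rewrite scaler_eq0 (negPf two_i_neq0) /= => /eqP ->.
by rewrite mxE /= ltxx.
Qed.

Lemma sp_act_siegel g Om : siegel Om -> siegel (sp_act g Om).
Proof.
move=> hO; have du := sp_den_unit g hO; have [sO pO] := hO.
have sA : (sp_act g Om)^T = sp_act g Om.
  have ut : (sp_den g Om)^T \in unitmx by rewrite unitmx_tr.
  rewrite /sp_act trmx_mul trmx_inv; apply: (can_inj (mulKmx ut)).
  by rewrite mulKVmx // mulmxA -sp_num_den_sym // -mulmxA mulmxV // mulmx1.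
split=> //; set d := invmx (sp_den g Om).
(* The imaginary part of the image is Hermitian congruent to that of [Om] by the inverse
   denominator, hence again positive definite. *)
have key : toC (map_mx (@complex.Im R) (sp_act g Om)) = (cj d)^T *m toC (map_mx (@complex.Im R) Om) *m d.
  apply: (scalerI two_i_neq0); rewrite -cj_sub scalemxAl scalemxAr -cj_sub.
  have := @sp_num_den_cj g Om conjc (or_intror erefl).
  rewrite -!/(cj _) (cj_tr Om) sO => <-.
  have dd : sp_den g Om *m d = 1%:M by exact: mulmxV.
  have cd : (cj d)^T *m (cj (sp_den g Om))^T = 1%:M.
    rewrite -trmx_mul -cjM dd -[RHS]trmx1; congr (_^T); exact: map_mx1.
  rewrite mulmxBr mulmxBl -!mulmxA dd mulmx1 (mulmxA (cj d)^T (cj (sp_den g Om))^T) cd mul1mx.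
  by congr (_ - _); rewrite -{1}sA -cj_tr /sp_act cjM trmx_mul.
move=> x x0; pose v := toC x *m d^T.
have v0 : v != 0.
  apply: contra_neq x0 => v0; have : toC x = 0.
    by rewrite -[toC x]mulmx1 -trmx1 -(mulmxV du) trmx_mul mulmxA -/d -/v v0 mul0mx.
  by move=> /matrixP X0; apply/matrixP => i j; have := X0 i j; rewrite !mxE => /complexI.
have := hermitian_pos pO v0; congr (_ < _).
have -> : cj v *m toC (map_mx (@complex.Im R) Om) *m v^T =
   toC (x *m map_mx (@complex.Im R) (sp_act g Om) *m x^T).
  rewrite /toC !map_mxM -!/(toC _) key /v cjM cj_toC -cj_tr trmx_mul trmxK toCT.
  by rewrite !mulmxA.
by rewrite mxE.
Qed.

Lemma sp_col_act g Om : siegel Om ->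
  col_mx (sp_num g Om) (sp_den g Om) = col_mx (sp_act g Om) 1%:M *m sp_den g Om.
Proof.
by move=> hO; rewrite mul_col_mx mul1mx /sp_act mulmxKV // sp_den_unit.
Qed.

Lemma sp_mul_num_den g h Om : siegel Om ->
  sp_num (g * h)%g Om = sp_num g (sp_act h Om) *m sp_den h Om /\
  sp_den (g * h)%g Om = sp_den g (sp_act h Om) *m sp_den h Om.
Proof.
move=> hO; apply: eq_col_mx; rewrite -mul_col_mx -!toC_sp_col.
have -> : toC (g * h)%g = toC g *m toC h by exact: toCM.
by rewrite -mulmxA toC_sp_col sp_col_act // mulmxA.
Qed.

Lemma sp_actM g h Om : siegel Om -> sp_act (g * h)%g Om = sp_act g (sp_act h Om).
Proof.
move=> hO; have [nE dE] := sp_mul_num_den g h hO; rewrite {1}/sp_act nE dE.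
have u1 := sp_den_unit h hO; have u2 := sp_den_unit g (sp_act_siegel h hO).
by rewrite invmx_mul // mulmxA mulmxK.
Qed.

(** The matrix of the quadratic form in the first exponential of the automorphic factor. *)
Definition sp_kernel g Om : 'M[C]_n := invmx (sp_den g Om) *m toC (dlsubmx g).

Lemma sp_block_rel g :
  (ulsubmx g)^T *m dlsubmx g = (dlsubmx g)^T *m ulsubmx g /\
  (drsubmx g)^T *m ulsubmx g - (ursubmx g)^T *m dlsubmx g = 1%:M.
Proof.
have := spP g; rewrite /symplectic -{1 2}[sp_mx g]submxK => /eqP.
rewrite /symp_form tr_block_mx !mulmx_block !(mulmx0, mulmx1, mulmxN, mul0mx, add0r, addr0).
rewrite !mulNmx => /eq_block_mx[e1 e2 e3 _]; split.
  by move/eqP: e1; rewrite addrC subr_eq0 => /eqP.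
by apply: oppr_inj; rewrite -e3 opprB addrC.
Qed.

(** The additive cocycle relation behind the first exponential. It rests on the expression, proved
    as [key], of the upper left block of [h] by its denominator, its lower left block and the image
    point. *)
Lemma sp_kernel_cocycle g h Om : siegel Om ->
  sp_kernel (g * h)%g Om =
  invmx (sp_den h Om) *m sp_kernel g (sp_act h Om) *m (invmx (sp_den h Om))^T
  + sp_kernel h Om.
Proof.
move=> hO; have u1 := sp_den_unit h hO; have u2 := sp_den_unit g (sp_act_siegel h hO).
have [_ dE] := sp_mul_num_den g h hO; have [r1 r2] := sp_block_rel h.
set d := sp_den h Om in u1 dE *; set d' := sp_den g _ in u2 dE *.
have key : toC (ulsubmx h) = (invmx d)^T + sp_act h Om *m toC (dlsubmx h).
  have ut : d^T \in unitmx by rewrite unitmx_tr.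
  apply: (can_inj (mulKmx ut)); rewrite mulmxDr trmx_inv mulmxV //.
  have [sA _] := sp_act_siegel h hO.
  rewrite mulmxA -{1}sA -trmx_mul /sp_act -/d mulmxKV //.
  rewrite /d /sp_den /sp_num; have [sO _] := hO.
  rewrite ![in LHS]raddfD /= ![in RHS]raddfD /= !trmx_mul sO -!toCT !mulmxDl -!mulmxA -!toCM r1.
  rewrite addrCA; congr (_ + _).
  by rewrite -[1%:M](map_mx1 (real_complex R)) -/(toC _) -r2 /toC -map_mxD subrK.
have C_mul : toC (dlsubmx (g * h)%g) = toC (dlsubmx g) *m toC (ulsubmx h) + toC (drsubmx g) *m toC (dlsubmx h).
  rewrite -!toCM -[RHS](map_mxD (real_complex R)) -/(toC _); congr toC.
  have -> : sp_mx (g * h)%g = sp_mx g *m sp_mx h by [].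
  by rewrite -{1}[sp_mx g]submxK -{1}[sp_mx h]submxK mulmx_block block_mxKdl.
have gen (P Q Cg T W Ch Dg : 'M[C]_n) : Q *m (Cg *m W + Dg) = 1%:M ->
    P *m Q *m (Cg *m (T + W *m Ch) + Dg *m Ch) = P *m (Q *m Cg) *m T + P *m Ch.
  move=> e; rewrite (mulmxDr Cg) -addrA (mulmxA Cg W) -mulmxDl mulmxDr !mulmxA; congr (_ + _).
  by rewrite -(mulmxA P) e mulmx1.
rewrite /sp_kernel dE invmx_mul // C_mul key; apply: gen.
exact: mulVmx.
Qed.

End SiegelAction.

(** * Even matrices modulo 2 *)

Section EvenIntegral.
Variables (m : nat) (M : 'M[int]_m).
Hypotheses (sM : M^T = M) (eM : forall i, (2 %| M i i)%Z).

Lemma even_split : exists S : 'M[int]_m, M = S + S^T.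
Proof.
exists (\matrix_(i, j) if (i < j)%N then M i j else if i == j then (M i i %/ 2)%Z else 0).
apply/matrixP => i j; rewrite !mxE.
have [ij|ji|/val_inj <-] := ltngtP i j.
- by rewrite -val_eqE /= gtn_eqF // addr0.
- by rewrite -val_eqE /= gtn_eqF // add0r -{1}sM mxE.
- by rewrite eqxx; have := divzK (eM i); lia.
Qed.

(** Writing [M = S + S^T], the two halves have equal trace against a symmetric matrix. *)
Lemma even_trace (N : 'M[int]_m) : N^T = N -> (2 %| \tr (M *m N))%Z.
Proof.
move=> sN; have [S ->] := even_split; rewrite mulmxDl mxtraceD.
have -> : \tr (S^T *m N) = \tr (S *m N).
  by rewrite -[LHS]mxtrace_tr trmx_mul trmxK sN mxtrace_mulC.
by apply/dvdzP; exists (\tr (S *m N)); ring.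
Qed.

Lemma even_unimodular_size : \det M = 1 -> ~~ odd m.
Proof.
move=> dM; apply/negP => om; have [S MS] := even_split.
have dN : \det (S - S^T) = 0.
  have : \det (S - S^T) = - \det (S - S^T).
    rewrite -[in LHS]det_tr raddfB /= trmxK -opprB -scaleN1r detZ -signr_odd om /=.
    by rewrite expr1 mulN1r.
  lia.
have E : map_mx (intr : int -> 'F_2) M = map_mx intr (S - S^T).
  rewrite {1}MS map_mxD map_mxB; congr (_ + _); apply/matrixP => i j; rewrite !mxE.
  by rewrite oppr_pchar2 // pchar_Fp.
have := congr1 (fun A : 'M['F_2]_m => \det A) E.
by rewrite !det_map_mx dM dN => /eqP; rewrite rmorph1 rmorph0 oner_eq0.
Qed.

End EvenIntegral.

Lemma conj_form_add (F : comPzRingType) p q (Z : 'M[F]_(p, q)) (P K L : 'M[F]_q) :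
  Z *m (P *m K *m P^T + L) *m Z^T = (Z *m P) *m K *m (Z *m P)^T + Z *m L *m Z^T.
Proof. by rewrite mulmxDr mulmxDl trmx_mul !mulmxA. Qed.

Lemma mul_regroup (F : comPzRingType) (c e x d f y t : F) :
  c * e * x * (d * f * y * t) = c * d * (e * f) * (x * y) * t.
Proof. by ring. Qed.

(** * Theta under the symplectic group; unipotent and Levi elements *)

Section ThetaTransform.
Variables (R : realType) (n m : nat) (M : 'M[int]_m).
Local Open Scope complex_scope.
Local Notation C := R[i].
Hypotheses (sM : M^T = M) (pM : posdef (zreal R M)) (eM : forall i, (2 %| M i i)%Z).
Implicit Types (g h : sp int n) (Om : 'M[C]_n) (Z : 'M[C]_(m, n)).

Definition theta_term Om Z (x : 'M[int]_(m, n)) : C :=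
  cexp (pi_i R * \tr (ztoC R M *m (ztoC R x *m Om *m (ztoC R x)^T + (ztoC R x *m Z^T) *+ 2))).

Lemma has_sum_theta Om Z : siegel Om -> has_sum (theta_term Om Z) (theta M (Om, Z)).
Proof.
move=> hO; have := has_sum_usum (theta_summable Z sM pM hO).
by move=> h; rewrite /theta (sum_eq h).
Qed.

Lemma theta_eq Om Z s : siegel Om -> has_sum (theta_term Om Z) s -> theta M (Om, Z) = s.
Proof. by move=> /has_sum_theta - /(_ Z) h1 h2; exact: has_sum_unique h1 h2. Qed.

Lemma ztoCD p q (A B : 'M[int]_(p, q)) : ztoC R (A + B) = ztoC R A + ztoC R B.
Proof. exact: map_mxD. Qed.

Lemma ztoCM p q r (A : 'M[int]_(p, q)) (B : 'M[int]_(q, r)) :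
  ztoC R (A *m B) = ztoC R A *m ztoC R B.
Proof. exact: map_mxM. Qed.

Lemma ztoCT p q (A : 'M[int]_(p, q)) : ztoC R A^T = (ztoC R A)^T.
Proof. by apply/matrixP => i j; rewrite !mxE. Qed.

Lemma ztoC_tr p (A : 'M[int]_p) : \tr (ztoC R A) = (\tr A)%:~R.
Proof. by rewrite /mxtrace rmorph_sum; apply: eq_bigr => i _; rewrite mxE. Qed.

Lemma ztoC1 p : ztoC R (1%:M : 'M[int]_p) = 1%:M.
Proof. exact: map_mx1. Qed.

Lemma ztoC0 p q : ztoC R (0 : 'M[int]_(p, q)) = 0.
Proof. exact: map_mx0. Qed.

Lemma cexp_pi_even (d : int) : (2 %| d)%Z -> cexp (pi_i R * d%:~R) = 1.
Proof.
case/dvdzP => q ->; have -> : pi_i R * (q * 2)%:~R = pi_i R *+ 2 * q%:~R by rewrite intrM; ring.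
exact: e2pi_int.
Qed.

Lemma cexp_even_trace (N : 'M[int]_m) : N^T = N ->
  cexp (pi_i R * \tr (ztoC R M *m ztoC R N)) = 1.
Proof. by move=> sN; rewrite -ztoCM ztoC_tr cexp_pi_even // even_trace. Qed.

Definition spR g : sp R n := sp_map intr g.

Lemma spR_mul g h : spR (g * h)%g = (spR g * spR h)%g.
Proof. by apply: val_inj; exact: map_mxM. Qed.

(** The transformation law with multiplier [c] and trivial Heisenberg part. The integral power of
    the determinant replaces the power of the root, so the factor is an exact cocycle and
    multipliers multiply. *)
Definition theta_trans g (c : C) : Prop := forall Om Z, siegel Om ->
  theta M (sp_act (spR g) Om, Z *m invmx (sp_den (spR g) Om)) =
  c * cexp (pi_i R * \tr (ztoC R M *m (Z *m sp_kernel (spR g) Om *m Z^T)))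
    * \det (sp_den (spR g) Om) ^+ m./2 * theta M (Om, Z).

Lemma theta_trans_mul g h c d : theta_trans g c -> theta_trans h d -> theta_trans (g * h)%g (c * d).
Proof.
move=> hg hh Om Z hO; rewrite !spR_mul.
have hO' := sp_act_siegel (spR h) hO.
have [_ dE] := sp_mul_num_den (spR g) (spR h) hO.
have u1 := sp_den_unit (spR h) hO; have u2 := sp_den_unit (spR g) hO'.
have e1 := hg _ (Z *m invmx (sp_den (spR h) Om)) hO'; rewrite (hh Om Z hO) in e1.
rewrite sp_actM // dE invmx_mul // (mulmxA Z (invmx _)); etransitivity; first exact: e1.
rewrite sp_kernel_cocycle // det_mulmx {e1}.
rewrite conj_form_add (mulmxDr (ztoC R M)) mxtraceD mulrDr cexpD exprMn.
exact: mul_regroup.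
Qed.

Lemma siegel_iI : siegel ('i%:M : 'M[C]_n).
Proof.
split; first exact: tr_scalar_mx.
move=> x x0.
have -> : map_mx (@complex.Im R) ('i%:M : 'M[C]_n) = 1%:M.
  by apply/matrixP => i j; rewrite !mxE; case: (i == j).
rewrite mulmx1 mxE; have [i xi] : exists i, x 0 i != 0.
  apply/existsP; apply: contraNT x0 => /existsPn h; apply/eqP/matrixP => i j.
  by rewrite (ord1 i) [RHS]mxE; apply/eqP; have := h j; rewrite negbK.
rewrite (bigD1 i) //= ltr_pwDl //.
  by rewrite mxE -expr2 lt_def sqrf_eq0 xi sqr_ge0.
by apply: sumr_ge0 => j _; rewrite mxE -expr2 sqr_ge0.
Qed.

Lemma theta_iI_neq0 : theta M ('i%:M : 'M[C]_n, 0) != 0.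
Proof.
apply: (@has_sum_pos_neq0 _ _ (fun x : 'M[int]_(m, n) =>
  expR (- (pi * \tr (zreal R M *m (zreal R x *m (zreal R x)^T))))) 0).
- by move=> x; exact: expR_ge0.
- exact: expR_gt0.
- apply: eq_has_sum (has_sum_theta 0 siegel_iI) => x.
  rewrite /theta_term trmx0 mulmx0 mul0rn addr0 mul_mx_scalar -scalemxAl -scalemxAr mxtraceZ.
  rewrite !ztoCE -toCT -!toCM toC_tr pi_iE -cexp_real; congr cexp.
  by rewrite mulrACA -expr2 sqr_i mulN1r rmorphN rmorphM.
Qed.

Lemma cexp_det_neq0 g Om (z : C) : siegel Om ->
  cexp z * \det (sp_den (spR g) Om) ^+ m./2 != 0.
Proof.
move=> hO; rewrite mulf_neq0 ?cexp_neq0 // expf_neq0 //.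
by have := sp_den_unit (spR g) hO; rewrite unitmxE unitfE.
Qed.

(** Comparison at the point ['i%:M] with [Z = 0], where theta is a sum of positive terms. This
    uniqueness is what later makes the multiplier a homomorphism. *)
Lemma theta_trans_unique g c d : theta_trans g c -> theta_trans g d -> c = d.
Proof.
move=> hc hd; have := hc _ 0 siegel_iI; rewrite (hd _ 0 siegel_iI).
have nz := mulf_neq0 (cexp_det_neq0 g (pi_i R * \tr (ztoC R M *m
  (0 *m sp_kernel (spR g) 'i%:M *m 0^T))) siegel_iI) theta_iI_neq0.
move: nz; move: (cexp _) => e nz E; apply: (mulIf nz); rewrite !mulrA; exact/esym.
Qed.

Lemma sp_blocks_map g (A B D E : 'M[int]_n) : sp_mx g = block_mx A B D E ->
  forall Om, sp_num (spR g) Om = ztoC R A *m Om + ztoC R B /\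
   sp_den (spR g) Om = ztoC R D *m Om + ztoC R E /\
   sp_kernel (spR g) Om = invmx (ztoC R D *m Om + ztoC R E) *m ztoC R D.
Proof.
move=> gE Om; rewrite /sp_kernel /sp_num /sp_den /spR /= gE map_block_mx.
rewrite block_mxKul block_mxKur block_mxKdl block_mxKdr -![toC (map_mx _ _)]ztoCE.
by [].
Qed.

Lemma theta_trans_unipotent g (T : 'M[int]_n) : T^T = T ->
  sp_mx g = block_mx 1%:M T 0 1%:M -> theta_trans g 1.
Proof.
move=> sT gE Om Z hO; have [nE [dE kE]] := sp_blocks_map gE Om.
have hO' := sp_act_siegel (spR g) hO; move: hO'.
rewrite /sp_act nE kE dE !ztoC1 !ztoC0 mul1mx mul0mx add0r invmx1 !mulmx1 mulmx0 mulmx0 mul0mx.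
rewrite mulmx0 mxtrace0 mulr0 cexp0 det1 expr1n !mul1r => hO'.
apply: theta_eq hO' _; apply: eq_has_sum (has_sum_theta Z hO) => x.
rewrite /theta_term (mulmxDr (ztoC R x)) mulmxDl [in RHS]addrAC [in RHS]mulmxDr [in RHS]mxtraceD [in RHS]mulrDr cexpD.
have -> : ztoC R x *m ztoC R T *m (ztoC R x)^T = ztoC R (x *m T *m x^T).
  by rewrite !ztoCM ztoCT.
by rewrite cexp_even_trace ?mulr1 // !trmx_mul trmxK sT mulmxA.
Qed.

Lemma theta_trans_one : theta_trans 1%g 1.
Proof.
apply: (@theta_trans_unipotent _ 0); first exact: trmx0.
by rewrite /= -scalar_mx_block.
Qed.

Lemma sp_one_action Om : sp_act 1%g Om = Om /\ sp_den (1%g : sp R n) Om = 1%:M /\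
  sp_kernel (1%g : sp R n) Om = 0.
Proof.
have -> : (1%g : sp R n) = spR 1%g by apply: val_inj; rewrite /= map_mx1.
have E : sp_mx (1%g : sp int n) = block_mx 1%:M 0 0 1%:M by rewrite /= -scalar_mx_block.
have [nE [dE kE]] := sp_blocks_map E Om.
rewrite /sp_act nE kE dE !ztoC1 !ztoC0 mul1mx mul0mx add0r addr0 invmx1 !mulmx1 mulmx0.
by [].
Qed.

Lemma theta_trans_inv g c : c != 0 -> theta_trans g c -> theta_trans g^-1%g c^-1.
Proof.
move=> c0 hg Om Z hO; set h := spR g^-1%g.
have gh : (spR g * h)%g = 1%g by rewrite /h -spR_mul mulgV; apply: val_inj; rewrite /= map_mx1.
have hO' := sp_act_siegel h hO.
have [_ dE] := sp_mul_num_den (spR g) h hO.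
have kE := sp_kernel_cocycle (spR g) h hO.
have aE := sp_actM (spR g) h hO.
have [w1 [w2 w3]] := sp_one_action Om; rewrite gh w1 in aE; rewrite gh w2 in dE; rewrite gh w3 in kE.
have u1 := sp_den_unit h hO; have u2 := sp_den_unit (spR g) hO'.
have zE : Z *m invmx (sp_den h Om) *m invmx (sp_den (spR g) (sp_act h Om)) = Z.
  by rewrite -mulmxA -(invmx_mul u2 u1) -dE invmx1 mulmx1.
have := hg _ (Z *m invmx (sp_den h Om)) hO'; rewrite -aE zE.
have d1 : \det (sp_den (spR g) (sp_act h Om)) * \det (sp_den h Om) = 1.
  by rewrite -det_mulmx -dE det1.
have e1 : cexp (pi_i R * \tr (ztoC R M *m (Z *m invmx (sp_den h Om) *m
     sp_kernel (spR g) (sp_act h Om) *m (Z *m invmx (sp_den h Om))^T))) *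
   cexp (pi_i R * \tr (ztoC R M *m (Z *m sp_kernel h Om *m Z^T))) = 1.
  by rewrite -cexpD -mulrDr -mxtraceD -mulmxDr -conj_form_add -kE mulmx0 mul0mx mulmx0 mxtrace0 mulr0 cexp0.
have {}d1 : \det (sp_den (spR g) (sp_act h Om)) ^+ m./2 * \det (sp_den h Om) ^+ m./2 = 1.
  by rewrite -exprMn d1 expr1n.
rewrite mulrC in e1; rewrite mulrC in d1.
by move=> ->; rewrite mul_regroup e1 d1 mulVf // !mul1r.
Qed.

(** The series is reindexed by [x -> x *m U]. The denominator [V] has determinant 1 or -1, which
    leaves the inverse of its power as multiplier. *)
Lemma theta_trans_levi g (U V : 'M[int]_n) : U^T *m V = 1%:M ->
  sp_mx g = block_mx U 0 0 V -> exists2 c, normc c = 1 & theta_trans g c.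
Proof.
move=> UV gE; have UVt : V^T *m U = 1%:M by rewrite -[LHS]trmxK trmx_mul trmxK UV trmx1.
have VU := mulmx1C UVt.
have dV : normc (\det (ztoC R V)) = 1.
  have -> : \det (ztoC R V) = (\det V)%:~R by exact: det_map_mx.
  rewrite -intC normc_real -intr_norm.
  have := congr1 determinant UV; rewrite det_mulmx det1 => d1.
  have : (\det V %| \det U^T * \det V)%Z by rewrite dvdz_mull.
  by rewrite d1 dvdz1 -abszE => /eqP ->.
have dV0 : \det (ztoC R V) ^+ m./2 != 0 by rewrite expf_neq0 // -normc_gt0 dV.
exists (\det (ztoC R V) ^+ m./2)^-1; first by rewrite normcV normcX dV expr1n invr1.
move=> Om Z hO; have [nE [dE kE]] := sp_blocks_map gE Om.
have iV : invmx (ztoC R V) = (ztoC R U)^T.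
  have VUC : ztoC R V *m (ztoC R U)^T = 1%:M by rewrite -ztoCT -ztoCM (mulmx1C UV) ztoC1.
  by have [uV _] := mulmx1_unit VUC; apply: (can_inj (mulKmx uV)); rewrite mulmxV.
have hO' := sp_act_siegel (spR g) hO; move: hO'.
rewrite /sp_act nE kE dE !ztoC0 mul0mx add0r addr0 mulmx0 mulmx0 mul0mx mulmx0 mxtrace0 mulr0 cexp0.
rewrite mulr1 mulVf // mul1r iV => hO'.
have bij : bijective (fun x : 'M[int]_(m, n) => x *m U).
  by exists (fun x => x *m V^T) => x; rewrite -mulmxA ?VU ?UVt mulmx1.
apply: theta_eq hO' _; apply: eq_has_sum (has_sum_reindex bij (has_sum_theta Z hO)) => x.
by rewrite /theta_term ztoCM !trmx_mul trmxK !mulmxA.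
Qed.

End ThetaTransform.

(** * The inversion in the first coordinate *)

Section FirstInversion.
Variables (R : realType) (n : nat).
Local Open Scope complex_scope.
Local Notation C := R[i].
Implicit Types (Om : 'M[C]_(1 + n)).

Lemma siegel_pivot Om : siegel Om -> 0 < complex.Im (pivot Om).
Proof. by move=> [_ /posdef_pivot]; rewrite /pivot mxE. Qed.

Lemma Im_gt0_neq0 (t : C) : 0 < complex.Im t -> t != 0.
Proof. by apply: contraTneq => ->; rewrite ltxx. Qed.

Definition first_inversion : sp int (1 + n) := Sp (symplectic_coord_inversion int (ord0 : 'I_(1 + n))).

Lemma delta00 : ztoC R (delta_mx ord0 ord0 : 'M[int]_(1 + n)) = block_mx 1%:M 0 0 0.
Proof.
rewrite -[LHS]submxK; congr block_mx; apply/matrixP => i j; rewrite !mxE -!val_eqE /= ?(ord1 i) ?(ord1 j) //.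
Qed.

Lemma first_inversion_action Om : siegel Om ->
  let g := spR R first_inversion in let t := pivot Om in let b := dlsubmx Om in
  [/\ sp_den g Om = block_mx t%:M b^T 0 1%:M,
      invmx (sp_den g Om) = block_mx (t^-1)%:M (- (t^-1 *: b^T)) 0 1%:M,
      sp_act g Om = block_mx (- t^-1)%:M (t^-1 *: b^T) (t^-1 *: b) (schur Om) &
      sp_kernel g Om = block_mx (t^-1)%:M 0 0 0].
Proof.
move=> hO g t b; have t0 : t != 0 by exact/Im_gt0_neq0/siegel_pivot.
have [sO _] := hO; have OE := sym_block sO; rewrite -/t -/b in OE.
have [nE [dE kE]] := sp_blocks_map (erefl (sp_mx first_inversion)) Om.
have oneB : (1%:M : 'M[C]_(1 + n)) = block_mx 1%:M 0 0 1%:M by rewrite -scalar_mx_block.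
have zB : ztoC R (1%:M - delta_mx ord0 ord0 : 'M[int]_(1 + n)) = block_mx 0 0 0 1%:M.
  rewrite /ztoC map_mxB -!/(ztoC R _) delta00 ztoC1 oneB opp_block_mx add_block_mx.
  by rewrite subrr !oppr0 !addr0.
have zN : ztoC R (- delta_mx ord0 ord0 : 'M[int]_(1 + n)) = block_mx (- 1%:M) 0 0 0.
  by rewrite /ztoC map_mxN -/(ztoC R _) delta00 opp_block_mx !oppr0.
have d1 : sp_den g Om = block_mx t%:M b^T 0 1%:M.
  rewrite dE delta00 zB {1}OE mulmx_block !(mul0mx, mul1mx, addr0) add_block_mx.
  by rewrite !addr0 add0r.
have n1 : sp_num g Om = block_mx (- 1%:M) 0 b (drsubmx Om).
  rewrite nE zB zN {1}OE mulmx_block !(mul0mx, mul1mx, addr0, add0r) add_block_mx.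
  by rewrite !addr0 !add0r.
have i1 : invmx (sp_den g Om) = block_mx (t^-1)%:M (- (t^-1 *: b^T)) 0 1%:M.
  have E : block_mx (t^-1)%:M (- (t^-1 *: b^T)) 0 1%:M *m sp_den g Om = 1%:M.
    rewrite d1 mulmx_block !(mulmx0, mul0mx, addr0, add0r, mulmx1) -scalar_mxM mulVf //.
    by rewrite mul_scalar_mx addrC addNr oneB.
  have [_ u] := mulmx1_unit E; apply: (can_inj (mulmxK u)).
  by rewrite mulVmx // E.
split=> //.
- rewrite /sp_act n1 i1 mulmx_block !(mulmx0, mul0mx, addr0, add0r, mulmx1, mulNmx, mul1mx).
  rewrite opprK mul_mx_scalar; congr block_mx; first by rewrite raddfN.
  by rewrite /schur -/b -/t mulmxN -scalemxAr addrC.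
- rewrite /sp_kernel i1 (_ : toC _ = block_mx 1%:M 0 0 0).
    by rewrite mulmx_block !(mulmx0, mul0mx, addr0, add0r, mulmx1).
  rewrite -delta00 /g /spR /= /coord_inversion map_block_mx block_mxKdl.
  by apply/matrixP => i j; rewrite !mxE intC.
Qed.

End FirstInversion.

Section SqrtSector.
Variable R : realType.
Local Open Scope complex_scope.
Local Notation C := R[i].

(** The principal root halves the argument and so maps the right half plane into the sector. *)
Lemma sqrtc_sector (z : C) : 0 < complex.Re z -> in_sector (sqrtc z).
Proof.
have re0 : 0 <= complex.Re (sqrtc z) by case: z => a b /=; exact: sqrtr_ge0.
rewrite -{1}[z]sqr_sqrtc; move: re0; rewrite /in_sector; case: (sqrtc z) => p q /= p0 h.
have {}h : `|q| ^+ 2 < p ^+ 2 by rewrite real_normK ?num_real //; lra.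
by rewrite -(@ltr_pXn2r _ 2) ?nnegrE.
Qed.

Lemma Re_i_div (t : C) : 0 < complex.Im t -> 0 < complex.Re ('i / t).
Proof.
case: t => a b /= b0; rewrite mul0r mul1r sub0r opprK divr_gt0 //.
by rewrite ltr_wpDl ?sqr_ge0 // exprn_gt0.
Qed.

End SqrtSector.

Section ImaginaryUnit.
Variable R : realType.
Local Open Scope complex_scope.
Local Notation C := R[i].

Lemma i_sqr : 'i * 'i = -1 :> C. Proof. by rewrite -expr2 sqr_i. Qed.

Lemma i_neq0 : 'i != 0 :> C.
Proof. by rewrite eq_complex /= oner_eq0 andbF. Qed.

Lemma div_i_div (p t : C) : t != 0 -> p / ('i / t) = - ('i * p * t).
Proof.
move=> t0; have i0 := i_neq0; apply: (mulIf (_ : 'i / t != 0)).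
  by rewrite mulf_neq0 ?invr_eq0.
rewrite divfK ?mulf_neq0 ?invr_eq0 //.
have -> : - ('i * p * t) * ('i / t) = - ('i * 'i) * p * (t / t) by ring.
by rewrite i_sqr opprK mul1r divff // mulr1.
Qed.

End ImaginaryUnit.

(** * Theta under the inversion by Poisson summation in the first column *)

Section InversionTheta.
Variables (R : realType) (n m : nat) (M N : 'M[int]_m).
Local Open Scope complex_scope.
Local Notation C := R[i].
Local Notation piC := ((pi : R)%:C : C).
Hypotheses (sM : M^T = M) (pM : posdef (zreal R M)) (MN : M *m N = 1%:M).

Let bf (u v : 'M[C]_(m, 1)) : C := \tr (ztoC R M *m (u *m v^T)).
Let qf (y : 'M[int]_(m, n)) (S : 'M[C]_n) : C := \tr (ztoC R M *m (ztoC R y *m S *m (ztoC R y)^T)).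
Let lf (y : 'M[int]_(m, n)) (Z : 'M[C]_(m, n)) : C := \tr (ztoC R M *m (ztoC R y *m Z^T)).

Lemma bfC u v : bf u v = bf v u.
Proof.
rewrite /bf -[LHS]mxtrace_tr !trmx_mul trmxK -ztoCT sM mxtrace_mulC.
by rewrite mulmxA.
Qed.

Lemma bfDl u u' v : bf (u + u') v = bf u v + bf u' v.
Proof. by rewrite /bf mulmxDl mulmxDr mxtraceD. Qed.

Lemma bfZl c u v : bf (c *: u) v = c * bf u v.
Proof. by rewrite /bf -scalemxAl -scalemxAr mxtraceZ. Qed.

Lemma bfDr u v v' : bf u (v + v') = bf u v + bf u v'.
Proof. by rewrite bfC bfDl !(bfC u). Qed.

Lemma bfZr c u v : bf u (c *: v) = c * bf u v.
Proof. by rewrite bfC bfZl bfC. Qed.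

Lemma bfNl u v : bf (- u) v = - bf u v.
Proof. by rewrite -scaleN1r bfZl mulN1r. Qed.

Lemma bfNr u v : bf u (- v) = - bf u v.
Proof. by rewrite -scaleN1r bfZr mulN1r. Qed.

Lemma theta_term_row (Om : 'M[C]_(1 + n)) (z : 'M[C]_(m, 1)) (Z1 : 'M[C]_(m, n))
    (x : 'M[int]_(m, 1)) (y : 'M[int]_(m, n)) : Om^T = Om -> pivot Om != 0 ->
  let w := (pivot Om)^-1 *: (ztoC R y *m dlsubmx Om) in
  theta_term M Om (row_mx z Z1) (row_mx x y) =
  cexp (pi_i R * (pivot Om * bf (ztoC R x + w) (ztoC R x + w) + qf y (schur Om)
    + 2 * (bf (ztoC R x) z + lf y Z1))).
Proof.
move=> sO p0 w; rewrite /theta_term; congr (cexp (_ * _)).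
have -> : ztoC R (row_mx x y) = row_mx (ztoC R x) (ztoC R y) by exact: map_row_mx.
rewrite schur_form // -/w tr_row_mx mul_row_col.
rewrite mulr2n !(mulmxDr (ztoC R M)) !mxtraceD -scalemxAr mxtraceZ.
by rewrite /bf /qf /lf [2 * _]mulr_natl mulr2n.
Qed.

Definition consM (p : 'M[int]_(m, n) * 'rV[int]_m) : 'M[int]_(m, 1 + n) := row_mx p.2^T p.1.

Lemma consM_bij : bijective consM.
Proof.
exists (fun x => (rsubmx x, (lsubmx x)^T)) => [[y r]|x]; rewrite /consM /=.
  by rewrite row_mxKl row_mxKr trmxK.
by rewrite trmxK hsubmxK.
Qed.

Section Point.
Variables (Om : 'M[C]_(1 + n)) (z : 'M[C]_(m, 1)) (Z1 : 'M[C]_(m, n)).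
Hypothesis hO : siegel Om.
Let t := pivot Om.
Let b := dlsubmx Om.
Let D := drsubmx Om.
Let be : C := sqrtc ('i / t).
Let v (y : 'M[int]_(m, n)) : 'M[C]_(m, 1) := ztoC R y *m b + z.
Let rest (y : 'M[int]_(m, n)) : C := cexp (pi_i R * (qf y D + 2 * lf y Z1)).
Let g := spR R (first_inversion n).
Let Om' := sp_act g Om.
Let z' : 'M[C]_(m, 1) := t^-1 *: z.
Let Z1' : 'M[C]_(m, n) := Z1 - t^-1 *: (z *m b^T).

Lemma pt_t0 : t != 0. Proof. exact/Im_gt0_neq0/siegel_pivot. Qed.

Lemma pt_be : be ^+ 2 = 'i / t. Proof. exact: sqr_sqrtc. Qed.

Lemma pt_sector : in_sector be.
Proof. exact/sqrtc_sector/Re_i_div/siegel_pivot. Qed.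

Lemma qf_schur y : qf y (schur Om) = qf y D - t^-1 * bf (ztoC R y *m b) (ztoC R y *m b).
Proof.
rewrite /qf /schur -/t -/b -/D mulmxBr mulmxBl mulmxBr [LHS]raddfB /=; congr (_ - _).
by rewrite -scalemxAr -scalemxAl -scalemxAr mxtraceZ /bf trmx_mul !mulmxA.
Qed.

(** For fixed remaining columns [y], the first column runs over the lattice Gaussian of [M] with
    parameter [be ^+ 2 = 'i / t]; the factor [rest y] does not involve it. *)
Lemma theta_term_quad (y : 'M[int]_(m, n)) (r : 'rV[int]_m) :
  theta_term M Om (row_mx z Z1) (consM (y, r)) =
  rest y * quad_term (zreal R M) be (ztoC R M *m v y)^T r.
Proof.
have [sO _] := hO; have t0 := pt_t0.
rewrite /consM theta_term_row //= -/t -/b qf_schur.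
rewrite /rest /quad_term -cexpD pt_be; congr cexp.
have e1 : \tr (ztoC R r *m toC (zreal R M) *m (ztoC R r)^T) = bf (ztoC R r^T) (ztoC R r^T).
  by rewrite /bf ztoCT trmxK -ztoCE mulmxA [RHS]mxtrace_mulC mulmxA.
have e2 : \tr (ztoC R r *m (ztoC R M *m v y)^T^T) = bf (ztoC R r^T) (v y).
  by rewrite trmxK bfC /bf ztoCT trmxK [LHS]mxtrace_mulC -mulmxA.
rewrite e1 e2 /v !(bfDl, bfDr, bfZl, bfZr) (bfC (ztoC R y *m b) (ztoC R r^T)) pi_iE.
move: (bf _ (ztoC R r^T)) (bf (ztoC R r^T) (ztoC R y *m b)) (bf (ztoC R r^T) z) => q1 q2 q3.
move: (bf _ _) (qf y D) (lf y Z1) => q4 q5 q6.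
rewrite div_i_div //; move: (t) t0 => u u0.
by field.
Qed.

(** The Schur complement of the image point is the lower right block [D] of the original one, which
    is why the same factor [rest] appears on both sides. *)
Lemma pt_act : [/\ pivot Om' = - t^-1, dlsubmx Om' = t^-1 *: b, schur Om' = D &
  row_mx z Z1 *m invmx (sp_den g Om) = row_mx z' Z1'].
Proof.
have [_ iE aE _] := first_inversion_action hO.
have t0 := pt_t0.
have p1 : pivot Om' = - t^-1.
  have := ulsubmx_pivot Om'; rewrite {1}/Om' aE block_mxKul => /matrixP/(_ 0 0).
  by rewrite !mxE eqxx !mulr1n => <-.
have d1 : dlsubmx Om' = t^-1 *: b by rewrite /Om' aE block_mxKdl.
split=> //.
  rewrite {1}/schur p1 d1 /Om' aE block_mxKdr /schur -/t -/b -/D.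
  rewrite trmx_scale -scalemxAl -scalemxAr !scalerA invrN invrK !mulNr scaleNr opprK.
  by rewrite ?mulrA mulfV // mul1r subrK.
rewrite iE mul_row_block mulmx0 addr0 mul_mx_scalar mulmx1 mulmxN -scalemxAr addrC.
by [].
Qed.

(** The dual series belongs to the inverse [N] of [M]. Since [M] is invertible over the integers,
    [r -> - (r *m M)] permutes the lattice and turns it into a series for [M] itself. *)
Lemma theta_term_dual (y : 'M[int]_(m, n)) (r : 'rV[int]_m) :
  theta_term M Om' (row_mx z' Z1') (consM (y, r)) =
  cexp (pi_i R * (t^-1 * bf z z)) * rest y *
    dual_term (zreal R N) be (ztoC R M *m v y)^T (- (r *m M)).
Proof.
have [sO' _] := sp_act_siegel g hO; have t0 := pt_t0.
have [pE dE sE _] := pt_act.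
have p0 : pivot Om' != 0 by rewrite pE oppr_eq0 invr_eq0.
rewrite /consM theta_term_row //= pE dE sE invrN invrK.
rewrite /rest /dual_term -!cexpD pt_be; congr cexp.
have e1 : ztoC R (- (r *m M)) + (ztoC R M *m v y)^T = (v y - ztoC R r^T)^T *m ztoC R M.
  have -> : ztoC R (- (r *m M)) = - (ztoC R r *m ztoC R M) by rewrite -ztoCM; exact: map_mxN.
  have -> : (v y - ztoC R r^T)^T = (v y)^T - ztoC R r by rewrite raddfB /= ztoCT trmxK.
  by rewrite trmx_mul -ztoCT sM mulmxBl addrC.
have e2 : \tr ((v y - ztoC R r^T)^T *m ztoC R M *m toC (zreal R N) *m ((v y - ztoC R r^T)^T *m ztoC R M)^T)
   = bf (v y - ztoC R r^T) (v y - ztoC R r^T).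
  rewrite -ztoCE -(mulmxA _ (ztoC R M) (ztoC R N)) -ztoCM MN ztoC1 mulmx1.
  by rewrite trmx_mul trmxK -ztoCT sM [LHS]mxtrace_mulC /bf -mulmxA.
rewrite e1 e2.
have -> : lf y Z1' = lf y Z1 - t^-1 * bf (ztoC R y *m b) z.
  rewrite /lf /Z1' [X in _ *m (_ *m X)]raddfB /= mulmxBr mulmxBr [LHS]raddfB /=; congr (_ - _).
  by rewrite trmx_scale -!scalemxAr mxtraceZ trmx_mul trmxK /bf !mulmxA.
have -> : - t *: (ztoC R y *m (t^-1 *: b)) = - (ztoC R y *m b).
  by rewrite -scalemxAr scalerA mulNr mulfV // scaleN1r.
rewrite /z' /v.
rewrite !(bfDl, bfDr, bfZl, bfZr, bfNl, bfNr).
rewrite (bfC (ztoC R y *m b) (ztoC R r^T)) (bfC z (ztoC R r^T)) (bfC z (ztoC R y *m b)) pi_iE.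
move: (bf _ (ztoC R r^T)) (bf (ztoC R r^T) (ztoC R y *m b)) (bf (ztoC R r^T) z) => q1 q2 q3.
move: (bf (ztoC R y *m b) _) (bf _ z) (bf z z) (qf y D) (lf y Z1) => q4 q5 q6 q7 q8.
by field.
Qed.

Lemma neg_mulM_bij : bijective (fun r : 'rV[int]_m => - (r *m M)).
Proof.
have NM := mulmx1C MN.
by exists (fun r => - (r *m N)) => r; rewrite mulNmx opprK -mulmxA ?MN ?NM mulmx1.
Qed.

Lemma theta_first_inversion_pt (c : C) : c != 0 ->
  (forall (be : C) (z : 'rV[C]_m), in_sector be ->
    exists S, has_sum (quad_term (zreal R M) be z) (c * be ^+ m * S) /\
      has_sum (dual_term (zreal R N) be z) S) -> ~~ odd m ->
  theta M (Om', row_mx z' Z1') =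
  c^-1 * 'i^-1 ^+ m./2 * cexp (pi_i R * (t^-1 * bf z z)) * t ^+ m./2 * theta M (Om, row_mx z Z1).
Proof.
move=> c0 hP em.
have /choice[S hS] := fun y => hP be (ztoC R M *m v y)^T pt_sector.
have h1 := has_sum_reindex consM_bij (has_sum_theta sM pM (row_mx z Z1) hO).
have h2 := has_sum_reindex consM_bij (has_sum_theta sM pM (row_mx z' Z1') (sp_act_siegel g hO)).
set e := cexp _.
have k1 : has_sum (fun y => rest y * (c * be ^+ m * S y)) (theta M (Om, row_mx z Z1)).
  apply: has_sum_fubini h1 _ => y.
  apply: eq_has_sum (has_sumZ (rest y) (hS y).1) => r /=.
  by rewrite theta_term_quad.
have k2 : has_sum (fun y => e * rest y * S y) (theta M (Om', row_mx z' Z1')).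
  apply: has_sum_fubini h2 _ => y.
  apply: eq_has_sum (has_sumZ (e * rest y) (has_sum_reindex neg_mulM_bij (hS y).2)) => r /=.
  by rewrite theta_term_dual.
have be0 : be != 0 := in_sector_neq0 pt_sector.
have bem : be ^+ m != 0 by rewrite expf_neq0.
have k3 := has_sumZ (e / (c * be ^+ m)) k1.
have -> : theta M (Om', row_mx z' Z1') = e / (c * be ^+ m) * theta M (Om, row_mx z Z1).
  apply: has_sum_unique k2 _; apply: eq_has_sum k3 => y /=.
  move: (rest y) (S y) (e) (be ^+ m) bem => r s e' bm bm0; field.
  by rewrite c0 bm0.
(* As [m] is even, only the square of the root enters. *)
have -> : be ^+ m = 'i ^+ m./2 / t ^+ m./2.
  by rewrite -{1}(even_halfK em) -mul2n exprM pt_be expr_div_n.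
rewrite exprVn; have ik : 'i ^+ m./2 != 0 :> C by rewrite expf_neq0 // i_neq0.
have tk : t ^+ m./2 != 0 by rewrite expf_neq0 // pt_t0.
move: (e) (theta M _) ('i ^+ _) (t ^+ _) ik tk => e' th ii tt ik tk; field.
by rewrite c0 ik tk.
Qed.

End Point.
End InversionTheta.

(** The theta exponent at the translated point is the one at index [X + L], corrected by the
    automorphic exponent and two traces of [Mc] against matrices that are symmetric in the
    application; for even [M] these last two disappear in the exponential. *)
Lemma heisenberg_exponent (F : comNzRingType) (m n : nat) (Mc K : 'M[F]_m)
    (X L U Z : 'M[F]_(m, n)) (Om : 'M[F]_n) :
  Mc^T = Mc -> Om^T = Om ->
  \tr (Mc *m (X *m Om *m X^T + (X *m (Z + L *m Om + U)^T) *+ 2)) =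
  - \tr (Mc *m (L *m Om *m L^T + (L *m Z^T) *+ 2 + K + U *m L^T))
  + \tr (Mc *m ((X + L) *m Om *m (X + L)^T + ((X + L) *m Z^T) *+ 2))
  + \tr (Mc *m (K + U *m L^T)) + \tr (Mc *m (X *m U^T + (X *m U^T)^T)).
Proof.
move=> sMc sO.
have e1 : \tr (Mc *m (L *m Om *m X^T)) = \tr (Mc *m (X *m Om *m L^T)).
  by rewrite -[LHS]mxtrace_tr !trmx_mul trmxK sMc sO mxtrace_mulC !mulmxA.
have e2 : \tr (Mc *m (X *m U^T)^T) = \tr (Mc *m (X *m U^T)).
  by rewrite -[LHS]mxtrace_tr trmx_mul trmxK sMc mxtrace_mulC.
have t1 : (Z + L *m Om + U)^T = Z^T + Om *m L^T + U^T.
  by rewrite !raddfD /= trmx_mul sO.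
have t2 : (X + L)^T = X^T + L^T by rewrite raddfD.
rewrite t1 t2 !mulr2n !(mulmxDr Mc) !mxtraceD !(mulmxDl X L) !(mulmxDl (X *m Om)).
rewrite !(mulmxDr X) !(mulmxDr (X *m Om)) !(mulmxDr (L *m Om)) !(mulmxDr Mc) !mxtraceD e1 e2 !(mulmxA X).
move: (\tr (Mc *m (X *m Om *m X^T))) (\tr (Mc *m (X *m Om *m L^T))) => q1 q2.
move: (\tr (Mc *m (L *m Om *m L^T))) (\tr (Mc *m (X *m Z^T))) => q3 q4.
move: (\tr (Mc *m (L *m Z^T))) (\tr (Mc *m (X *m U^T))) => q5 q6.
move: (\tr (Mc *m K)) (\tr (Mc *m (U *m L^T))) => q7 q8.
ring.
Qed.

(** * Multipliers of all group elements and the Heisenberg action *)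

Section ThetaGroup.
Variables (R : realType) (m : nat) (M : 'M[int]_m).
Local Open Scope complex_scope.
Local Notation C := R[i].
Hypotheses (sM : M^T = M) (pM : posdef (zreal R M)) (eM : forall i, (2 %| M i i)%Z)
  (dM : \det M = 1).

Lemma theta_trans_first_inversion n : exists2 c : C, normc c = 1 & theta_trans M (first_inversion n) c.
Proof.
have MN : M *m invmx M = 1%:M by rewrite mulmxV // unitmxE dM unitr1.
have MNr : zreal R M *m zreal R (invmx M) = 1%:M by rewrite -map_mxM MN map_mx1.
have em := even_unimodular_size sM eM dM.
have sMr : (zreal R M)^T = zreal R M by rewrite /zreal matrix.map_trmx sM.
have [c0 c00 hP] := poisson_lattice sMr pM.
pose c : C := c0^-1 * 'i^-1 ^+ m./2.
have tr : theta_trans M (first_inversion n) c.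
  move=> Om Z hO; have [d1 _ _ k1] := first_inversion_action hO.
  have [_ _ _ z1] := pt_act (lsubmx Z) (rsubmx Z) hO.
  have := theta_first_inversion_pt sM pM MN (lsubmx Z) (rsubmx Z) hO c00
    (fun be z hb => hP _ be z MNr hb) em.
  rewrite -z1 hsubmxK => ->; rewrite -/c d1 det_ublock det1 mulr1 det_scalar expr1.
  congr (_ * cexp (_ * _) * _ * _).
  rewrite k1 -[Z]hsubmxK mul_row_block !(mulmx0, addr0) tr_row_mx mul_row_col mul0mx addr0.
  by rewrite mul_mx_scalar -scalemxAl -scalemxAr mxtraceZ row_mxKl.
exists c => //.
have hI := siegel_iI R (1 + n).
have := tr _ 0 hI; have [d1 _ a1 _] := first_inversion_action hI.
have p1 : pivot ('i%:M : 'M[C]_(1 + n)) = 'i by rewrite /pivot mxE eqxx.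
have dl : dlsubmx ('i%:M : 'M[C]_(1 + n)) = 0 by rewrite scalar_mx_block block_mxKdl.
have -> : sp_act (spR R (first_inversion n)) 'i%:M = 'i%:M.
  rewrite a1 p1 dl trmx0 !scaler0 /schur dl mul0mx scaler0 subr0.
  rewrite scalar_mx_block block_mxKdr; congr (block_mx _%:M _ _ _).
  by apply: (mulfI (i_neq0 R)); rewrite mulrN mulfV ?i_neq0 // i_sqr.
rewrite d1 det_ublock det1 mulr1 det_scalar expr1 p1 !mul0mx mulmx0 mxtrace0 mulr0 cexp0 mulr1.
(* At the fixed point theta cancels, leaving [1 = c * 'i ^+ m./2] and so the modulus of [c]. *)
rewrite -[LHS]mul1r => /(mulIf (theta_iI_neq0 _ sM pM))/(congr1 (@normc R)).
have ni : normc ('i : C) = 1 by rewrite /= expr0n expr1n add0r sqrtr1.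
by rewrite normcM normcX ni expr1n mulr1 normc1.
Qed.

Lemma tperm_delta n (i : 'I_(1 + n)) :
  tperm_mx ord0 i *m delta_mx ord0 ord0 *m tperm_mx ord0 i = delta_mx i i :> 'M[int]_(1 + n).
Proof.
rewrite -xrowE -xcolE; apply/matrixP => a b; rewrite !mxE.
have E x : (tperm ord0 i x == ord0) = (x == i).
  by rewrite -(inj_eq (@perm_inj _ (tperm ord0 i))) tpermK tpermL.
by rewrite !E.
Qed.

Lemma tperm_mxK n (i : 'I_(1 + n)) : tperm_mx ord0 i *m tperm_mx ord0 i = 1%:M :> 'M[int]_(1 + n).
Proof. by rewrite -perm_mxM tperm2 perm_mx1. Qed.

(** Conjugation by the Levi element of a transposition moves the first coordinate to the [i]-th.
    This Levi element is its own inverse, so it stands on both sides. *)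
Lemma theta_trans_coord_inversion n (g : sp int n) (i : 'I_n) :
  sp_mx g = coord_inversion int i -> exists2 c : C, normc c = 1 & theta_trans M g c.
Proof.
case: n g i => [|n] g i; first by case: i.
rewrite -[n.+1]/(1 + n)%N in g i *; move=> gE.
have PP : (tperm_mx ord0 i)^T *m tperm_mx ord0 i = 1%:M :> 'M[int]_(1 + n).
  by rewrite tr_tperm_mx tperm_mxK.
pose L := Sp (symplectic_levi PP).
have [d d1 hd] := theta_trans_levi sM pM PP (erefl (sp_mx L)).
have [c c1 hc] := theta_trans_first_inversion n.
exists (d * c * d); first by rewrite !normcM d1 c1 !mulr1.
have -> : g = (L * first_inversion n * L)%g.
  apply: val_inj; rewrite /= gE /coord_inversion !mulmx_block !(mul0mx, mulmx0, addr0, add0r).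
  by rewrite mulmxN mulNmx !mulmxBr !mulmxBl mulmx1 tperm_mxK tperm_delta.
exact: theta_trans_mul (theta_trans_mul hd hc) hd.
Qed.

Lemma theta_trans_exists n (g : sp int n) : exists2 c : C, normc c = 1 & theta_trans M g c.
Proof.
move: g; apply: sp_generated.
- by exists 1; [exact: normc1 | exact: theta_trans_one].
- move=> g h [c c1 hc] [d d1 hd]; exists (c * d); first by rewrite normcM c1 d1 mulr1.
  exact: theta_trans_mul.
- move=> g [c c1 hc]; exists c^-1; first by rewrite normcV c1 invr1.
  by apply: theta_trans_inv => //; rewrite -normc_gt0 c1.
- by move=> g T sT gE; exists 1; [exact: normc1 | exact: theta_trans_unipotent gE].
- by move=> g U V UV gE; exact: theta_trans_levi UV gE.
- by move=> g i gE; exact: theta_trans_coord_inversion gE.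
Qed.

Lemma theta_heisenberg n (Om : 'M[C]_n) (Z : 'M[C]_(m, n)) (l u : 'M[int]_(m, n)) (kap : 'M[int]_m) :
  siegel Om -> (kap + u *m l^T)^T = kap + u *m l^T ->
  theta M (Om, Z + ztoC R l *m Om + ztoC R u) =
  cexp (- pi_i R * \tr (ztoC R M *m (ztoC R l *m Om *m (ztoC R l)^T + (ztoC R l *m Z^T) *+ 2
     + ztoC R kap + ztoC R u *m (ztoC R l)^T))) * theta M (Om, Z).
Proof.
move=> hO sk; apply: (theta_eq sM pM hO).
have bij : bijective (fun x : 'M[int]_(m, n) => x + l).
  by exists (fun x => x - l) => x; [exact: addrK | exact: subrK].
apply: eq_has_sum (has_sumZ _ (has_sum_reindex bij (has_sum_theta sM pM Z hO))) => x.
have sMc : (ztoC R M)^T = ztoC R M by rewrite -ztoCT sM.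
rewrite [RHS]/theta_term (heisenberg_exponent (ztoC R kap) (ztoC R x) (ztoC R l) _ _ sMc (proj1 hO)).
rewrite /theta_term ztoCD.
have -> : ztoC R kap + ztoC R u *m (ztoC R l)^T = ztoC R (kap + u *m l^T).
  by rewrite -ztoCT -ztoCM -ztoCD.
have -> : ztoC R x *m (ztoC R u)^T + (ztoC R x *m (ztoC R u)^T)^T =
   ztoC R (x *m u^T + (x *m u^T)^T).
  by rewrite -!ztoCT -!ztoCM -!ztoCT -ztoCD.
have e1 := cexp_even_trace R sM eM sk.
have e2 : cexp (pi_i R * \tr (ztoC R M *m ztoC R (x *m u^T + (x *m u^T)^T))) = 1.
  by apply: (cexp_even_trace R sM eM); rewrite raddfD /= trmxK addrC.
move: (\tr _) (\tr _) e1 (\tr _) (\tr _) e2 => a b e1 d f e2.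
rewrite !(mulrDr (pi_i R)) !cexpD e1 e2 !mulr1.
by rewrite mulrN -mulNr.
Qed.

End ThetaGroup.

Lemma jfactor_base_neq0 (R : realType) (n m : nat) (M : 'M[int]_m) (x : jacobi int n m)
    (Om : 'M[R[i]]_n) (Z : 'M[R[i]]_(m, n)) :
  siegel Om -> jfactor M (jacobi_map intr x) (Om, Z) != 0.
Proof.
move=> hO; apply: mulf_neq0; first by apply: mulf_neq0; exact: cexp_neq0.
apply: expf_neq0; rewrite sqrtc_eq0.
by have := sp_den_unit (spR R (jsp x)) hO; rewrite unitmxE unitfE.
Qed.


(** The element acts by first translating [Z] to [W] through the Heisenberg part and then applying
    [g] to [(Om, W)]; the automorphic factor is the product of the two corresponding factors. *)
Lemma theta_jacobi (R : realType) (n m : nat) (M : 'M[int]_m) (g : sp int n) (h : heis int n m)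
    (c : R[i]) (Om : 'M[R[i]]_n) (Z : 'M[R[i]]_(m, n)) :
  M^T = M -> posdef (zreal R M) -> (forall i, (2 %| M i i)%Z) -> ~~ odd m ->
  theta_trans M g c -> siegel Om ->
  theta M (jacobi_act (jacobi_map intr (Jacobi g h)) (Om, Z)) =
  c * jfactor M (jacobi_map intr (Jacobi g h)) (Om, Z) * theta M (Om, Z).
Proof.
move=> sM pM eM em hg hO.
pose W := Z + ztoC R (hlam h) *m Om + ztoC R (hmu h).
have sk : (hkap h + hmu h *m (hlam h)^T)^T = hkap h + hmu h *m (hlam h)^T.
  by case: h @W => -[[l u] k] hk _; exact/eqP.
have actE : jacobi_act (jacobi_map intr (Jacobi g h)) (Om, Z) =
    (sp_act (spR R g) Om, W *m invmx (sp_den (spR R g) Om)).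
  by rewrite /W !ztoCE.
have facE : jfactor M (jacobi_map intr (Jacobi g h)) (Om, Z) =
    cexp (pi_i R * \tr (ztoC R M *m W *m invmx (sp_den (spR R g) Om)
        *m toC (dlsubmx (spR R g)) *m W^T))
  * cexp (- pi_i R * \tr (ztoC R M *m (ztoC R (hlam h) *m Om *m (ztoC R (hlam h))^T
        + (ztoC R (hlam h) *m Z^T) *+ 2 + ztoC R (hkap h)
        + ztoC R (hmu h) *m (ztoC R (hlam h))^T)))
  * sqrtc (\det (sp_den (spR R g) Om)) ^+ m.
  by rewrite /W (ztoCE _ (hlam h)) (ztoCE _ (hmu h)) (ztoCE _ (hkap h)).
have kerE : \tr (ztoC R M *m W *m invmx (sp_den (spR R g) Om)
      *m toC (dlsubmx (spR R g)) *m W^T) =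
    \tr (ztoC R M *m (W *m sp_kernel (spR R g) Om *m W^T)).
  rewrite /sp_kernel; move: (ztoC R M) (invmx _) (toC _) W^T => A B D E.
  by rewrite !mulmxA.
have detE : sqrtc (\det (sp_den (spR R g) Om)) ^+ m = \det (sp_den (spR R g) Om) ^+ m./2.
  by rewrite -{1}(even_halfK em) -mul2n exprM sqr_sqrtc.
have hW := theta_heisenberg sM pM eM Z hO sk.
rewrite -/W in hW.
rewrite actE facE kerE detE; move: (hg Om W hO) hW => -> ->.
move: (cexp _) (cexp _) (\det _ ^+ _) (theta _ _) => a b d t.
ring.
Qed.
Theorem theorem6p1 (R : realType) (n m : nat) (hn : (0 < n)%N) (hm : (0 < m)%N)
    (M : 'M[int]_m)
    (Mpos : posdef (map_mx intr M : 'M[R]_m))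
    (Munimodular : \det M = 1)
    (Meven : even_integral M) :
  exists! rho : jacobi int n m -> R[i],
    [/\ character rho,
        forall gam, `|rho gam| ^+ 8 = 1 &
        forall (gam : jacobi int n m) (Omega : 'M[R[i]]_n) (Z : 'M[R[i]]_(m, n)),
          siegel Omega ->
          theta M (jacobi_act (jacobi_map intr gam) (Omega, Z)) =
          rho gam * jfactor M (jacobi_map intr gam) (Omega, Z)
            * theta M (Omega, Z)].
Proof.
have sM : M^T = M by case: Meven.
have eM : forall i, (2 %| M i i)%Z by case: Meven.
have em := even_unimodular_size sM eM Munimodular.
have /choice[c hc] : forall g : sp int n, exists c : R[i], normc c = 1 /\ theta_trans M g c.
  by move=> g; have [c c1 h] := theta_trans_exists sM Mpos eM Munimodular g; exists c.
have th0 := theta_iI_neq0 n sM Mpos.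
have key (gam : jacobi int n m) (Om : 'M[R[i]]_n) (Z : 'M[R[i]]_(m, n)) : siegel Om ->
    theta M (jacobi_act (jacobi_map intr gam) (Om, Z)) =
    c (jsp gam) * jfactor M (jacobi_map intr gam) (Om, Z) * theta M (Om, Z).
  move=> hO; case: gam => g h.
  exact: (theta_jacobi _ _ sM Mpos eM em (hc g).2 hO).
exists (fun gam => c (jsp gam)); split; first split.
- split=> [x|x y].
    by have [c1 _] := hc (jsp x); rewrite -normc_gt0 c1.
  (* The product of two multipliers is a multiplier of the product, hence the chosen one. *)
  exact: (theta_trans_unique sM Mpos (hc _).2 (theta_trans_mul (hc _).2 (hc _).2)).
- by move=> gam; rewrite normcE_norm (hc _).1 expr1n.
- exact: key.
move=> rho [_ _ hrho]; apply: funext => gam.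
have hI := siegel_iI R n.
(* At [('i%:M, 0)] both theta and the automorphic factor are nonzero, so the functional equation
   determines [rho gam]. *)
have := hrho gam _ 0 hI; rewrite key // => /(mulIf th0)/(mulIf (jfactor_base_neq0 M gam 0 hI)).
by [].
Qed.
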